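(* Let $(\mathbb{E},\langle\,,\rangle,\rho,[\,,])$ be a curved Courant algebroid over $M$ with curvature $F\in\Gamma(\wedge^2\mathbb{E}^*\otimes TM)$, where $\mathbb{E}=TM\oplus E$ for a vector bundle $E\to M$, and let $\nabla$ be a vector bundle connection on $E$ with curvature $R_\nabla\in\Omega^2(M,\mathrm{End}\,E)$. Then the Courant algebroid lift $(TE,g_\nabla,\rho_\nabla,[\,,]_\nabla)$ is a curved Courant algebroid with curvature $F_\nabla\in\Omega^2(E,TE)$ given, for $a,b\in\Gamma(\mathbb{E})$, by $$F_\nabla(\phi a,\phi b)=F(a,b)^{h}+R_\nabla(\rho(a),\rho(b))^{\upsilon}.$$
   Context: Everything is smooth. A tuple $(\mathbb{E},\langle\,,\rangle,\rho,[\,,])$ over $M$ consists of a vector bundle $\mathbb{E}\to M$, a non-degenerate symmetric pairing $\langle\,,\rangle\in\Gamma(\mathrm{Sym}^2\mathbb{E}^* )$, a vector bundle morphism $\rho:\mathbb{E}\to TM$ over $\mathrm{id}_M$ (the anchor), and an $\mathbb{R}$-bilinear bracket on $\Gamma(\mathbb{E})$. Define $\rho^*:T^*M\to\mathbb{E}$ by $\langle\rho^*\alpha,b\rangle=\alpha(\rho(b))$. Properties (for $a,b,c\in\Gamma(\mathbb{E})$, $f\in C^\infty(M)$): (Ca1) $[a,b]+[b,a]=\rho^*d\langle a,b\rangle$; (Ca2) $\rho(a)\langle b,c\rangle=\langle[a,b],c\rangle+\langle b,[a,c]\rangle$; (Ca4) $[a,fb]=(\rho(a)f)b+f[a,b]$;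 (Ca5) $[fa,b]=-(\rho(b)f)a+f[a,b]+\langle a,b\rangle\rho^*df$. A metric algebroid satisfies (Ca1), (Ca2) (hence (Ca4), (Ca5) automatically). A curved Courant algebroid is a metric algebroid for which $F(a,b):=\rho([a,b])-[\rho(a),\rho(b)]_{\mathrm{Lie}}$ satisfies $F\in\Gamma(\wedge^2\mathbb{E}^*\otimes TM)$ and $F(a,b)=0$ whenever $a\in\ker\rho$ (pointwise); $F$ is its curvature. Courant algebroid lift: let $\mathbb{E}=TM\oplus E$ with $\mathrm{pr}:E\to M$ a vector bundle, the tuple satisfying (Ca4) and (Ca5), and $\nabla$ a connection on $E$. For $X\in\mathfrak{X}(M)$ let $X^{h}\in\mathfrak{X}(E)$ be its horizontal lift with respect to $\nabla$; for $\varphi\in\Gamma(E)$ let $\varphi^{v}\in\mathfrak{X}(E)$ be its vertical lift, $\varphi^v_q=\frac{d}{dt}|_{t=0}(q+t\varphi_{\mathrm{pr}(q)})$. Set $\phi:\Gamma(\mathbb{E})\to\mathfrak{X}(E)$, $\phi(X+\varphi)=X^h+\varphi^v$; its image locally generates $\mathfrak{X}(E)$. The lift is the tuple $(TE,g_\nabla,\rho_\nabla,[\,,]_\nabla)$ over the manifold $E$, where $g_\nabla$ is the unique pairing on $TE$ with $g_\nabla(\phi a,\phi b)=\mathrm{pr}^*\langle a,b\rangle$, $\rho_\nabla:TE\to TE$ is the unique vector bundle endomorphism with $\rho_\nabla(\phi a)=\phi(\rho(a))=\rho(a)^h$, and $[\,,]_\nabla$ is the unique bracket on $\mathfrak{X}(E)$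 with $[\phi a,\phi b]_\nabla=\phi[a,b]$ such that $(TE,g_\nabla,\rho_\nabla,[\,,]_\nabla)$ satisfies (Ca4) and (Ca5). For $A\in\Gamma(\mathrm{End}\,E)$, $A^\upsilon\in\mathfrak{X}(E)$ is the vertical vector field $A^\upsilon_q=\frac{d}{dt}|_{t=0}(q+tA(q))$; in fibre coordinates $v^\mu$ it is $v^\nu(\mathrm{pr}^*A^\mu_\nu)\partial_{v^\mu}$. Curvature convention: $R_\nabla(X,Y)\varphi=\nabla_X\nabla_Y\varphi-\nabla_Y\nabla_X\varphi-\nabla_{[X,Y]_{\mathrm{Lie}}}\varphi$. *)

(* Defs.v *)
From HB Require Import structures.
From mathcomp Require Import all_boot all_order all_algebra.
From mathcomp Require Import all_classical all_reals all_analysis.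

Set Implicit Arguments.
Unset Strict Implicit.
Unset Printing Implicit Defensive.

Import Order.TTheory GRing.Theory Num.Theory.
Import numFieldNormedType.Exports.

Local Open Scope classical_set_scope.
Local Open Scope ring_scope.

(* Operations on functions, vector fields and sections are total functions on
   all set-theoretic maps; only their values on smooth arguments matter, and
   every axiom below is restricted to smooth arguments. *)

Section Manifolds.
Context {R : realType}.

(* C^oo on U: all iterated directional derivatives exist and are Frechet
   differentiable, hence continuous, at the points of U (U will be open). *)
Definition smooth_on (V W : normedModType R) (U : set V) (f : V -> W) :=
  forall (vs : seq V) (x : V), U x ->
    differentiable (foldr (fun v (g : V -> W) => 'D_v g) f vs) x.

(* cmap and cinv are only meaningful on cdom and cimg respectively. *)
Record chart (M : Type) (n : nat) := Chart {
  cdom : set M;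
  cmap : M -> 'rV[R]_n;
  cinv : 'rV[R]_n -> M }.

Definition cimg (M : Type) (n : nat) (c : chart M n) : set 'rV[R]_n :=
  cmap c @` cdom c.

Definition is_chart (M : topologicalType) (n : nat) (c : chart M n) :=
  [/\ open (cdom c), open (cimg c),
      forall x, cdom c x -> cinv c (cmap c x) = x,
      forall x, cdom c x -> {for x, continuous (cmap c)} &
      forall y, cimg c y -> {for y, continuous (cinv c)}].

Definition compatible (M : topologicalType) (n : nat) (c d : chart M n) :=
  smooth_on (cmap c @` (cdom c `&` cdom d)) (cmap d \o cinv c) /\
  smooth_on (cmap d @` (cdom c `&` cdom d)) (cmap c \o cinv d).

Record manifold (n : nat) := Manifold {
  mcar :> topologicalType;
  mhausdorff : hausdorff_space mcar;
  mcountable : @second_countable mcar;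
  atlas : set (chart mcar n);
  atlas_chart : forall c, atlas c -> is_chart c;
  atlas_cover : forall x, exists2 c, atlas c & cdom c x;
  atlas_compatible : forall c d, atlas c -> atlas d -> compatible c d;
  atlas_maximal : forall c, is_chart c ->
    (forall d, atlas d -> compatible c d) -> atlas c }.

Definition smooth_fun (n : nat) (M : manifold n) (f : M -> R) :=
  forall c, atlas c -> smooth_on (cimg c) (f \o cinv c : 'rV[R]_n -> R^o).

Definition smooth_map (m n : nat) (N : manifold m) (M : manifold n)
    (f : N -> M) :=
  continuous f /\
  forall (c : chart N m) (d : chart M n), atlas c -> atlas d ->
    smooth_on (cmap c @` (cdom c `&` f @^-1` cdom d))
              (cmap d \o f \o cinv c).

Section Tangent.
Context {n : nat} {M : manifold n}.

(* T_xM as the space of derivations of C^oo(M) at x. A derivation is extended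
   by 0 to the non-smooth functions, so that equality of tangent vectors is
   equality of their actions on smooth functions. *)
Definition derivation_at (x : M) (D : (M -> R) -> R^o) : Prop :=
  [/\ forall (r : R) f g, smooth_fun f -> smooth_fun g ->
        D (fun y => r * f y + g y) = r * D f + D g,
      forall f g, smooth_fun f -> smooth_fun g ->
        D (fun y => f y * g y) = D f * g x + f x * D g &
      forall f, ~ smooth_fun f -> D f = 0].

Definition derivations (x : M) : {pred (M -> R) -> R^o} :=
  fun D => `[< derivation_at x D >].

Lemma derivations_submod (x : M) : submod_closed (derivations x).
Proof.
split.
  apply/asboolP; split=> [r f g _ _|f g _ _|f _]; rewrite /GRing.zero /=.
  - by rewrite mulr0 addr0.
  - by rewrite mul0r mulr0 addr0.
  - by [].
move=> s D1 D2 /asboolP[l1 p1 z1] /asboolP[l2 p2 z2].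
have E f : (s *: D1 + D2) f = s * D1 f + D2 f by [].
apply/asboolP; split=> [r f g sf sg|f g sf sg|f sf]; rewrite !E.
- rewrite l1 // l2 // !mulrDr !mulrA [s * r]mulrC -!addrA; congr (_ + _).
  by rewrite addrCA.
- rewrite p1 // p2 // !mulrDr !mulrDl !mulrA [s * f x]mulrC -!addrA.
  by congr (_ + _); rewrite addrCA.
- by rewrite z1 // z2 // mulr0 addr0.
Qed.

HB.instance Definition _ (x : M) :=
  GRing.isSubmodClosed.Build R _ (derivations x) (derivations_submod x).

Record tangent (x : M) := Tangent {
  tval :> (M -> R) -> R^o;
  tvalP : tval \in derivations x }.

HB.instance Definition _ (x : M) := [isSub for @tval x].
HB.instance Definition _ (x : M) := [Choice of tangent x by <:].
HB.instance Definition _ (x : M) :=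
  [SubChoice_isSubLmodule of tangent x by <:].

(* The tangent vector at x acting on smooth functions as D (0 if none). *)
Definition tangent_of (x : M) (D : (M -> R) -> R) : tangent x :=
  xget 0 [set w : tangent x | forall f, smooth_fun f -> w f = D f].

End Tangent.
End Manifolds.

Arguments manifold : clear implicits.
Arguments tangent {R n M} x.

Section Algebroids.
Context {R : realType}.

(* A vector bundle presented by its fibres and its smooth sections, which is
   all that the algebroid axioms refer to. It is used below for TM, for the
   sections of a vector bundle and for Whitney sums of these. *)
Record vfamily (n : nat) (M : manifold R n) := VFamily {
  fib :> M -> lmodType R;
  smooth_sec : set (forall x, fib x) }.

Definition tangent_bundle (n : nat) (M : manifold R n) : vfamily M :=
  @VFamily n M (fun x => tangent x)
    [set X | forall f, smooth_fun f -> smooth_fun (fun x => X x f)].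

Definition whitney_sum (n : nat) (M : manifold R n) (V W : vfamily M) :
    vfamily M :=
  @VFamily n M (fun x => (V x * W x)%type)
    [set a | @smooth_sec n M V (fun x => (a x).1) /\
             @smooth_sec n M W (fun x => (a x).2)].

Section Tuples.
Context {n : nat} {M : manifold R n}.

Definition lie (X Y : forall x : M, tangent x) (x : M) : tangent x :=
  tangent_of x (fun f => X x (fun y => Y y f) - Y x (fun y => X y f)).

Variable V : vfamily M.
Local Notation section := (forall x, fib V x).

Record algebroid_tuple := AlgebroidTuple {
  pairing : forall x, V x -> V x -> R;
  anchor : forall x, V x -> tangent x;
  bracket : section -> section -> section }.

Variable A : algebroid_tuple.
Local Notation smooth := (@smooth_sec n M V).
Local Notation "<< a , b >>" := (fun x => pairing A (a x) (b x)).
Local Notation rho a := (fun x => anchor A (a x)).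

Definition is_tuple : Prop :=
  [/\ [/\ forall x (u : V x), scalar (pairing A u),
          forall x (u v : V x), pairing A u v = pairing A v u,
          forall x (u : V x), (forall v, pairing A u v = 0) -> u = 0 &
          forall a b, smooth a -> smooth b -> smooth_fun << a, b >>],
      (forall x, linear (@anchor A x)) /\
      (forall a, smooth a -> smooth_sec (v := tangent_bundle M) (rho a)) &
      [/\ forall a b, smooth a -> smooth b -> smooth (bracket A a b),
          forall (r : R) a b c, smooth a -> smooth b -> smooth c -> forall x,
            bracket A (fun y => r *: a y + b y) c x =
            r *: bracket A a c x + bracket A b c x &
          forall (r : R) a b c, smooth a -> smooth b -> smooth c -> forall x,
            bracket A a (fun y => r *: b y + c y) x =
            r *: bracket A a b x + bracket A a c x]].

(* rho^* alpha for a covector alpha at x. *)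
Definition anchor_dual (x : M) (alpha : tangent x -> R) : V x :=
  xget 0 [set u | forall v, pairing A u v = alpha (anchor A v)].

Definition rho_star_d (f : M -> R) (x : M) : V x :=
  anchor_dual (fun u : tangent x => u f).

Definition Ca1 : Prop := forall a b, smooth a -> smooth b -> forall x,
  bracket A a b x + bracket A b a x = rho_star_d << a, b >> x.

Definition Ca2 : Prop :=
  forall a b c, smooth a -> smooth b -> smooth c -> forall x,
  rho a x << b, c >> = << bracket A a b, c >> x + << b, bracket A a c >> x.

Definition Ca4 : Prop :=
  forall a b f, smooth a -> smooth b -> smooth_fun f -> forall x,
  bracket A a (fun y => f y *: b y) x =
  rho a x f *: b x + f x *: bracket A a b x.

Definition Ca5 : Prop :=
  forall a b f, smooth a -> smooth b -> smooth_fun f -> forall x,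
  bracket A (fun y => f y *: a y) b x =
  - (rho b x f *: a x) + f x *: bracket A a b x
  + << a, b >> x *: rho_star_d f x.

Definition metric_algebroid : Prop := [/\ is_tuple, Ca1 & Ca2].

(* F is a section of wedge^2 V^* (x) TM. *)
Definition TM_valued_2form (F : forall x, V x -> V x -> tangent x) : Prop :=
  [/\ forall x (u : V x), linear (F x u),
      forall x (u v : V x), F x u v = - F x v u &
      forall a b, smooth a -> smooth b ->
        smooth_sec (v := tangent_bundle M) (fun x => F x (a x) (b x))].

(* A is a curved Courant algebroid with curvature F. *)
Definition curved_courant (F : forall x, V x -> V x -> tangent x) : Prop :=
  [/\ metric_algebroid,
      TM_valued_2form F,
      forall a b, smooth a -> smooth b -> forall x,
        F x (a x) (b x) = rho (bracket A a b) x - lie (rho a) (rho b) x &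
      forall x (u v : V x), anchor A u = 0 -> F x u v = 0].

End Tuples.
End Algebroids.

Section Bundles.
Context {R : realType}.

(* A smooth vector bundle of rank k. The fibre over x is identified with the
   vector space bfib x by v |-> bpt x v, with inverse q |-> bvec q. In blocal,
   (v, a) |-> sum_i a_i e_i(x) is a local trivialisation over the domain of c,
   and C is the chart of the total space with coordinates (x^1 .. x^n, a). *)
Record vector_bundle (n : nat) (M : manifold R n) (k : nat) := VectorBundle {
  tot : manifold R (n + k);
  bproj : tot -> M;
  bfib : M -> lmodType R;
  bpt : forall x, bfib x -> tot;
  bvec : forall q, bfib (bproj q);
  bproj_smooth : smooth_map bproj;
  bproj_pt : forall x (v : bfib x), bproj (bpt v) = x;
  bpt_inj : forall x, injective (@bpt x);
  bptK : forall q, bpt (bvec q) = q;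
  blocal : forall x0 : M,
    exists (c : chart M n) (e : 'I_k -> forall x, bfib x)
           (C : chart tot (n + k)),
    [/\ atlas c /\ cdom c x0,
        forall x, cdom c x -> forall v : bfib x,
          exists! a : 'rV[R]_k, v = \sum_(i < k) a 0 i *: e i x,
        atlas C /\ cdom C = bproj @^-1` cdom c &
        forall x (a : 'rV[R]_k), cdom c x ->
          cmap C (bpt (\sum_(i < k) a 0 i *: e i x)) = row_mx (cmap c x) a] }.

Definition bundle_family (n : nat) (M : manifold R n) (k : nat)
    (E : vector_bundle M k) : vfamily M :=
  @VFamily R n M (bfib E)
    [set s | smooth_map (fun x => bpt (s x) : tot E)].

Section Connection.
Context {n : nat} {M : manifold R n} {k : nat} (E : vector_bundle M k).
Local Notation smooth := (smooth_sec (v := bundle_family E)).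
Local Notation smooth_vf := (smooth_sec (v := tangent_bundle M)).

Definition covariant :=
  forall x : M, tangent x -> (forall y, bfib E y) -> bfib E x.

Definition is_connection (nabla : covariant) : Prop :=
  [/\ forall x s, smooth s -> linear (fun u : tangent x => nabla x u s),
      forall x (u : tangent x) (r : R) s t, smooth s -> smooth t ->
        nabla x u (fun y => r *: s y + t y) = r *: nabla x u s + nabla x u t,
      forall x (u : tangent x) f s, smooth_fun f -> smooth s ->
        nabla x u (fun y => f y *: s y) = u f *: s x + f x *: nabla x u s &
      forall X s, smooth_vf X -> smooth s ->
        smooth (fun x => nabla x (X x) s)].

(* Rn is the curvature of nabla, an End(E)-valued 2-form. *)
Definition is_connection_curvature (nabla : covariant)
    (Rn : forall x : M, tangent x -> tangent x -> bfib E x -> bfib E x) :=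
  forall X Y s, smooth_vf X -> smooth_vf Y -> smooth s -> forall x,
    Rn x (X x) (Y x) (s x) =
      nabla x (X x) (fun y => nabla y (Y y) s)
      - nabla x (Y x) (fun y => nabla y (X y) s)
      - nabla x (lie X Y x) s.

(* Vertical lift of w in the fibre through q: d/dt (q + t w) at t = 0. *)
Definition vert (q : tot E) (w : bfib E (bproj q)) : tangent q :=
  tangent_of q (fun f =>
    derive1 (fun t : R => f (bpt (bvec q + t *: w)) : R^o) 0).

(* Horizontal lift of u to q: the vector ds(u), for a section s through q
   with nabla_u s = 0. *)
Definition hor (nabla : covariant) (q : tot E) (u : tangent (bproj q)) :
    tangent q :=
  xget 0 [set w : tangent q | exists s : forall x, bfib E x,
    [/\ smooth s, s (bproj q) = bvec q, nabla (bproj q) u s = 0 &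
        forall f, smooth_fun f -> w f = u (fun x => f (bpt (s x)))]].

Definition TM_plus_E : vfamily M :=
  whitney_sum (tangent_bundle M) (bundle_family E).

Definition phi (nabla : covariant) (a : forall x, TM_plus_E x) (q : tot E) :
    tangent q :=
  hor nabla (a (bproj q)).1 + vert (a (bproj q)).2.

Definition is_lift (A : algebroid_tuple TM_plus_E) (nabla : covariant)
    (L : algebroid_tuple (tangent_bundle (tot E))) : Prop :=
  [/\ is_tuple L,
      forall a b, smooth_sec a -> smooth_sec b -> forall q,
        pairing L (phi nabla a q) (phi nabla b q) =
        pairing A (a (bproj q)) (b (bproj q)),
      forall a, smooth_sec a -> forall q,
        anchor L (phi nabla a q) = hor nabla (anchor A (a (bproj q))),
      forall a b, smooth_sec a -> smooth_sec b -> forall q,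
        bracket L (phi nabla a) (phi nabla b) q =
        phi nabla (bracket A a b) q &
      Ca4 L /\ Ca5 L].

End Connection.
End Bundles.

(* Main.v *)
Require Import Defs.
From HB Require Import structures.
From mathcomp Require Import all_boot all_order all_algebra.
From mathcomp Require Import all_classical all_reals all_analysis.
From mathcomp Require Import ring lra.

Set Implicit Arguments.
Unset Strict Implicit.
Unset Printing Implicit Defensive.

Import Order.TTheory GRing.Theory Num.Theory.
Import numFieldNormedType.Exports.

Local Open Scope classical_set_scope.
Local Open Scope ring_scope.

(** Each axiom of a curved Courant algebroid holds for the lift because it holds
    on the fields [phi a], where it is the axiom of [A] read through [phi], and
    because its failure is a tensor. By (Ca4) and (Ca5) the defects of (Ca1) and
    (Ca2) are linear over smooth functions in every argument, so their value at
    [q] only depends on the values at [q] of their arguments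
    ([tensor_pointwise]); and every tangent vector at [q] is of the form
    [phi a q] ([phi_onto]).

    For the curvature [F(a,b) = rho [a,b] - [rho a, rho b]] tensoriality in the
    first argument has an obstruction, [<a,b> rho(rho^* df)]. It vanishes for [A],
    precisely because the curvature of [A] is assumed to be a tensor
    ([curved_rho_star0]). It then vanishes for the lift, because the anchor of
    the lift is horizontal and the restriction of a differential to the
    horizontal vectors at a point comes from the base ([lift_rho_star0]). Hence
    the curvature of the lift is a 2-form determined by its values on the fields
    [phi a], and the formula reduces to the classical identity
    [[X^h, Y^h] = [X,Y]^h - R(X,Y)^v] ([lie_hor]). From the formula, the
    curvature vanishes when the anchor of one argument does: horizontal lifting
    is injective, and both [F] and the curvature of [nabla] then vanish.

    Identities between vectors tangent to the total space are checked on
    functions pulled back from the base and on fibrewise linear functions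
    ([tot_tangent_eq]). A horizontal lift acts on the former through the base
    vector and on the latter through the dual connection; a vertical lift kills
    the former and evaluates the latter.

    Tangent vectors being derivations of the algebra of global functions, these
    arguments rest on two facts: derivations are local, by means of bump
    functions built from [exp(-1/t)] ([bump_manifold]), and they are determined
    by their values on coordinates, by Hadamard's lemma ([hadamard],
    [coordinate_frame]). In particular tangent spaces are finite dimensional,
    which gives the existence of [rho^*] ([riesz_finite]). *)

(** * Smooth functions on open subsets of normed spaces *)

Section Calculus.
Context {R : realType} {V : normedModType R}.

(** The order is shifted: [Ck U 0] already asks for differentiability on [U].
    The derivative taken first is the innermost one, the form under which the
    Leibniz and chain rules pass through an induction on the order. *)
Fixpoint Ck (W : normedModType R) (U : set V) (j : nat) (f : V -> W) : Prop :=
  if j is j'.+1 then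
    (forall x, U x -> differentiable f x) /\
    forall v, Ck U j' (fun x => 'D_v f x)
  else forall x, U x -> differentiable f x.

Lemma smooth_onP (W : normedModType R) (U : set V) (f : V -> W) :
  smooth_on U f <-> forall j, Ck U j f.
Proof.
split=> [sf j|].
  elim: j f sf => [|j IH] f sf /=; first by move=> x Ux; exact: (sf [::] x Ux).
  split=> [x Ux|v]; first exact: (sf [::] x Ux).
  by apply: IH => vs x Ux; have := sf (rcons vs v) x Ux; rewrite foldr_rcons.
move=> H vs; elim/last_ind: vs f H => [|vs v IH] f H x Ux.
  exact: H 0%N x Ux.
rewrite foldr_rcons; apply: IH Ux => j; exact: (H j.+1).2.
Qed.

Lemma Ck_diff (W : normedModType R) (U : set V) j (f : V -> W) x :
  Ck U j f -> U x -> differentiable f x.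
Proof. by case: j => [|j] H Ux; [exact: H|exact: H.1]. Qed.

Lemma CkS (W : normedModType R) (U : set V) j (f : V -> W) :
  Ck U j.+1 f -> Ck U j f.
Proof.
elim: j f => [|j IH] f [df Df] //=; split=> // v; exact: IH.
Qed.

Lemma near_eq_differentiable (W : normedModType R) (f g : V -> W) x :
  (\near x, f x = g x) -> differentiable f x -> differentiable g x.
Proof.
move=> fg df.
have gE : g = f + (g - f) by apply/funext => y; rewrite !fctE addrC subrK.
suff dgf : differentiable (g - f) x by rewrite gE; exact: differentiableD.
have e0 : (g - f) \o shift x = cst ((g - f) x) + (\0 : V -> W) +o_ 0 id.
  apply/eqaddoP => e e0; near=> h.
  rewrite !fctE /= (nbhs_singleton fg) subrr.
  have -> : f (h + x) = g (h + x).
    near: h; have := fg; rewrite (near_shift 0) /=; apply: filterS => h /=.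
    by rewrite subr0.
  by rewrite subrr addr0 subrr normr0 mulr_ge0 // ltW.
have dE : 'd (g - f) x = \0 :> (V -> W).
  by apply: (@diff_unique _ _ _ (g - f) \0 x); [exact: cst_continuous|].
by apply/diff_locallyP; rewrite dE; split=> //; exact: cst_continuous.
Unshelve. all: by end_near. Qed.

Lemma Ck_ext (W : normedModType R) (U : set V) j (f g : V -> W) :
  open U -> (forall x, U x -> f x = g x) -> Ck U j f -> Ck U j g.
Proof.
move=> oU; have H (f' g' : V -> W) : (forall x, U x -> f' x = g' x) ->
    forall x, U x -> \near x, f' x = g' x.
  move=> fg x Ux; have : nbhs x U by exact: open_nbhs_nbhs.
  by apply: filterS.
elim: j f g => [|j IH] f g fg /=.
  by move=> df x Ux; apply: near_eq_differentiable (df x Ux); exact: H.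
move=> [df Df]; split=> [x Ux|v].
  by apply: near_eq_differentiable (df x Ux); exact: H.
by apply: IH (Df v) => x Ux; apply: near_eq_derive; exact: H.
Qed.

Lemma Ck_sub (W : normedModType R) (U U' : set V) j (f : V -> W) :
  U' `<=` U -> Ck U j f -> Ck U' j f.
Proof.
move=> UU; elim: j f => [|j IH] f /=; first by move=> H x /UU; exact: H.
by move=> [H1 H2]; split=> [x /UU|v]; [exact: H1|exact: IH].
Qed.

Section Algebra.
Variables (U : set V) (oU : open U).

Lemma Ck_cst (W : normedModType R) (w : W) j : Ck U j (fun=> w).
Proof.
elim: j w => [|j IH] w /=; first by move=> x _; exact: differentiable_cst.
split=> [x _|v]; first exact: differentiable_cst.
by apply: Ck_ext (IH 0) => // x _; rewrite derive_cst.
Qed.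

Lemma CkD (W : normedModType R) j (f g : V -> W) :
  Ck U j f -> Ck U j g -> Ck U j (fun x => f x + g x).
Proof.
elim: j f g => [|j IH] f g /=.
  by move=> df dg x Ux; apply: differentiableD; [exact: df|exact: dg].
move=> [df Df] [dg Dg]; split=> [x Ux|v].
  by apply: differentiableD; [exact: df|exact: dg].
apply: Ck_ext (IH _ _ (Df v) (Dg v)) => // x Ux.
by rewrite -deriveD //; apply: diff_derivable; [exact: df|exact: dg].
Qed.

Lemma Ck_Zl (W : normedModType R) j (f : V -> R^o) (w : W) :
  Ck U j f -> Ck U j (fun x => f x *: w).
Proof.
elim: j f => [|j IH] f /=.
  by move=> df x Ux; apply: differentiableZl; exact: df.
move=> [df Df]; split=> [x Ux|v].
  by apply: differentiableZl; exact: df.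
apply: Ck_ext (IH _ (Df v)) => // x Ux.
have dfx := df x Ux; have dfw := differentiableZl w dfx.
transitivity ('d (fun y => f y *: w) x v); last by rewrite -deriveE.
by rewrite (diffZl w dfx) (deriveE v dfx).
Qed.

Lemma CkM j (f g : V -> R^o) :
  Ck U j f -> Ck U j g -> Ck U j (fun x => f x * g x : R^o).
Proof.
elim: j f g => [|j IH] f g.
  by move=> df dg x Ux; apply: differentiableM; [exact: df|exact: dg].
move=> cf cg; split=> [x Ux|v].
  by apply: differentiableM; [exact: Ck_diff cf Ux|exact: Ck_diff cg Ux].
apply: Ck_ext (CkD (IH _ _ (CkS cf) (cg.2 v)) (IH _ _ (CkS cg) (cf.2 v))) => //.
move=> x Ux; apply/esym; rewrite (_ : (fun _ => _) = f * g) //.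
by rewrite deriveM //; apply: diff_derivable; [exact: Ck_diff cf Ux|exact: Ck_diff cg Ux].
Qed.

Lemma Ck_sum (W : normedModType R) j m (f : 'I_m -> V -> W) :
  (forall i, Ck U j (f i)) -> Ck U j (fun x => \sum_i f i x).
Proof.
elim: m f => [|m IH] f H.
  by apply: Ck_ext (Ck_cst 0 j) => // x _; rewrite big_ord0.
apply: Ck_ext (CkD (H ord0) (IH (fun i => f (lift ord0 i)) _)) => //.
by move=> x _; rewrite big_ord_recl.
Qed.

Lemma CkV j (f : V -> R^o) : (forall x, U x -> f x != 0) ->
  Ck U j f -> Ck U j (fun x => (f x)^-1 : R^o).
Proof.
move=> f0; elim: j f f0 => [|j IH] f f0.
  by move=> df x Ux; apply: differentiableV; [exact: df|exact: f0].
move=> cf; split=> [x Ux|v].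
  by apply: differentiableV; [exact: Ck_diff cf Ux|exact: f0].
have ci := IH f f0 (CkS cf).
apply: Ck_ext (CkM (CkM ci ci) (CkM (Ck_cst (-1 : R^o) j) (cf.2 v))) => // x Ux.
have df := Ck_diff cf Ux.
have dv := differentiableV df (f0 x Ux).
transitivity ('d (fun y => (f y)^-1) x v); last by rewrite -(deriveE v dv).
rewrite (diffV df (f0 x Ux)) /= -(deriveE v df).
by rewrite -exprVn expr2 mulN1r mulrN /GRing.scale /= mulNr.
Qed.

End Algebra.
End Calculus.

Section Rows.
Context {R : realType}.

Section Coord.
Context {V : normedModType R}.
Variables (U : set V) (oU : open U).

Lemma Ck_rowE j n (f : V -> 'rV[R]_n) :
  (forall i, Ck U j (fun x => f x 0 i : R^o)) -> Ck U j f.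
Proof.
move=> H; apply: Ck_ext (Ck_sum oU (fun i => Ck_Zl oU (delta_mx 0 i) (H i))) => //.
by move=> x _; rewrite -row_sum_delta.
Qed.

Lemma Ck_coord j n (f : V -> 'rV[R]_n) i :
  Ck U j f -> Ck U j (fun x => f x 0 i : R^o).
Proof.
elim: j f => [|j IH] f.
  move=> df x Ux.
  exact: (differentiable_comp (df x Ux) (differentiable_coord _ _ _)).
move=> cf; split=> [x Ux|v].
  exact: (differentiable_comp (Ck_diff cf Ux) (differentiable_coord _ _ _)).
apply: Ck_ext (IH _ (cf.2 v)) => // x Ux.
by rewrite derive_mx ?mxE //; apply: diff_derivable; exact: Ck_diff cf Ux.
Qed.

(** The directions [delta_mx 0 i] do not depend on the point, unlike the vector
    ['D_v g x] in the usual chain rule; the induction on the order in [Ck_comp]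
    needs this. *)
Lemma derive_comp_row (W : normedModType R) n (g : V -> 'rV[R]_n)
    (f : 'rV[R]_n -> W) x v :
  differentiable g x -> differentiable f (g x) ->
  'D_v (f \o g) x = \sum_i 'D_v (fun y => g y 0 i : R^o) x *: 'D_(delta_mx 0 i) f (g x).
Proof.
move=> dg df; rewrite deriveE; last exact: differentiable_comp.
rewrite diff_comp //= (row_sum_delta ('d g x v)) linear_sum.
apply: eq_bigr => i _; rewrite linearZ /= -!deriveE // derive_mx ?mxE //.
exact: diff_derivable.
Qed.

End Coord.

Lemma Ck_comp (V : normedModType R) n (U : set V) (U' : set 'rV[R]_n) j
    (g : V -> 'rV[R]_n) (f : 'rV[R]_n -> R^o) :
  open U -> (forall x, U x -> U' (g x)) ->
  Ck U j g -> Ck U' j f -> Ck U j (f \o g).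
Proof.
move=> oU gU; elim: j f => [|j IH] f.
  by move=> dg df x Ux; apply: differentiable_comp; [exact: dg|exact/df/gU].
move=> cg cf; split=> [x Ux|v].
  by apply: differentiable_comp; [exact: Ck_diff cg Ux|exact: Ck_diff cf (gU _ Ux)].
apply: Ck_ext (Ck_sum oU (fun i => CkM oU (Ck_coord oU i (cg.2 v))
  (IH _ (CkS cg) (cf.2 (delta_mx 0 i))))) => // x Ux.
rewrite derive_comp_row; [|exact: Ck_diff cg Ux|exact: Ck_diff cf (gU _ Ux)].
apply: eq_bigr => i _; rewrite derive_mx ?mxE //.
exact/diff_derivable/(Ck_diff cg Ux).
Qed.

End Rows.

(** * Bump functions *)

Section Flat.
Context {R : realType}.
Implicit Types (p : {poly R}) (t : R).

Lemma gt_nbhs (a t : R) : a < t -> \forall s \near t, a < s.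
Proof. by move=> at0; apply: open_nbhs_nbhs; split=> //; exact: open_gt. Qed.

(** The functions [p(1/t) e^(-1/t)], extended by [0] to the left, form a family
    closed under derivation; this gives their smoothness at once. *)
Definition flat p t : R^o := if 0 < t then p.[t^-1] * expR (- t^-1) else 0.

(** Each monomial is dominated by the exponential: [y^i <= i! e^y]. *)
Lemma horner_expR_bound p :
  exists C, forall y, 0 <= y -> `|p.[y] * expR (- y)| <= C.
Proof.
have mono i y : 0 <= y -> y ^+ i * expR (- y) <= i`!%:R.
  move=> y0; rewrite expRN ler_pdivrMr ?expR_gt0 //.
  case: i => [|i]; first rewrite expr0 fact0 mul1r.
    by apply: le_trans (expR_ge1Dx y); rewrite lerDl.
  rewrite mulrC -ler_pdivrMr ?ltr0n ?fact_gt0 //.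
  by apply: le_trans (expR_ge1Dxn i y0); rewrite lerDr.
exists (\sum_(i < size p) `|p`_i| * i`!%:R) => y y0.
rewrite horner_coef mulr_suml; apply: le_trans (ler_norm_sum _ _ _) _.
apply: ler_sum => i _; rewrite -mulrA normrM ler_wpM2l //.
by rewrite ger0_norm ?mono // mulr_ge0 ?exprn_ge0 ?expR_ge0.
Qed.

Lemma flat_bound p : exists C, forall t, `|flat p t| <= C * t ^+ 2.
Proof.
have [C HC] := horner_expR_bound ('X^2 * p).
have C0 : 0 <= C by apply: le_trans (HC 0 (lexx _)).
exists C => t; rewrite /flat; case: ifPn => t0; last first.
  by rewrite normr0 mulr_ge0 ?sqr_ge0.
have ti : 0 <= t^-1 by rewrite invr_ge0 ltW.
have := HC _ ti; rewrite hornerM hornerXn -mulrA normrM.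
rewrite ger0_norm ?sqr_ge0 // exprVn.
by rewrite mulrC ler_pdivrMr // exprn_gt0.
Qed.

(** The derivative of [p(1/t) e^(-1/t)] is [q(1/t) e^(-1/t)] for
    [q = X^2 (p - p')]. *)
Definition dflat p : {poly R} := 'X^2 * (p - p^`()).

Lemma is_derive_flat p t : is_derive (t : R^o) 1 (flat p) (flat (dflat p) t).
Proof.
have [t0|t0|->] := ltgtP t 0.
- have E : \near t, (cst 0 : R^o -> R^o) t = flat p t.
    near=> s; rewrite /flat ltNge ltW //.
    by near: s; exact: lt_nbhsl.
  apply: near_eq_is_derive E _.
  by rewrite {1}/flat ltNge (ltW t0) /=; exact: is_derive_cst.
- have E : \near t, p.[t^-1] * expR (- t^-1) = flat p t :> R^o.
    near=> s; rewrite /flat ifT //.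
    by near: s; exact: gt_nbhs.
  apply: near_eq_is_derive E _.
  have tn0 : t != 0 by rewrite gt_eqF.
  have dV : is_derive (t : R^o) 1 (fun s => s^-1 : R^o) (- t ^- 2).
    apply: DeriveDef; first by apply: derivableV => //; exact: derivable_id.
    rewrite (@deriveV _ _ id) //.
    by rewrite derive_id /GRing.scale /= mulr1.
  have dp : is_derive (t^-1 : R^o) 1 (horner p : R^o -> R^o) (p^`()).[t^-1].
    by apply: DeriveDef; [exact: derivable_horner|rewrite derivE derive1E].
  have d1 : is_derive (t : R^o) 1 (fun s => p.[s^-1] : R^o)
      ((p^`()).[t^-1] * - t ^- 2).
    apply: DeriveDef.
      apply/derivable1_diffP.
      apply: (@differentiable_comp _ _ _ _ (fun s : R => s^-1) (horner p)).
        by apply/derivable1_diffP; case: dV.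
      by apply/derivable1_diffP; case: dp.
    have [dV1 dV2] := dV; have [dp1 dp2] := dp.
    transitivity (derive1 (horner p \o (fun s : R => s^-1)) t); first by rewrite derive1E.
    by rewrite (derive1_comp dV1 dp1) !derive1E dV2 dp2.
  have d2 : is_derive (t : R^o) 1 (fun s => expR (- s^-1) : R^o)
      (expR (- t^-1) * t ^- 2).
    apply: DeriveDef.
      apply/derivable1_diffP.
      apply: (@differentiable_comp _ _ _ _ (fun s : R => - s^-1) expR).
        by apply/derivable1_diffP; apply: derivableN; case: dV.
      by apply/derivable1_diffP; exact: derivable_expR.
    have [dV1 dV2] := dV; have dN := derivableN dV1.
    have de : derivable (expR : R -> R) ((- (fun s : R => s^-1)) t) 1 by exact: derivable_expR.
    transitivity (derive1 (expR \o - (fun s : R => s^-1)) t); first by rewrite derive1E.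
    rewrite (derive1_comp dN de) !derive1E (deriveN dV1) dV2 opprK.
    by congr (_ * _); rewrite -[RHS](congr1 (@^~ (- t^-1)) (@derive_expR R)).
  have [d1a d1b] := d1; have [d2a d2b] := d2.
  apply: DeriveDef; first exact: (derivableM d1a d2a).
  transitivity (derive ((fun s => p.[s^-1] : R^o) * (fun s => expR (- s^-1) : R^o)) t 1) => //.
  rewrite (deriveM d1a d2a) d1b d2b.
  rewrite /flat t0 /dflat hornerM hornerXn hornerD hornerN exprVn /GRing.scale /=.
  by ring.
(* at 0 the difference quotient is at most C |h| *)
- have [C HC] := flat_bound p.
  have f0 q : flat q 0 = 0 by rewrite /flat ltxx.
  have C0 : 0 <= C by have := HC 1; rewrite expr1n mulr1; exact: le_trans.
  rewrite f0; have cv : (fun h : R => h^-1 *: (flat p (h *: 1 + 0) - flat p 0)) @ 0^' --> (0 : R^o).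
    apply/cvgrPdist_le => e e0; near=> h.
    rewrite f0 sub0r subr0 addr0 normrN [_ *: 1]mulr1 /GRing.scale /= normrM normfV.
    have h0 : h != 0 by near: h; exact: nbhs_dnbhs_neq.
    rewrite mulrC ler_pdivrMr ?normr_gt0 //.
    apply: le_trans (HC h) _.
    rewrite -real_normK ?num_real // expr2 mulrA ler_wpM2r //.
    have : `|h| <= e / (C + 1).
      near: h; apply: dnbhs0_le; rewrite divr_gt0 // ltr_pwDr //.
    have C1 : 0 < C + 1 by rewrite ltr_pwDr.
    rewrite ler_pdivlMr // => /(le_trans _); apply.
    by rewrite mulrC ler_wpM2l // lerDl.
  apply: DeriveDef; first by apply/cvg_ex; exists 0.
  by apply: cvg_lim => //; exact: cv.
Unshelve. all: by end_near. Qed.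

Lemma diff_flat p t : differentiable (flat p : R^o -> R^o) t.
Proof. by apply/derivable1_diffP; case: (is_derive_flat p t). Qed.

Lemma derive_R (f : R^o -> R^o) (t v : R^o) :
  differentiable f t -> 'D_v f t = v * 'D_1 f t.
Proof.
move=> df; rewrite !deriveE // -[X in 'd f t X = _]mulr1.
exact: linearZ.
Qed.

Lemma Ck_flat p j : Ck [set: R^o] j (flat p).
Proof.
elim: j p => [|j IH] p; first by move=> t _; exact: diff_flat.
split=> [t _|v]; first exact: diff_flat.
apply: Ck_ext (CkM openT (Ck_cst openT (v : R^o) j) (IH (dflat p))) => //; first exact: openT.
move=> t _; rewrite derive_R; last exact: diff_flat.
by case: (is_derive_flat p t) => _ ->.
Qed.

Lemma Ck_comp1 (V : normedModType R) (U : set V) (U' : set R^o) j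
    (g : V -> R^o) (f : R^o -> R^o) :
  open U -> (forall x, U x -> U' (g x)) ->
  Ck U j g -> Ck U' j f -> Ck U j (f \o g).
Proof.
move=> oU gU; elim: j f => [|j IH] f.
  by move=> dg df x Ux; apply: differentiable_comp; [exact: dg|exact/df/gU].
move=> cg cf; split=> [x Ux|v].
  by apply: differentiable_comp; [exact: Ck_diff cg Ux|exact: Ck_diff cf (gU _ Ux)].
apply: Ck_ext (CkM oU (cg.2 v) (IH _ (CkS cg) (cf.2 1))) => // x Ux.
have dg := Ck_diff cg Ux; have df := Ck_diff cf (gU _ Ux).
rewrite [RHS]deriveE; last exact: differentiable_comp.
rewrite diff_comp //= -(deriveE _ df) -(deriveE _ dg).
by rewrite -derive_R.
Qed.

Definition smooth_step t : R^o := flat 1 t / (flat 1 t + flat 1 (1 - t)).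

Lemma flat1_ge0 t : 0 <= flat 1 t.
Proof. by rewrite /flat; case: ifP => // _; rewrite hornerC mul1r expR_ge0. Qed.

Lemma flat1_gt0 t : 0 < t -> 0 < flat 1 t.
Proof. by rewrite /flat => ->; rewrite hornerC mul1r expR_gt0. Qed.

Lemma flat_le0 p t : t <= 0 -> flat p t = 0.
Proof. by rewrite /flat ltNge => ->. Qed.

Lemma smooth_step_den t : flat 1 t + flat 1 (1 - t) != 0.
Proof.
rewrite gt_eqF //; have [t0|t0] := ltP 0 t.
  by rewrite ltr_pwDl ?flat1_gt0 ?flat1_ge0.
by rewrite ltr_wpDl ?flat1_ge0 // flat1_gt0 // subr_gt0 (le_lt_trans t0).
Qed.

Lemma smooth_step0 t : t <= 0 -> smooth_step t = 0.
Proof. by move=> t0; rewrite /smooth_step flat_le0 // mul0r. Qed.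

Lemma smooth_step1 t : 1 <= t -> smooth_step t = 1.
Proof.
move=> t1; have := smooth_step_den t; rewrite /smooth_step (@flat_le0 _ (1 - t)) ?subr_le0 //.
by rewrite addr0 => d; rewrite divff.
Qed.

Lemma Ck_id j : Ck [set: R^o] j (fun t : R^o => t).
Proof.
case: j => [|j] /=; first by move=> x _; exact: ex_diff.
split=> [x _|v]; first exact: ex_diff.
by apply: Ck_ext (Ck_cst openT v j) => //; [exact: openT|move=> x _; rewrite derive_id].
Qed.

Lemma Ck_smooth_step j : Ck [set: R^o] j smooth_step.
Proof.
have sub1 : Ck [set: R^o] j (fun t : R^o => 1 + -1 * t : R^o).
  apply: (CkD openT (Ck_cst openT _ j)).
  exact: (CkM openT (Ck_cst openT _ j) (Ck_id j)).
have c2 : Ck [set: R^o] j (fun t => flat 1 (1 - t)).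
  apply: Ck_ext (Ck_comp1 openT _ sub1 (Ck_flat 1 j)) => //; first exact: openT.
  by move=> t _ /=; rewrite mulN1r.
apply: (CkM openT (Ck_flat 1 j)).
apply: (CkV openT); first by move=> x _; exact: smooth_step_den.
exact: (CkD openT (Ck_flat 1 j)).
Qed.

End Flat.

Section Bump.
Context {R : realType} {n : nat}.
Local Notation V := 'rV[R]_n.

Definition gsmooth (W : normedModType R) (f : V -> W) := forall j, Ck setT j f.

Lemma Ck_coordinate (U : set V) j (i : 'I_n) : open U ->
  Ck U j (fun y : V => y 0 i : R^o).
Proof.
move=> oU; case: j => [|j] /=; first by move=> x _; exact: differentiable_coord.
split=> [x _|v]; first exact: differentiable_coord.
apply: Ck_ext (Ck_cst oU (v 0 i : R^o) j) => // x _.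
have lc : linear (fun y : V => y 0 i : R^o) by move=> a u w; rewrite !mxE.
pose lM := GRing.isLinear.Build _ _ _ _ _ lc.
pose l : {linear V -> R^o} := HB.pack (fun y : V => y 0 i : R^o) lM.
rewrite deriveE; last exact: differentiable_coord.
by rewrite (@diff_lin _ _ _ l) // => z; exact: coord_continuous.
Qed.

(** The norm of a row is the largest modulus of its entries, which is not a
    smooth function; the Euclidean distance bounds it from above. *)
Definition sqdist (a y : V) : R^o := \sum_i (y 0 i - a 0 i) * (y 0 i - a 0 i).

Lemma gsmooth_sqdist a : gsmooth (sqdist a).
Proof.
move=> j; apply: (Ck_sum openT) => i.
have c : Ck setT j (fun y : V => y 0 i - a 0 i : R^o).
  exact: (CkD openT (Ck_coordinate j i openT) (Ck_cst openT _ j)).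
exact: (CkM openT c c).
Qed.

Lemma norm_sqdist a y e : 0 < e -> e <= `|y - a| -> e ^+ 2 <= sqdist a y.
Proof.
move=> e0; rewrite [`|y - a|]/Num.Def.normr /= mx_normrE.
move=> /bigmax_geP [|[/= [i0 i] _]] /=; first by move/(lt_le_trans e0); rewrite ltxx.
rewrite !mxE (ord1 i0) => ei; rewrite /sqdist (bigD1 i) //=.
apply: (@le_trans _ _ ((y 0 i - a 0 i) * (y 0 i - a 0 i))).
  rewrite -expr2 -[leRHS]real_normK ?num_real // !expr2; apply: ler_pM => //; exact: ltW.
by rewrite lerDl sumr_ge0 // => k _; rewrite -expr2 sqr_ge0.
Qed.

Lemma bump_rV (a : V) (e : R) : 0 < e -> exists chi : V -> R^o,
  [/\ gsmooth chi, (forall y, e <= `|y - a| -> chi y = 0) &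
      \near a, chi a = 1].
Proof.
(* 2 - 2 |y - a|^2 / e^2 is 2 at [a], and non-positive at distance at least [e] *)
move=> e0; pose g y : R^o := 2 + (- 2 / e ^+ 2) * sqdist a y.
have e2 : 0 < e ^+ 2 by rewrite exprn_gt0.
have sg : gsmooth g.
  move=> j; apply: (CkD openT (Ck_cst openT _ j)).
  exact: (CkM openT (Ck_cst openT _ j) (gsmooth_sqdist a j)).
exists (smooth_step \o g); split.
- by move=> j; exact: (Ck_comp1 openT _ (sg j) (Ck_smooth_step j)).
- move=> y /(norm_sqdist e0) H; rewrite /= smooth_step0 // /g.
  have : 1 <= sqdist a y / e ^+ 2 by rewrite ler_pdivlMr // mul1r.
  by rewrite -mulrA [_^-1 * _]mulrC; lra.
- have cg : {for a, continuous g}.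
    exact: (differentiable_continuous (sg 0%N a I)).
  have ga : g a = 2.
    by rewrite /g /sqdist big1 ?mulr0 ?addr0 // => i _; rewrite subrr mulr0.
  have lt : \forall y \near a, 1 < g y.
    apply: (cg [set t | 1 < t]); rewrite /= ga; apply: gt_nbhs.
    by rewrite ltr1n.
  by apply: filterS lt => y /= ly; rewrite smooth_step1 // ltW.
Qed.

(** Multiply by a bump function supported in [U]. Working with functions defined
    on the whole space removes all domain conditions from later arguments. *)
Lemma gsmooth_germ (U : set V) (a : V) (f : V -> R^o) :
  open U -> U a -> (forall j, Ck U j f) ->
  exists2 F : V -> R^o, gsmooth F & \near a, F a = f a.
Proof.
move=> oU Ua sf; have /nbhs_ballP[e /= e0 He] : nbhs a U by exact: open_nbhs_nbhs.
have e20 : 0 < e / 2 by rewrite divr_gt0.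
have [chi [sc c0 c1]] := bump_rV a e20.
exists (fun y => chi y * f y); last by apply: filterS c1 => y /= ->; rewrite mul1r.
have big : forall j, Ck [set y : V | e / 2 < `|y - a|] j (fun y => chi y * f y : R^o).
  have oB : open [set y : V | e / 2 < `|y - a|].
    apply: (@open_comp _ _ (fun y : V => `|y - a|) [set t | e / 2 < t]); last exact: open_gt.
    move=> y _; apply: continuous_comp; last exact: norm_continuous.
    by apply: continuousB => //; exact: cst_continuous.
  move=> j; apply: Ck_ext (Ck_cst oB (0 : R^o) j) => // y /= /ltW /c0 ->.
  by rewrite mul0r.
have small : forall j, Ck U j (fun y => chi y * f y : R^o).
  by move=> j; apply: (CkM oU) => //; exact: Ck_sub (sc j).
move=> j; elim: j (fun y => chi y * f y) big small => [|j IH] F big small.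
  move=> y _; have [ye|ye] := ltP (e / 2) `|y - a|; first exact: (big 0%N).
  apply: (small 0%N); apply: He; rewrite -ball_normE /= distrC (le_lt_trans ye) //.
  by rewrite ltr_pdivrMr // mulr_natr mulr2n ltrDl.
split=> [y _|v]; last by apply: IH => k; [exact: (big k.+1).2|exact: (small k.+1).2].
have [ye|ye] := ltP (e / 2) `|y - a|; first exact: (big 0%N).
apply: (small 0%N); apply: He; rewrite -ball_normE /= distrC (le_lt_trans ye) //.
by rewrite ltr_pdivrMr // mulr_natr mulr2n ltrDl.
Qed.

End Bump.

(** * Hadamard's lemma *)

Section Mean.
Context {R : realType}.

Definition mean (u : R -> R) : R := \int[@lebesgue_measure R]_(s in `[0, 1]) u s.

Lemma mean_integrable (u : R -> R) : continuous (u : R^o -> R^o) ->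
  (@lebesgue_measure R).-integrable `[0, 1] (EFin \o u).
Proof.
move=> cu; apply: continuous_compact_integrable; first exact: segment_compact.
exact: continuous_subspaceT.
Qed.

Lemma meanD (u v : R -> R) : continuous (u : R^o -> R^o) ->
  continuous (v : R^o -> R^o) -> mean (fun s => u s + v s) = mean u + mean v.
Proof. by move=> cu cv; apply: RintegralD => //; exact: mean_integrable. Qed.

Lemma meanB (u v : R -> R) : continuous (u : R^o -> R^o) ->
  continuous (v : R^o -> R^o) -> mean (fun s => u s - v s) = mean u - mean v.
Proof. by move=> cu cv; apply: RintegralB => //; exact: mean_integrable. Qed.

Lemma meanZ (c : R) (u : R -> R) : continuous (u : R^o -> R^o) ->
  mean (fun s => c * u s) = c * mean u.
Proof. by move=> cu; apply: RintegralZl => //; exact: mean_integrable. Qed.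

Lemma continuous_Ml (c : R) (u : R -> R) : continuous (u : R^o -> R^o) ->
  continuous ((fun s => c * u s) : R^o -> R^o).
Proof. by move=> cu s; apply: cvgM; [exact: cvg_cst|exact: cu]. Qed.

Lemma continuous_B (u v : R -> R) : continuous (u : R^o -> R^o) ->
  continuous (v : R^o -> R^o) -> continuous ((fun s => u s - v s) : R^o -> R^o).
Proof. by move=> cu cv s; apply: cvgB; [exact: cu|exact: cv]. Qed.

Lemma continuous_D (u v : R -> R) : continuous (u : R^o -> R^o) ->
  continuous (v : R^o -> R^o) -> continuous ((fun s => u s + v s) : R^o -> R^o).
Proof. by move=> cu cv s; apply: cvgD; [exact: cu|exact: cv]. Qed.

Lemma mean_cst (c : R) : mean (fun=> c) = c.
Proof.
rewrite /mean Rintegral_cst //=.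
have -> : lebesgue_measure `[0 : R, 1]%classic = 1%E.
  by rewrite lebesgue_measure_itv /= lte_fin ltr01 sube0.
by rewrite mulr1.
Qed.

Lemma mean_bound (u : R -> R) C : continuous (u : R^o -> R^o) ->
  (forall s, 0 <= s <= 1 -> `|u s| <= C) -> `|mean u| <= C.
Proof.
move=> cu uC; apply: le_trans (le_normr_Rintegral _ (mean_integrable cu)) _ => //.
rewrite -[leRHS]mean_cst; apply: le_Rintegral => //.
- apply: (@mean_integrable (fun s => `|u s|)) => s.
  by apply: continuous_comp; [exact: cu|exact: norm_continuous].
- by apply: (@mean_integrable (fun=> C)); exact: cst_continuous.
Qed.

Lemma mean_derive (p dp : R -> R) : (forall t, is_derive (t : R^o) 1 (p : R^o -> R^o) (dp t)) ->
  continuous (dp : R^o -> R^o) -> mean dp = p 1 - p 0.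
Proof.
move=> pd cd; have cp : continuous (p : R^o -> R^o).
  move=> t; apply: differentiable_continuous; apply/derivable1_diffP.
  by case: (pd t).
rewrite /mean /Rintegral (@continuous_FTC2 _ dp p) //.
- exact: continuous_subspaceT.
- split; first by move=> x _; case: (pd x).
  + by apply: cvg_at_right_filter; exact: cp.
  + by apply: cvg_at_left_filter; exact: cp.
- by move=> x _; rewrite derive1E; case: (pd x).
Qed.

End Mean.

(** A quadratic remainder is in particular negligible, and the differential is
    unique. *)
Lemma quadratic_diff {R : realType} (V W : normedModType R) (f : V -> W)
    (L : {linear V -> W}) (y : V) C : continuous L ->
  (forall h, `|h| <= 1 -> `|f (y + h) - f y - L h| <= C * `|h| ^+ 2) ->
  differentiable f y /\ forall v, 'D_v f y = L v.
Proof.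
move=> cl H.
have E : f \o shift y = cst (f y) + L +o_ 0 id.
  apply/eqaddoP => e e0; near=> h.
  rewrite !fctE /= opprD addrA [h + y]addrC.
  have h1 : `|h| <= 1 by near: h; apply: nbhs0_le.
  have C1 : 0 < `|C| + 1 by rewrite ltr_wpDl.
  have he : `|h| <= e / (`|C| + 1).
    by near: h; apply: nbhs0_le; rewrite divr_gt0.
  apply: le_trans (H h h1) _.
  rewrite expr2 mulrA ler_wpM2r //.
  move: he; rewrite ler_pdivlMr // => /(le_trans _); apply.
  rewrite mulrC; apply: ler_wpM2l => //.
  by apply: le_trans (ler_norm C) _; rewrite lerDl.
have dE : 'd f y = L :> (V -> W) by apply: diff_unique.
have df : differentiable f y by apply/diff_locallyP; rewrite dE; split.
by split=> // v; rewrite deriveE // dE.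
Unshelve. all: by end_near. Qed.

Section Hadamard.
Context {R : realType} {n : nat}.
Local Notation V := 'rV[R]_n.

Lemma is_derive_line (W : normedModType R) (f : V -> W) (z h : V) (t : R) :
  differentiable f (z + t *: h) ->
  is_derive (t : R^o) 1 (fun s : R^o => f (z + s *: h)) ('D_h f (z + t *: h)).
Proof.
move=> df; have dl : is_diff (t : R^o) (fun s : R^o => z + s *: h) (fun s => s *: h).
  have d1 : is_diff (t : R^o) (fun s : R^o => s *: h) (fun s => s *: h).
    exact: is_diff_scalel.
  have [e1 e2] := is_diffD (is_diff_cst z (t : R^o)) d1.
  by apply: DiffDef => //; rewrite e2; apply/funext => s; rewrite !fctE add0r.
have [dl1 dl2] := dl.
have dc : differentiable (f \o (fun s : R^o => z + s *: h)) t.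
  exact: differentiable_comp.
apply: DeriveDef; first exact: diff_derivable.
transitivity ('d (f \o (fun s : R^o => z + s *: h)) (t : R^o) 1).
  by rewrite deriveE.
by rewrite diff_comp //= dl2 scale1r deriveE.
Qed.

Lemma derive_lin_dir (W : normedModType R) (f : V -> W) x (a : R) u v :
  differentiable f x -> 'D_(a *: u + v) f x = a *: 'D_u f x + 'D_v f x.
Proof. by move=> df; rewrite !deriveE // linearP. Qed.

Lemma derive_dir_sum (W : normedModType R) (f : V -> W) x (h : V) :
  differentiable f x -> 'D_h f x = \sum_i h 0 i *: 'D_(delta_mx 0 i) f x.
Proof.
move=> df; rewrite deriveE // {1}(row_sum_delta h) linear_sum.
by apply: eq_bigr => i _; rewrite linearZ deriveE.
Qed.

Lemma coord_le_norm (h : V) i : `|h 0 i| <= `|h|.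
Proof.
rewrite [leRHS]/Num.Def.normr /= mx_normrE.
exact: (le_bigmax _ (fun p => `|h p.1 p.2|) (0, i)).
Qed.

Lemma gsmooth_continuous (W : normedModType R) (f : V -> W) : gsmooth f -> continuous f.
Proof. by move=> sf x; apply: differentiable_continuous; exact: (sf 0%N x I). Qed.

Lemma gsmooth_bounded (f : V -> R^o) (a : V) (r : R) : gsmooth f ->
  exists C, forall z, `|z - a| <= r -> `|f z| <= C.
Proof.
move=> sf; pose K := [set z : V | `|z - a| <= r].
have cK : compact K.
  apply: bounded_closed_compact.
    exists (r + `|a|); split; first exact: num_real.
    move=> M rM z Kz /=; apply: le_trans (ltW rM).
    by rewrite -{1}(subrK a z); apply: le_trans (ler_normD _ _) _; rewrite lerD2r.
  apply: (@closed_comp _ _ (fun y : V => `|y - a|) [set t | t <= r]); last exact: closed_le.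
  move=> y _; apply: continuous_comp; last exact: norm_continuous.
  by apply: continuousB => //; exact: cst_continuous.
have cf : {within K, continuous f} by apply: continuous_subspaceT; exact: gsmooth_continuous.
have [M [_ HM]] := compact_bounded (continuous_compact cf cK).
exists (M + 1) => z Kz; apply: (HM (M + 1)); first by rewrite ltrDl.
by exists z.
Qed.

(** Apply the mean value theorem twice along the segment from [z] to [z + h];
    the second derivatives are bounded on the ball by compactness. *)
Lemma second_order_bound (f : V -> R^o) (a : V) (r : R) : gsmooth f ->
  exists C, forall z h, `|z - a| <= r -> `|z + h - a| <= r ->
    `|f (z + h) - f z - 'D_h f z| <= C * `|h| ^+ 2.
Proof.
move=> sf; pose D i f : V -> R^o := fun x => 'D_(delta_mx 0 i) f x.
have sD (v : V) (g : V -> R^o) : gsmooth g -> gsmooth (fun x => 'D_v g x : R^o) by move=> sg j; exact: (sg j.+1).2.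
have dg (g : V -> R^o) x : gsmooth g -> differentiable g x by move=> sg; exact: (sg 0%N x I).
have bd i j : exists C, forall z, `|z - a| <= r -> `|D j (D i f) z| <= C.
  exact: (gsmooth_bounded a r (sD _ _ (sD _ _ sf))).
pose M i j := sval (cid (bd i j)).
have HM i j z : `|z - a| <= r -> `|D j (D i f) z| <= M i j by exact: (svalP (cid (bd i j))).
exists (\sum_i \sum_j M i j) => z h zr zhr.
have seg t : 0 <= t <= 1 -> `|z + t *: h - a| <= r.
  move=> /andP[t0 t1].
  have -> : z + t *: h - a = (1 - t) *: (z - a) + t *: (z + h - a).
    by rewrite !scalerBr !scalerDr !scalerBl !scale1r; apply/rowP => i; rewrite !mxE; ring.
  apply: le_trans (ler_normD _ _) _; rewrite !normrZ ger0_norm ?subr_ge0 // ger0_norm //.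
  have := ler_wpM2l t0 zhr; have t1' : 0 <= 1 - t by rewrite subr_ge0.
  by have := ler_wpM2l t1' zr; lra.
have p1 t : is_derive (t : R^o) 1 (fun s : R^o => f (z + s *: h)) ('D_h f (z + t *: h)).
  by apply: is_derive_line; exact: dg.
have p2 t : is_derive (t : R^o) 1 (fun s : R^o => 'D_h f (z + s *: h))
    ('D_h (fun x => 'D_h f x) (z + t *: h)).
  by apply: (@is_derive_line _ (fun x => 'D_h f x)); apply: dg; exact: sD.
have cont (p dp : R -> R) : (forall t, is_derive (t : R^o) 1 (p : R^o -> R^o) (dp t)) ->
    forall b, {within `[0, b], continuous p}.
  move=> pd b; apply: continuous_subspaceT => t.
  by apply: differentiable_continuous; apply/derivable1_diffP; case: (pd t).
have [c c01 E1] := MVT ltr01 (fun t _ => p1 t) (cont _ _ p1 1).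
have c0 : 0 < c by move: c01; rewrite in_itv /= => /andP[].
have c1 : c < 1 by move: c01; rewrite in_itv /= => /andP[].
have [d d01 E2] := MVT c0 (fun t _ => p2 t) (cont _ _ p2 c).
have d0 : 0 < d by move: d01; rewrite in_itv /= => /andP[].
have dc : d < c by move: d01; rewrite in_itv /= => /andP[].
move: E1 E2; rewrite scale1r scale0r addr0 !subr0 mulr1 => -> ->.
rewrite normrM (gtr0_norm c0).
have dr : `|z + d *: h - a| <= r by apply: seg; rewrite ltW //= ltW // (lt_trans dc).
apply: (@le_trans _ _ `|'D_h (fun x => 'D_h f x) (z + d *: h)|).
  by rewrite ler_piMr ?normr_ge0 // ltW.
have DE j : 'D_(delta_mx 0 j) (fun x => 'D_h f x : R^o) (z + d *: h) =
    \sum_i h 0 i * D j (D i f) (z + d *: h).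
  have -> : (fun x => 'D_h f x : R^o) = \sum_i (h 0 i *: (D i f)).
    apply/funext => x; rewrite derive_dir_sum; last exact: dg.
    by rewrite fct_sumE.
  rewrite derive_sum => [|i]; last first.
    by apply: derivableZ; apply: diff_derivable; apply: dg; exact: sD.
  apply: eq_bigr => i _; rewrite deriveZ //.
  by apply: diff_derivable; apply: dg; exact: sD.
(* both the direction and the inner derivative are expanded in coordinates *)
rewrite derive_dir_sum; last by apply: dg; exact: sD.
rewrite mulr_suml; apply: le_trans (ler_norm_sum _ _ _) _.
rewrite -mulr_suml exchange_big /= mulr_suml; apply: ler_sum => j _.
rewrite DE /GRing.scale /= mulr_sumr mulr_suml.
apply: le_trans (ler_norm_sum _ _ _) _; apply: ler_sum => i _.
rewrite !normrM mulrA mulrC; apply: ler_pM => //; first exact: HM.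
by rewrite expr2; apply: ler_pM => //; exact: coord_le_norm.
Qed.

Lemma continuous_linear_row (l : V -> R^o) : linear l -> continuous l.
Proof.
move=> ll; pose lM := GRing.isLinear.Build _ _ _ _ _ ll.
pose L : {linear V -> R^o} := HB.pack l lM.
have -> : l = fun h => \sum_i h 0 i * l (delta_mx 0 i).
  apply/funext => h; rewrite -[l]/(L : V -> R^o) {1}(row_sum_delta h) linear_sum.
  by apply: eq_bigr => i _; rewrite linearZ.
apply: gsmooth_continuous => j; apply: (Ck_sum openT) => i.
exact: (CkM openT (Ck_coordinate j i openT) (Ck_cst openT _ j)).
Qed.

(** The weight [s ^+ k] is what differentiation under the integral sign brings
    out: a derivative of [ray_mean a k f] is [ray_mean a k.+1] of the same
    derivative of [f]. *)
Definition ray_mean (a : V) k (f : V -> R^o) (y : V) : R^o :=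
  mean (fun s => s ^+ k * f (a + s *: (y - a))).

Lemma ray_continuous (a y : V) k (f : V -> R^o) : gsmooth f ->
  continuous (fun s : R^o => s ^+ k * f (a + s *: (y - a)) : R^o).
Proof.
move=> sf s; apply: differentiable_continuous.
apply: (@differentiableM _ _ (fun s : R^o => s ^+ k) (fun s : R^o => f (a + s *: (y - a)))).
  by apply/derivable1_diffP; exact: exprn_derivable.
apply/derivable1_diffP.
by case: (@is_derive_line R^o f a (y - a) s (sf 0%N _ I)).
Qed.

(** The second-order bound is uniform along the ray, so it survives averaging. *)
Lemma ray_mean_diff (a : V) k (f : V -> R^o) : gsmooth f -> forall y,
  differentiable (ray_mean a k f) y /\
  forall v, 'D_v (ray_mean a k f) y = ray_mean a k.+1 (fun x => 'D_v f x) y.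
Proof.
move=> sf y; have sD (v : V) : gsmooth (fun x => 'D_v f x) by move=> j; exact: (sf j.+1).2.
have df x : differentiable f x by exact: (sf 0%N x I).
have [C HC] := second_order_bound a (`|y - a| + 1) sf.
have C0 : 0 <= C + `|C| by rewrite -lerBlDl sub0r -normrN ler_norm.
have cR v i := @ray_continuous a y i _ (sD v).
pose l h : R^o := ray_mean a k.+1 (fun x => 'D_h f x) y.
have ll : linear l.
  move=> c u v; rewrite /l /ray_mean [X in _ = X + _]/GRing.scale /= -meanZ; last exact: cR.
  rewrite -meanD; last 2 first.
  - exact/continuous_Ml/cR.
  - exact: cR.
  congr mean; apply/funext => s; rewrite derive_lin_dir // /GRing.scale /=; ring.
pose lM := GRing.isLinear.Build _ _ _ _ _ ll.
pose L : {linear V -> R^o} := HB.pack l lM.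
apply: (@quadratic_diff _ _ _ _ L _ (C + `|C|)); first exact: continuous_linear_row.
move=> h h1; rewrite /L /= /l /ray_mean.
have cf z := @ray_continuous a z k _ sf.
have cB := continuous_B (cf (y + h)) (cf y).
rewrite -(meanB (cf _) (cf _)) -(meanB cB (cR _ _)).
apply: mean_bound => [|s /andP[s0 s1]]; first exact: continuous_B.
have sk : 0 <= s ^+ k <= 1 by rewrite exprn_ge0 // exprn_ile1.
set z := a + s *: (y - a).
have -> : a + s *: (y + h - a) = z + s *: h.
  by rewrite /z; apply/rowP => i; rewrite !mxE; ring.
have zr : `|z - a| <= `|y - a| + 1.
  rewrite /z addrC addKr normrZ ger0_norm //; apply: (@le_trans _ _ `|y - a|).
    by rewrite ler_piMl.
  by rewrite lerDl.
have zhr : `|z + s *: h - a| <= `|y - a| + 1.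
  have -> : z + s *: h - a = s *: (y - a) + s *: h by rewrite /z; apply/rowP => i; rewrite !mxE; ring.
  apply: le_trans (ler_normD _ _) _; rewrite !normrZ ger0_norm //.
  by apply: lerD; [rewrite ler_piMl|rewrite (le_trans _ h1) // ler_piMl].
have := HC z (s *: h) zr zhr.
have -> : 'D_(s *: h) f z = s *: 'D_h f z by rewrite !deriveE // linearZ.
move=> B; have -> : s ^+ k * f (z + s *: h) - s ^+ k * f z - s ^+ k.+1 * 'D_h f z =
   s ^+ k * (f (z + s *: h) - f z - s *: 'D_h f z).
  by rewrite exprS /GRing.scale /=; ring.
have /andP[k0 k1] := sk; rewrite normrM (ger0_norm k0).
apply: (@le_trans _ _ `|f (z + s *: h) - f z - s *: 'D_h f z|); first by rewrite ler_piMl.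
apply: le_trans B _; rewrite normrZ (ger0_norm s0) exprMn.
apply: (@le_trans _ _ ((C + `|C|) * (s ^+ 2 * `|h| ^+ 2))).
  by rewrite ler_wpM2r ?mulr_ge0 ?exprn_ge0 // lerDl.
by rewrite ler_wpM2l // ler_piMl ?exprn_ge0 // exprn_ile1.
Qed.

Lemma gsmooth_ray_mean (a : V) k (f : V -> R^o) : gsmooth f -> gsmooth (ray_mean a k f).
Proof.
move=> sf j; elim: j k f sf => [|j IH] k f sf.
  by move=> y _; case: (ray_mean_diff a k sf y).
split=> [y _|v]; first by case: (ray_mean_diff a k sf y).
apply: Ck_ext (IH k.+1 (fun x => 'D_v f x) _) => //; first exact: openT.
  by move=> y _; case: (ray_mean_diff a k sf y) => _ ->.
by move=> i; exact: (sf i.+1).2.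
Qed.

(** This is the fundamental theorem of calculus along the ray from [a] to [y]. *)
Lemma hadamard (f : V -> R^o) (a : V) : gsmooth f ->
  exists g : 'I_n -> V -> R^o, [/\ forall i, gsmooth (g i),
    forall i, g i a = 'D_(delta_mx 0 i) f a &
    forall y, f y = f a + \sum_i (y 0 i - a 0 i) * g i y].
Proof.
move=> sf; have sD (v : V) : gsmooth (fun x => 'D_v f x : R^o) by move=> j; exact: (sf j.+1).2.
have df x : differentiable f x by exact: (sf 0%N x I).
exists (fun i => ray_mean a 0 (fun x => 'D_(delta_mx 0 i) f x)); split.
- by move=> i; exact: gsmooth_ray_mean.
- move=> i; rewrite -[RHS]mean_cst; congr mean; apply/funext => s.
  by rewrite expr0 mul1r subrr scaler0 addr0.
move=> y.
have H := mean_derive (fun t => is_derive_line (df (a + t *: (y - a)))).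
have cD v : continuous (fun t : R^o => 'D_v f (a + t *: (y - a))).
  rewrite (_ : (fun t => _) = fun t : R^o => t ^+ 0 * 'D_v f (a + t *: (y - a))).
    exact: (@ray_continuous a y 0 _ (sD v)).
  by apply/funext => t; rewrite expr0 mul1r.
move: {H}(H (cD _)); rewrite scale1r scale0r addr0 subrKC.
move=> E; rewrite -[f y](subrKC (f a)) -E; congr (_ + _).
pose G i (s : R) := (y - a) 0 i * 'D_(delta_mx 0 i) f (a + s *: (y - a)).
have -> : (fun t : R => 'D_(y - a) f (a + t *: (y - a))) = fun t => \sum_i G i t.
  by apply/funext => t; rewrite derive_dir_sum.
have cG i : continuous (G i : R^o -> R^o).
  by apply: continuous_Ml; exact: cD.
have SG (r : seq 'I_n) : continuous (fun t : R^o => \sum_(i <- r) G i t : R^o) /\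
    mean (fun t => \sum_(i <- r) G i t) = \sum_(i <- r) mean (G i).
  elim: r => [|i r [IH1 IH2]].
    have -> : (fun t : R => \sum_(i <- [::]) G i t) = fun=> 0.
      by apply/funext => t; rewrite big_nil.
    by split; [exact: cst_continuous|rewrite mean_cst big_nil].
  have -> : (fun t : R => \sum_(j <- i :: r) G j t) =
      fun t => G i t + \sum_(j <- r) G j t.
    by apply/funext => t; rewrite big_cons.
  split; first exact: continuous_D.
  by rewrite meanD // big_cons IH2.
rewrite (SG _).2; apply: eq_bigr => i _; rewrite /G meanZ // !mxE; congr (_ * mean _).
by apply/funext => s; rewrite expr0 mul1r.
Qed.

End Hadamard.

(** * Smooth functions on manifolds *)

Lemma Ck_local {R : realType} (V W : normedModType R) (U : set V) j (f : V -> W) :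
  (forall x, U x -> exists U' : set V, [/\ open U', U' x & Ck U' j f]) ->
  Ck U j f.
Proof.
elim: j f => [|j IH] f H; first by move=> x /H[U' [_ U'x cf]]; exact: Ck_diff cf U'x.
split=> [x /H[U' [_ U'x cf]]|v]; first exact: Ck_diff cf U'x.
by apply: IH => x /H[U' [oU' U'x cf]]; exists U'; split=> //; exact: cf.2.
Qed.

Section Charts.
Context {R : realType} {n : nat} {M : manifold R n}.
Implicit Types (c d : @chart R M n) (x y : M).

Lemma cdom_open c : atlas c -> open (cdom c).
Proof. by move=> /atlas_chart []. Qed.

Lemma cdom_nbhs c x : atlas c -> cdom c x -> nbhs x (cdom c).
Proof. by move=> /atlas_chart [oc _ _ _ _] cx; exact: open_nbhs_nbhs. Qed.

Lemma cimg_nbhs c x : atlas c -> cdom c x -> nbhs (cmap c x) (cimg c).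
Proof.
by move=> /atlas_chart [_ oc _ _ _] cx; apply: open_nbhs_nbhs; split=> //; exists x.
Qed.

Lemma cmapK c x : atlas c -> cdom c x -> cinv c (cmap c x) = x.
Proof. by move=> /atlas_chart [_ _ H _ _]; exact: H. Qed.

Lemma cinvK c z : atlas c -> cimg c z -> cmap c (cinv c z) = z.
Proof. by move=> ac [x cx <-]; rewrite cmapK. Qed.

Lemma cinv_cdom c z : atlas c -> cimg c z -> cdom c (cinv c z).
Proof. by move=> ac [x cx <-]; rewrite cmapK. Qed.

Lemma near_cmap c x (P : set 'rV[R]_n) : atlas c -> cdom c x ->
  nbhs (cmap c x) P -> \forall y \near x, P (cmap c y).
Proof. by move=> /atlas_chart [_ _ _ H _] cx; exact: (H x cx). Qed.

Lemma near_cinv c x (P : set M) : atlas c -> cdom c x ->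
  nbhs x P -> \forall z \near cmap c x, P (cinv c z).
Proof.
move=> ac cx nP; have [_ _ _ _ H] := atlas_chart ac.
by apply: (H (cmap c x)); [exists x|rewrite cmapK].
Qed.

Lemma open_chart_image c (O : set M) : atlas c -> open O -> O `<=` cdom c ->
  open (cmap c @` O).
Proof.
move=> ac oO Oc; rewrite openE => _ [x Ox <-]; rewrite /interior.
near=> z.
have ciz : cimg c z by near: z; apply: cimg_nbhs => //; exact: Oc.
exists (cinv c z); last by rewrite cinvK.
near: z; apply: near_cinv => //; [exact: Oc|exact: open_nbhs_nbhs].
Unshelve. all: by end_near. Qed.

(** Smoothness of a germ, read in some chart as the restriction of a smooth
    function defined on all of the model space; bump functions make the
    globally defined representative available. *)
Definition smooth_at (f : M -> R) x :=
  exists c (F : 'rV[R]_n -> R^o), [/\ atlas c, cdom c x, gsmooth F &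
    \forall y \near x, f y = F (cmap c y)].

(** A change of chart is smooth, and the composite extends to the model space. *)
Lemma smooth_at_chart (f : M -> R) x c : smooth_at f x -> atlas c -> cdom c x ->
  exists2 F : 'rV[R]_n -> R^o, gsmooth F & \forall y \near x, f y = F (cmap c y).
Proof.
move=> [d [F [ad dx sF fF]]] ac cx.
have [_ comp] := atlas_compatible ad ac.
pose O := cmap c @` (cdom c `&` cdom d).
have oO : open O.
  apply: (open_chart_image ac); last by move=> y [].
  by apply: openI; [exact: (cdom_open ac)|exact: (cdom_open ad)].
have [sc _] := atlas_compatible ac ad.
have Ox : O (cmap c x) by exists x.
have sG j : Ck O j (F \o (cmap d \o cinv c)).
  have cdc : Ck O j (cmap d \o cinv c) by move/smooth_onP: sc; exact.
  exact: (@Ck_comp _ _ _ _ setT _ _ _ oO (fun _ _ => I) cdc (sF j)).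
have [G sg GE] := gsmooth_germ oO Ox sG.
exists G => //; near=> y.
have cy : cdom c y by near: y; exact: (cdom_nbhs ac cx).
have -> : G (cmap c y) = F (cmap d (cinv c (cmap c y))).
  by near: y; exact: (near_cmap ac cx GE).
by rewrite cmapK //; near: y.
Unshelve. all: by end_near. Qed.

Lemma smooth_at_near (f : M -> R) x : smooth_at f x -> \forall y \near x, smooth_at f y.
Proof.
move=> [c [F [ac cx sF /nbhs_interior nf]]].
by apply: filterS2 (cdom_nbhs ac cx) nf => y cy fF; exists c, F.
Qed.

Lemma smooth_at_ext (f g : M -> R) x : (\forall y \near x, f y = g y) ->
  smooth_at f x -> smooth_at g x.
Proof.
move=> fg [c [F [ac cx sF fF]]]; exists c, F; split=> //.
by apply: filterS2 fg fF => y -> .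
Qed.

Lemma smooth_funP (f : M -> R) : smooth_fun f <-> forall x, smooth_at f x.
Proof.
split=> [sf x|H c ac].
  have [c ac cx] := atlas_cover x; have /smooth_onP sfc := sf c ac.
  have [_ oc _ _ _] := atlas_chart ac.
  have cix : cimg c (cmap c x) by exists x.
  have [F sF FE] := gsmooth_germ oc cix sfc.
  exists c, F; split=> //; near=> y.
  have cy : cdom c y by near: y; exact: (cdom_nbhs ac cx).
  have -> : F (cmap c y) = f (cinv c (cmap c y)) by near: y; exact: (near_cmap ac cx FE).
  by rewrite cmapK.
apply/smooth_onP => j; apply: Ck_local => _ [x cx <-].
have [F sF fF] := smooth_at_chart (H x) ac cx.
have : nbhs (cmap c x) [set z | F z = f (cinv c z)].
  near=> z; have ciz : cimg c z by near: z; exact: (cimg_nbhs ac cx).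
  rewrite /= -{1}(cinvK ac ciz); apply/esym.
  by near: z; exact: (near_cinv ac cx fF).
rewrite nbhsE => -[Q [oQ Qx] QE]; exists Q; split=> //.
by apply: Ck_ext (Ck_sub (@subsetT _ Q) (sF j)).
Unshelve. all: by end_near. Qed.

Lemma smooth_fun_at (f : M -> R) x : smooth_fun f -> smooth_at f x.
Proof. by move=> /smooth_funP. Qed.

Lemma smooth_at_cst (r : R) x : smooth_at (fun=> r) x.
Proof.
have [c ac cx] := atlas_cover x; exists c, (fun=> r); split=> //.
- by move=> j; exact: (Ck_cst openT).
- exact: nearW.
Qed.

Lemma smooth_atD (f g : M -> R) x : smooth_at f x -> smooth_at g x ->
  smooth_at (fun y => f y + g y) x.
Proof.
move=> [c [F [ac cx sF fF]]] sg; have [G sG gG] := smooth_at_chart sg ac cx.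
exists c, (fun z => F z + G z); split=> //.
- by move=> j; exact: (CkD openT).
- by apply: filterS2 fF gG => y -> ->.
Qed.

Lemma smooth_atM (f g : M -> R) x : smooth_at f x -> smooth_at g x ->
  smooth_at (fun y => f y * g y) x.
Proof.
move=> [c [F [ac cx sF fF]]] sg; have [G sG gG] := smooth_at_chart sg ac cx.
exists c, (fun z => F z * G z); split=> //.
- by move=> j; exact: (CkM openT).
- by apply: filterS2 fF gG => y -> ->.
Qed.

Lemma smooth_at_sum m (f : 'I_m -> M -> R) x : (forall i, smooth_at (f i) x) ->
  smooth_at (fun y => \sum_i f i y) x.
Proof.
elim: m f => [|m IH] f H.
  by apply: smooth_at_ext (smooth_at_cst 0 x); apply: nearW => y; rewrite big_ord0.
apply: smooth_at_ext (smooth_atD (H ord0) (IH (fun i => f (lift ord0 i)) _)) => //.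
by apply: nearW => y; rewrite big_ord_recl.
Qed.

Lemma smooth_at_coord c x i : atlas c -> cdom c x -> smooth_at (fun y => cmap c y 0 i) x.
Proof.
move=> ac cx; exists c, (fun z => z 0 i); split=> //; last exact: nearW.
by move=> j; exact: Ck_coordinate openT.
Qed.

Lemma smooth_fun_cst (r : R) : smooth_fun (fun _ : M => r).
Proof. by apply/smooth_funP => x; exact: smooth_at_cst. Qed.

Lemma smooth_funD (f g : M -> R) : smooth_fun f -> smooth_fun g ->
  smooth_fun (fun y => f y + g y).
Proof. by move=> /smooth_funP sf /smooth_funP sg; apply/smooth_funP => x; exact: smooth_atD. Qed.

Lemma smooth_funM (f g : M -> R) : smooth_fun f -> smooth_fun g ->
  smooth_fun (fun y => f y * g y).
Proof. by move=> /smooth_funP sf /smooth_funP sg; apply/smooth_funP => x; exact: smooth_atM. Qed.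

Lemma smooth_funB (f g : M -> R) : smooth_fun f -> smooth_fun g ->
  smooth_fun (fun y => f y - g y).
Proof.
move=> sf sg; rewrite (_ : (fun y => _) = fun y => f y + -1 * g y).
  by apply: smooth_funD => //; apply: smooth_funM => //; exact: smooth_fun_cst.
by apply/funext => y; rewrite mulN1r.
Qed.

Lemma smooth_fun_sum m (f : 'I_m -> M -> R) : (forall i, smooth_fun (f i)) ->
  smooth_fun (fun y => \sum_i f i y).
Proof.
by move=> H; apply/smooth_funP => x; apply: smooth_at_sum => i; exact: smooth_fun_at.
Qed.

(** The set [K] is the image of a closed ball under a chart inverse: it is compact,
    hence closed in the Hausdorff manifold, and the extension by [0] outside the
    chart is smooth. *)
Lemma bump_manifold x (W : set M) : nbhs x W -> exists chi K,
  [/\ smooth_fun (chi : M -> R), \forall y \near x, chi y = 1, closed K, K `<=` W &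
      forall y, ~ K y -> chi y = 0].
Proof.
move=> nW; have [c ac cx] := atlas_cover x.
have [oc oci _ _ cci] := atlas_chart ac.
have /nbhs_ballP[e /= e0 He] : nbhs (cmap c x) [set z | cimg c z /\ W (cinv c z)].
  by apply: filterI; [exact: cimg_nbhs|exact: near_cinv].
have e20 : 0 < e / 2 by rewrite divr_gt0.
have [chi0 [sc c0 c1]] := bump_rV (cmap c x) e20.
pose K0 := [set z : 'rV[R]_n | `|z - cmap c x| <= e / 2].
have K0e z : K0 z -> cimg c z /\ W (cinv c z).
  move=> Kz; apply: He; rewrite -ball_normE /= distrC (le_lt_trans Kz) //.
  by rewrite ltr_pdivrMr // mulr_natr mulr2n ltrDl.
have cK0 : compact K0.
  apply: bounded_closed_compact.
    exists (e / 2 + `|cmap c x|); split; first exact: num_real.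
    move=> N rN z Kz /=; apply: le_trans (ltW rN).
    by rewrite -{1}(subrK (cmap c x) z); apply: le_trans (ler_normD _ _) _; rewrite lerD2r.
  apply: (@closed_comp _ _ (fun y : 'rV[R]_n => `|y - cmap c x|) [set t | t <= e / 2]); last exact: closed_le.
  move=> y _; apply: continuous_comp; last exact: norm_continuous.
  by apply: continuousB => //; exact: cst_continuous.
have clK : closed (cinv c @` K0).
  apply: compact_closed; first exact: mhausdorff.
  apply: continuous_compact => //; apply: continuous_in_subspaceT => z.
  by rewrite inE => /K0e [ciz _]; exact: cci.
pose chi y := if `[< cdom c y >] then chi0 (cmap c y) else 0.
have chi0E y : ~ (cinv c @` K0) y -> chi y = 0.
  rewrite /chi; case: asboolP => // cy nK; apply: c0; rewrite leNgt; apply/negP => lt.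
  by apply: nK; exists (cmap c y); [exact: ltW|rewrite cmapK].
have chiE y : cdom c y -> \forall z \near y, chi z = chi0 (cmap c z).
  by move=> cy; apply: filterS (cdom_nbhs ac cy) => z cz; rewrite /chi asboolT.
exists chi, (cinv c @` K0); split=> //.
- apply/smooth_funP => y; have [cy|ncy] := pselect (cdom c y).
    by exists c, chi0; split=> //; exact: chiE.
  apply: smooth_at_ext (smooth_at_cst 0 y).
  have : nbhs y (~` (cinv c @` K0)).
    apply: open_nbhs_nbhs; split; first exact: closed_openC.
    by move=> [z /K0e[ciz _]] zy; apply: ncy; rewrite -zy; exact: cinv_cdom.
  by apply: filterS => z /chi0E ->.
- by apply: filterS2 (chiE x cx) (near_cmap ac cx c1) => y -> ->.
- by move=> _ [z /K0e[_ Wz] <-].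
Qed.

(** Derivations act on functions defined on all of [M]; through this extension
    they can be computed from germs. *)
Lemma smooth_at_extend (f : M -> R) x : smooth_at f x ->
  exists2 F, smooth_fun F & \forall y \near x, F y = f y.
Proof.
move=> /smooth_at_near nf; have [chi [K [schi c1 cK KW c0]]] := bump_manifold nf.
exists (fun y => chi y * f y); last by apply: filterS c1 => y ->; rewrite mul1r.
apply/smooth_funP => y; have [Ky|nKy] := pselect (K y).
  by apply: smooth_atM; [exact: smooth_fun_at|exact: KW].
apply: smooth_at_ext (smooth_at_cst 0 y).
have : nbhs y (~` K) by apply: open_nbhs_nbhs; split=> //; exact: closed_openC.
by apply: filterS => z /c0 ->; rewrite mul0r.
Qed.

End Charts.

Section Maps.
Context {R : realType} {m n : nat} {N : manifold R m} {M : manifold R n}.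

Lemma smooth_map_comp (f : N -> M) (g : M -> R) :
  smooth_map f -> smooth_fun g -> smooth_fun (g \o f).
Proof.
move=> [cf sf] /smooth_funP sg; apply/smooth_funP => x.
have [c ac cx] := atlas_cover x; have [d ad dx] := atlas_cover (f x).
have [G sG gG] := smooth_at_chart (sg (f x)) ad dx.
pose O := cmap c @` (cdom c `&` f @^-1` cdom d).
have oO : open O.
  apply: (open_chart_image ac); last by move=> y [].
  apply: openI; first exact: (cdom_open ac).
  by apply: open_comp; [move=> y _; exact: cf|exact: (cdom_open ad)].
have Ox : O (cmap c x) by exists x.
have sGd j : Ck O j (G \o (cmap d \o f \o cinv c)).
  have cdf : Ck O j (cmap d \o f \o cinv c) by have /smooth_onP := sf c d ac ad; exact.
  exact: (@Ck_comp _ _ _ _ setT _ _ _ oO (fun _ _ => I) cdf (sG j)).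
have [F sF FE] := gsmooth_germ oO Ox sGd.
exists c, F; split=> //; near=> y.
have cy : cdom c y by near: y; exact: (cdom_nbhs ac cx).
have -> : F (cmap c y) = G (cmap d (f (cinv c (cmap c y)))).
  by near: y; exact: (near_cmap ac cx FE).
by rewrite cmapK //=; near: y; exact: (cf x _ gG).
Unshelve. all: by end_near. Qed.

(** Global functions see both the topology, through bump functions, and the
    coordinates, through extensions of their germs. Smoothness of sections can
    therefore be tested without charts of the target. *)
Lemma smooth_mapP (f : N -> M) : 
  (forall g, smooth_fun g -> smooth_fun (g \o f)) -> smooth_map f.
Proof.
move=> H; have cf : continuous f.
  move=> x W nW; have [chi [K [schi c1 cK KW c0]]] := bump_manifold nW.
  have /smooth_funP/(_ x)[c [F [ac cx sF FE]]] := H _ schi.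
  have Fx : F (cmap c x) = 1 by rewrite -(nbhs_singleton FE) /= (nbhs_singleton c1).
  have cF : {for cmap c x, continuous F} by exact: gsmooth_continuous.
  have np : \forall z \near cmap c x, 0 < F z.
    apply: (cF [set t | 0 < t]); rewrite /= Fx; exact: gt_nbhs.
  change (\forall y \near x, W (f y)).
  near=> y; apply: KW; apply: contrapT => /c0 E.
  have : 0 < F (cmap c y) by near: y; exact: (near_cmap ac cx np).
  have <- : chi (f y) = F (cmap c y) by near: y.
  by rewrite E ltxx.
split=> // c d ac ad; apply/smooth_onP => j.
have oO : open (cmap c @` (cdom c `&` f @^-1` cdom d)).
  apply: (open_chart_image ac); last by move=> y [].
  apply: openI; first exact: (cdom_open ac).
  by apply: open_comp; [move=> y _; exact: cf|exact: (cdom_open ad)].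
apply: (Ck_rowE oO) => i; apply: Ck_local => _ [x [cx dx] <-].
have [g sg gE] := smooth_at_extend (smooth_at_coord i ad dx).
have sgf := (smooth_funP _).1 (H g sg) x.
have [F sF FE] := smooth_at_chart sgf ac cx.
have : nbhs (cmap c x) [set z | F z = cmap d (f (cinv c z)) 0 i].
  near=> z; have ciz : cimg c z by near: z; exact: (cimg_nbhs ac cx).
  rewrite /= -{1}(cinvK ac ciz).
  have <- : (g \o f) (cinv c z) = F (cmap c (cinv c z)).
    by near: z; exact: (near_cinv ac cx FE).
  near: z; apply: (near_cinv (P := fun y => g (f y) = cmap d (f y) 0 i) ac cx).
  exact: (cf x _ gE).
rewrite nbhsE => -[Q [oQ Qx] QE]; exists Q; split=> //.
by apply: Ck_ext (Ck_sub (@subsetT _ Q) (sF j)).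
Unshelve. all: by end_near. Qed.

End Maps.

(** * Tangent vectors and vector fields *)

Section Tangent.
Context {R : realType} {n : nat} {M : manifold R n}.
Implicit Types (x y : M) (f g : M -> R).

Section Rules.
Context {x : M}.
Implicit Types D : tangent x.

Lemma tangent_derivation D : derivation_at x D.
Proof. by have /asboolP := tvalP D. Qed.

Lemma tangent_eq D1 D2 : (forall f, smooth_fun f -> D1 f = D2 f) -> D1 = D2.
Proof.
move=> H; apply: val_inj; apply/funext => f.
have [sf|nsf] := pselect (smooth_fun f); first exact: H.
have [_ _ z1] := tangent_derivation D1; have [_ _ z2] := tangent_derivation D2.
by rewrite /= z1 // z2.
Qed.

Lemma tanvD D1 D2 f : (D1 + D2) f = D1 f + D2 f. Proof. by []. Qed.
Lemma tanvZ a D f : (a *: D) f = a * D f. Proof. by []. Qed.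
Lemma tanvN D f : (- D) f = - D f. Proof. by []. Qed.
Lemma tanvB D1 D2 f : (D1 - D2) f = D1 f - D2 f. Proof. by []. Qed.
Lemma tanv0 f : (0 : tangent x) f = 0. Proof. by []. Qed.

Lemma tanv_sum m (D : 'I_m -> tangent x) f : (\sum_i D i) f = \sum_i D i f.
Proof.
elim: m D => [|m IH] D; first by rewrite !big_ord0.
by rewrite !big_ord_recl tanvD IH.
Qed.

Lemma derZD D r f g : smooth_fun f -> smooth_fun g ->
  D (fun y => r * f y + g y) = r * D f + D g.
Proof. by have [H _ _] := tangent_derivation D; exact: H. Qed.

Lemma derM D f g : smooth_fun f -> smooth_fun g ->
  D (fun y => f y * g y) = D f * g x + f x * D g.
Proof. by have [_ H _] := tangent_derivation D; exact: H. Qed.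

Lemma derD D f g : smooth_fun f -> smooth_fun g ->
  D (fun y => f y + g y) = D f + D g.
Proof.
move=> sf sg; rewrite -[D f]mul1r -derZD //; congr (Defs.tval D _).
by apply/funext => y; rewrite mul1r.
Qed.

Lemma der_cst D r : D (fun=> r) = 0.
Proof.
have s1 := @smooth_fun_cst R n M 1; have s0 := @smooth_fun_cst R n M 0.
have D1 : D (fun=> 1) = 0.
  have E : D (fun=> 1) = D (fun=> 1) + D (fun=> 1).
    transitivity (D (fun=> 1 * 1)); last by rewrite derM // mulr1 mul1r.
    by congr (Defs.tval D _); apply/funext => y; rewrite mulr1.
  by apply: (addrI (D (fun=> 1))); rewrite addr0 {3}E.
have D0 : D (fun=> 0) = 0.
  transitivity (D (fun=> 0 * 0)).
    by congr (Defs.tval D _); apply/funext => y; rewrite mulr0.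
  by rewrite derM // mulr0 mul0r addr0.
transitivity (D (fun=> r * 1 + 0)).
  by congr (Defs.tval D _); apply/funext => y; rewrite mulr1 addr0.
by rewrite (derZD D r s1 s0) D1 D0 mulr0 addr0.
Qed.

Lemma derZ D r f : smooth_fun f -> D (fun y => r * f y) = r * D f.
Proof.
move=> sf; transitivity (D (fun y => r * f y + 0)).
  by congr (Defs.tval D _); apply/funext => y; rewrite addr0.
by rewrite (derZD D r sf (smooth_fun_cst 0)) der_cst addr0.
Qed.

Lemma derB D f g : smooth_fun f -> smooth_fun g ->
  D (fun y => f y - g y) = D f - D g.
Proof.
move=> sf sg; rewrite -[- D g]mulN1r addrC -derZD //; congr (Defs.tval D _).
by apply/funext => y; rewrite mulN1r addrC.
Qed.

Lemma der_sum D m (f : 'I_m -> M -> R) : (forall i, smooth_fun (f i)) ->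
  D (fun y => \sum_i f i y) = \sum_i D (f i).
Proof.
elim: m f => [|m IH] f sf.
  rewrite big_ord0 -[RHS](der_cst D 0); congr (Defs.tval D _).
  by apply/funext => y; rewrite big_ord0.
rewrite big_ord_recl -IH // -derD //; last exact: smooth_fun_sum.
by congr (Defs.tval D _); apply/funext => y; rewrite big_ord_recl.
Qed.

(** The difference vanishes near [x]: multiply it by a bump function supported
    where it vanishes, and apply the Leibniz rule. *)
Lemma der_local D f g : smooth_fun f -> smooth_fun g ->
  (\forall y \near x, f y = g y) -> D f = D g.
Proof.
move=> sf sg fg; have [chi [K [schi c1 _ KW c0]]] := bump_manifold fg.
have sB := smooth_funB sf sg.
have := derM D schi sB.
rewrite (_ : (fun y => _) = fun=> 0); last first.
  apply/funext => y; have [/KW ->|/c0 ->] := pselect (K y); last by rewrite mul0r.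
  by rewrite subrr mulr0.
rewrite der_cst (nbhs_singleton fg) subrr mulr0 add0r (nbhs_singleton c1) mul1r.
by rewrite derB // => /esym/eqP; rewrite subr_eq0 => /eqP.
Qed.

(** Tangent vectors vanish on non-smooth functions, so [D] is first replaced by
    [0] there. *)
Lemma tangent_ofE (D : (M -> R) -> R) :
  (forall r f g, smooth_fun f -> smooth_fun g ->
     D (fun y => r * f y + g y) = r * D f + D g) ->
  (forall f g, smooth_fun f -> smooth_fun g ->
     D (fun y => f y * g y) = D f * g x + f x * D g) ->
  forall f, smooth_fun f -> tangent_of x D f = D f.
Proof.
move=> Dl Dm.
pose D' f : R^o := if `[< smooth_fun f >] then D f else 0.
have D'E f : smooth_fun f -> D' f = D f by move=> sf; rewrite /D' asboolT.
have dD : D' \in derivations x.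
  apply/asboolP; split=> [r f g sf sg|f g sf sg|f nsf].
  - rewrite !D'E ?Dl //; apply: smooth_funD => //.
    by apply: smooth_funM => //; exact: smooth_fun_cst.
  - by rewrite !D'E ?Dm //; exact: smooth_funM.
  - by rewrite /D' asboolF.
pose w := Tangent dD.
have Pw : [set w : tangent x | forall f, smooth_fun f -> w f = D f] w.
  by move=> f sf; rewrite /= D'E.
exact: (xgetI 0 Pw).
Qed.

End Rules.

(** ** Coordinate frames *)

Section Frame.
Variables (c : @chart R M n) (ac : atlas c).

Definition partial (i : 'I_n) y f : R :=
  'D_(delta_mx 0 i) (f \o cinv c : 'rV[R]_n -> R^o) (cmap c y).

Lemma partial_germ (F : 'rV[R]_n -> R^o) f y i : cdom c y ->
  (\forall z \near y, f z = F (cmap c z)) ->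
  partial i y f = 'D_(delta_mx 0 i) F (cmap c y).
Proof.
move=> cy fF; apply: near_eq_derive; near=> z.
have ciz : cimg c z by near: z; exact: (cimg_nbhs ac cy).
rewrite /= -[in RHS](cinvK ac ciz).
by near: z; exact: (near_cinv ac cy fF).
Unshelve. all: by end_near. Qed.

Lemma partial_smooth f y i : smooth_fun f -> cdom c y -> smooth_at (fun z => partial i z f) y.
Proof.
move=> sf cy; have [F sF FE] := smooth_at_chart (smooth_fun_at y sf) ac cy.
exists c, (fun z => 'D_(delta_mx 0 i) F z); split=> //.
  by move=> j; exact: (sF j.+1).2.
by apply: filterS2 (cdom_nbhs ac cy) (nbhs_interior FE) => z cz nz; exact: partial_germ.
Qed.

Lemma partialZD y i r f g : cdom c y -> smooth_fun f -> smooth_fun g ->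
  partial i y (fun y => r * f y + g y) = r * partial i y f + partial i y g.
Proof.
move=> cy sf sg.
have [F sF FE] := smooth_at_chart (smooth_fun_at y sf) ac cy.
have [G sG GE] := smooth_at_chart (smooth_fun_at y sg) ac cy.
rewrite (partial_germ _ cy FE) (partial_germ _ cy GE).
rewrite (@partial_germ (r *: F + G)) //; last by apply: filterS2 FE GE => z -> ->.
have dF : differentiable F (cmap c y) by exact: (sF 0%N _ I).
have dG : differentiable G (cmap c y) by exact: (sG 0%N _ I).
rewrite deriveD ?deriveZ //; try exact: diff_derivable.
by apply: derivableZ; exact: diff_derivable.
Qed.

Lemma partialM y i f g : cdom c y -> smooth_fun f -> smooth_fun g ->
  partial i y (fun y => f y * g y) = partial i y f * g y + f y * partial i y g.
Proof.
move=> cy sf sg.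
have [F sF FE] := smooth_at_chart (smooth_fun_at y sf) ac cy.
have [G sG GE] := smooth_at_chart (smooth_fun_at y sg) ac cy.
rewrite (partial_germ _ cy FE) (partial_germ _ cy GE).
rewrite (@partial_germ (F * G)) //; last by apply: filterS2 FE GE => z -> ->.
have dF : differentiable F (cmap c y) by exact: (sF 0%N _ I).
have dG : differentiable G (cmap c y) by exact: (sG 0%N _ I).
rewrite deriveM; try exact: diff_derivable.
rewrite (nbhs_singleton FE) (nbhs_singleton GE) /GRing.scale /=; ring.
Qed.

(** Hadamard's lemma makes a tangent vector the combination of the coordinate
    derivations given by its values on the coordinates. *)
Lemma der_partial (xi : 'I_n -> M -> R) y (D : tangent y) f :
  cdom c y -> (forall i, smooth_fun (xi i)) ->
  (forall i, \forall z \near y, xi i z = cmap c z 0 i) ->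
  smooth_fun f -> D f = \sum_i D (xi i) * partial i y f.
Proof.
move=> cy sxi xiE sf.
have [F sF FE] := smooth_at_chart (smooth_fun_at y sf) ac cy.
have [G [sG Ga GE]] := hadamard (cmap c y) sF.
have sGc i : smooth_at (fun z => G i (cmap c z)) y.
  by exists c, (G i); split=> //; exact: nearW.
pose h i := s2val (cid2 (smooth_at_extend (sGc i))).
have sh i : smooth_fun (h i) by exact: (s2valP (cid2 (smooth_at_extend (sGc i)))).
have hE i : \forall z \near y, h i z = G i (cmap c z).
  exact: (s2valP' (cid2 (smooth_at_extend (sGc i)))).
have sd i : smooth_fun (fun z => xi i z - xi i y).
  by apply: smooth_funB => //; exact: smooth_fun_cst.
have sp i : smooth_fun (fun z => (xi i z - xi i y) * h i z) by exact: smooth_funM.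
have -> : D f = D (fun z => F (cmap c y) + \sum_i (xi i z - xi i y) * h i z).
  apply: der_local => //.
    by apply: smooth_funD; [exact: smooth_fun_cst|exact: smooth_fun_sum].
  have hA : \forall z \near y, forall i, h i z = G i (cmap c z) by exact: filter_forall.
  have xA : \forall z \near y, forall i, xi i z = cmap c z 0 i by exact: filter_forall.
  near=> z; have -> : f z = F (cmap c z) by near: z.
  rewrite GE; congr (_ + _); apply: eq_bigr => i _.
  have -> : h i z = G i (cmap c z) by move: i; near: z.
  have -> : xi i z = cmap c z 0 i by move: i; near: z.
  by rewrite (nbhs_singleton (xiE i)).
rewrite derD; [|exact: smooth_fun_cst|exact: smooth_fun_sum].
rewrite der_cst add0r der_sum //; apply: eq_bigr => i _.
rewrite derM // subrr mul0r addr0 derB // ?der_cst ?subr0; last exact: smooth_fun_cst.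
by rewrite (nbhs_singleton (hE i)) Ga (partial_germ i cy FE).
Unshelve. all: by end_near. Qed.

End Frame.

Local Notation smooth_vf := (smooth_sec (v := tangent_bundle M)).

(** The fields [Y i] are the coordinate derivations multiplied by a bump
    function equal to [1] near [x0]. The extended coordinates [xi] are an
    argument because, on the total space of a bundle, they have to be chosen
    adapted to the bundle. *)
Lemma coordinate_frame (c : @chart R M n) x0 (xi : 'I_n -> M -> R) :
  atlas c -> cdom c x0 -> (forall i, smooth_fun (xi i)) ->
  (forall i, \forall z \near x0, xi i z = cmap c z 0 i) ->
  exists2 Y : 'I_n -> forall y, tangent y, (forall i, smooth_vf (Y i)) &
    \forall y \near x0, forall D : tangent y, D = \sum_i D (xi i) *: Y i y.
Proof.
move=> ac cx sxi xiE.
have [chi [K [schi c1 cK KW c0]]] := bump_manifold (cdom_nbhs ac cx).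
pose P i y : tangent y := tangent_of y (partial c i y).
have PE i y f : cdom c y -> smooth_fun f -> P i y f = partial c i y f.
  move=> cy; apply: tangent_ofE => [r g h sg sh|g h sg sh].
    exact: partialZD.
  exact: partialM.
exists (fun i y => chi y *: P i y).
  move=> i f sf; apply/smooth_funP => y.
  have [Ky|nKy] := pselect (K y).
    have cy := KW y Ky.
    apply: smooth_at_ext (smooth_atM (smooth_fun_at y schi) (partial_smooth ac i sf cy)).
    by apply: filterS (cdom_nbhs ac cy) => z cz; rewrite tanvZ PE.
  apply: smooth_at_ext (smooth_at_cst 0 y).
  have : nbhs y (~` K) by apply: open_nbhs_nbhs; split=> //; exact: closed_openC.
  by apply: filterS => z /c0 E; rewrite tanvZ E mul0r.
have xiA : \forall y \near x0, forall i, \forall z \near y, xi i z = cmap c z 0 i.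
  by apply: filter_forall => i; exact: (nbhs_interior (xiE i)).
near=> y => D; apply: tangent_eq => f sf.
have cy : cdom c y by near: y; exact: (cdom_nbhs ac cx).
rewrite (der_partial ac (xi := xi) D cy) //; last by near: y.
rewrite tanv_sum; apply: eq_bigr => i _.
have -> : chi y = 1 by near: y.
by rewrite scale1r tanvZ PE.
Unshelve. all: by end_near. Qed.

Lemma local_frame x0 : exists (xi : 'I_n -> M -> R) (Y : 'I_n -> forall y, tangent y),
  [/\ forall i, smooth_fun (xi i), forall i, smooth_vf (Y i) &
      \forall y \near x0, forall D : tangent y, D = \sum_i D (xi i) *: Y i y].
Proof.
have [c ac cx] := atlas_cover x0.
pose e i := cid2 (smooth_at_extend (smooth_at_coord i ac cx)).
have sxi i : smooth_fun (s2val (e i)) by exact: (s2valP (e i)).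
have [Y sY YE] := coordinate_frame ac cx sxi (fun i => s2valP' (e i)).
by exists (fun i => s2val (e i)), Y.
Qed.

Lemma smooth_vf0 : smooth_vf (fun=> 0).
Proof. by move=> f sf; exact: smooth_fun_cst. Qed.

Lemma smooth_vfD X Y : smooth_vf X -> smooth_vf Y -> smooth_vf (fun y => X y + Y y).
Proof. by move=> sX sY f sf; apply: smooth_funD; [exact: sX|exact: sY]. Qed.

Lemma smooth_vfZ f X : smooth_fun f -> smooth_vf X -> smooth_vf (fun y => f y *: X y).
Proof. by move=> sf sX g sg; apply: smooth_funM => //; exact: sX. Qed.

Lemma smooth_vfB X Y : smooth_vf X -> smooth_vf Y -> smooth_vf (fun y => X y - Y y).
Proof. by move=> sX sY f sf; apply: smooth_funB; [exact: sX|exact: sY]. Qed.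

(** ** The Lie bracket *)

Lemma lieE X Y x f : smooth_vf X -> smooth_vf Y -> smooth_fun f ->
  lie X Y x f = X x (fun y => Y y f) - Y x (fun y => X y f).
Proof.
move=> sX sY; apply: tangent_ofE => [r g h sg sh|g h sg sh].
  have E (Z : forall y, tangent y) : (fun y => Z y (fun y => r * g y + h y)) =
      fun y => r * Z y g + Z y h.
    by apply/funext => y; rewrite derZD.
  have [sXg sXh sYg sYh] := And4 (sX g sg) (sX h sh) (sY g sg) (sY h sh).
  by rewrite !E !derZD //; ring.
have E (Z : forall y, tangent y) : (fun y => Z y (fun y => g y * h y)) =
    fun y => Z y g * h y + g y * Z y h.
  by apply/funext => y; rewrite derM.
have [sXg sXh sYg sYh] := And4 (sX g sg) (sX h sh) (sY g sg) (sY h sh).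
rewrite !E !derD ?derM //; try exact: smooth_funM.
by ring.
Qed.

Lemma smooth_lie X Y : smooth_vf X -> smooth_vf Y -> smooth_vf (lie X Y).
Proof.
move=> sX sY f sf; rewrite (_ : (fun x => _) =
  fun x => X x (fun y => Y y f) - Y x (fun y => X y f)).
  by apply: smooth_funB; [apply: sX; exact: sY|apply: sY; exact: sX].
by apply/funext => x; rewrite lieE.
Qed.

End Tangent.

(** * Tensoriality *)

Section Tensor.
Context {R : realType} {n : nat} {M : manifold R n}.
Variable V : vfamily M.
Local Notation section := (forall x, fib V x).
Local Notation smooth := (@smooth_sec R n M V).

Definition smooth_module : Prop :=
  (forall a b, smooth a -> smooth b -> smooth (fun x => a x + b x)) /\
  (forall f a, smooth_fun f -> smooth a -> smooth (fun x => f x *: a x)).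

(** The coefficients [g i] have to vanish at [q] together with the section: this
    turns linearity over functions into dependence on the value at [q]. *)
Definition locally_generated (q : M) : Prop :=
  exists m (Y : 'I_m -> section), (forall i, smooth (Y i)) /\
  forall a, smooth a -> exists (chi : M -> R) (g : 'I_m -> M -> R),
    [/\ smooth_fun chi, forall i, smooth_fun (g i), chi q = 1,
        a q = 0 -> forall i, g i q = 0 &
        forall y, chi y *: a y = \sum_i g i y *: Y i y].

(** [T a = chi(q) T a = T (chi a) = sum_i g_i(q) T(Y_i)], where the [g_i(q)]
    vanish. *)
Lemma tensor_vanish (W : lmodType R) (T : section -> W) (q : M) (a : section) :
  smooth_module -> locally_generated q ->
  (forall a b, smooth a -> smooth b -> T (fun x => a x + b x) = T a + T b) ->
  (forall f a, smooth_fun f -> smooth a -> T (fun x => f x *: a x) = f q *: T a) ->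
  smooth a -> a q = 0 -> T a = 0.
Proof.
move=> [sD sZ] [m [Y [sY gen]]] TD TZ sa a0.
have [chi [g [schi sg chi1 g0 E]]] := gen a sa.
have T0 : T (fun=> 0) = 0.
  have := TZ (fun=> 0) a (smooth_fun_cst 0) sa; rewrite scale0r => <-.
  by congr T; apply: functional_extensionality_dep => x; rewrite scale0r.
have -> : T a = T (fun x => chi x *: a x) by rewrite TZ // chi1 scale1r.
have -> : (fun x => chi x *: a x) = fun x => \sum_i g i x *: Y i x.
  by apply: functional_extensionality_dep.
have s0 : smooth (fun=> 0).
  have := sZ _ _ (@smooth_fun_cst R n M 0) sa.
  rewrite (_ : (fun x => _) = fun=> 0) //.
  by apply: functional_extensionality_dep => x; rewrite scale0r.
suff H (r : seq 'I_m) : smooth (fun x => \sum_(i <- r) g i x *: Y i x) /\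
    T (fun x => \sum_(i <- r) g i x *: Y i x) = 0 by rewrite (H _).2.
elim: r => [|i r [IH1 IH2]].
  have -> : (fun x => \sum_(i <- [::]) g i x *: Y i x) = fun=> 0.
    by apply: functional_extensionality_dep => x; rewrite big_nil.
  by split.
have -> : (fun x => \sum_(j <- i :: r) g j x *: Y j x) =
    fun x => g i x *: Y i x + \sum_(j <- r) g j x *: Y j x.
  by apply: functional_extensionality_dep => x; rewrite big_cons.
have sgY := sZ _ _ (sg i) (sY i).
by split; [exact: sD|rewrite TD // IH2 TZ // g0 // scale0r addr0].
Qed.

Lemma tensor_pointwise (W : lmodType R) (T : section -> W) (q : M) (a b : section) :
  smooth_module -> locally_generated q ->
  (forall a b, smooth a -> smooth b -> T (fun x => a x + b x) = T a + T b) ->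
  (forall f a, smooth_fun f -> smooth a -> T (fun x => f x *: a x) = f q *: T a) ->
  smooth a -> smooth b -> a q = b q -> T a = T b.
Proof.
move=> sm lg TD TZ sa sb ab; have [sD sZ] := sm.
have c1 := @smooth_fun_cst R n M (-1).
have sNb := sZ _ _ c1 sb.
have : T (fun x => a x + -1 *: b x) = 0.
  apply: (tensor_vanish sm lg TD TZ) => //; first exact: sD.
  by rewrite ab scaleN1r subrr.
by rewrite TD // (TZ (fun=> -1)) // scaleN1r => /eqP; rewrite subr_eq0 => /eqP.
Qed.

End Tensor.

Section TangentBundle.
Context {R : realType} {n : nat} {M : manifold R n}.

Lemma tangent_bundle_module : smooth_module (tangent_bundle M).
Proof. by split=> [a b|f a]; [exact: smooth_vfD|exact: smooth_vfZ]. Qed.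

Lemma tangent_bundle_generated (q : M) : locally_generated (tangent_bundle M) q.
Proof.
have [xi [Y [sxi sY YE]]] := local_frame q.
have [chi [K [schi c1 cK KW c0]]] := bump_manifold YE.
exists n, Y; split=> // a sa; exists chi, (fun i y => chi y * a y (xi i)).
split=> //.
- by move=> i; apply: smooth_funM => //; exact: sa.
- exact: (nbhs_singleton c1).
- by move=> a0 i; rewrite a0 tanv0 mulr0.
move=> y; have [Ky|/c0 ->] := pselect (K y).
  rewrite {1}(KW y Ky (a y)) scaler_sumr.
  by apply: eq_bigr => i _; rewrite scalerA.
by rewrite scale0r big1 // => i _; rewrite mul0r scale0r.
Qed.

Lemma vector_extend (q : M) (u : tangent q) :
  exists2 X : forall y, tangent y, smooth_sec (v := tangent_bundle M) X & X q = u.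
Proof.
have [xi [Y [sxi sY YE]]] := local_frame q.
exists (fun y => \sum_i u (xi i) *: Y i y); last by rewrite -(nbhs_singleton YE).
move=> f sf; rewrite (_ : (fun x => _) = fun x => \sum_i u (xi i) * Y i x f).
  apply: smooth_fun_sum => i; apply: smooth_funM; first exact: smooth_fun_cst.
  exact: sY.
by apply/funext => x; rewrite tanv_sum.
Qed.

Lemma tangent_span (q : M) : exists (xi : 'I_n -> M -> R) (Y : 'I_n -> tangent q),
  (forall i, smooth_fun (xi i)) /\ forall D : tangent q, D = \sum_i D (xi i) *: Y i.
Proof.
have [xi [Y [sxi sY YE]]] := local_frame q.
by exists xi, (fun i => Y i q); split=> //; exact: (nbhs_singleton YE).
Qed.

End TangentBundle.

(** * Sections of a vector bundle and functions on its total space *)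

Section Bundle.
Context {R : realType} {n : nat} {M : manifold R n} {k : nat} (E : vector_bundle M k).
Local Notation section := (forall x, bfib E x).
Local Notation smooth := (smooth_sec (v := bundle_family E)).

(** The vector [bvec (bpt v)] lies in the fibre over [bproj (bpt v)], which is [x]
    only up to a propositional equality; functions defined on all fibres do not
    see the transport. *)
Lemma at_bpt (T : Type) (h : forall x, bfib E x -> T) x (v : bfib E x) :
  h _ (bvec (bpt v)) = h x v.
Proof.
suff H y (e : y = x) (w : bfib E y) : bpt w = bpt v -> h y w = h x v.
  by apply: H; [exact: bproj_pt|exact: bptK].
by case: x / e v => v; move=> /bpt_inj ->.
Qed.

Lemma bproj_continuous : continuous (@bproj R n M k E).
Proof. by have [] := @bproj_smooth R n M k E. Qed.

Lemma smooth_pullback f : smooth_fun f -> smooth_fun (fun q : tot E => f (bproj q)).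
Proof. by move=> sf; exact: (smooth_map_comp (@bproj_smooth R n M k E) sf). Qed.

(** The content of [blocal], without the base point. *)
Definition trivializes (c : @chart R M n) (e : 'I_k -> section)
    (C : @chart R (tot E) (n + k)) : Prop :=
  [/\ atlas c,
      forall x, cdom c x -> forall v : bfib E x,
        exists! a : 'rV[R]_k, v = \sum_(i < k) a 0 i *: e i x,
      atlas C /\ cdom C = @bproj R n M k E @^-1` cdom c &
      forall x (a : 'rV[R]_k), cdom c x ->
        cmap C (bpt (\sum_(i < k) a 0 i *: e i x)) = row_mx (cmap c x) a].

Lemma trivialization_at x0 : exists c e C, trivializes c e C /\ cdom c x0.
Proof.
have [c [e [C [[ac cx] H1 H2 H3]]]] := blocal E x0.
by exists c, e, C.
Qed.

Definition fcoord (e : 'I_k -> section) x (v : bfib E x) : 'rV[R]_k :=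
  xget 0 [set a : 'rV[R]_k | v = \sum_i a 0 i *: e i x].

Section Triv.
Variables (c : @chart R M n) (e : 'I_k -> section) (C : @chart R (tot E) (n + k)).
Hypothesis T : trivializes c e C.

Lemma fcoordE x (v : bfib E x) : cdom c x -> v = \sum_i fcoord e v 0 i *: e i x.
Proof.
by move=> cx; have [_ H _ _] := T; have [a [Pa _]] := H x cx v;
  exact: (@xgetI _ 0 [set a : 'rV[R]_k | v = \sum_i a 0 i *: e i x] a Pa).
Qed.

Lemma fcoord_unique x (v : bfib E x) (a : 'rV[R]_k) : cdom c x ->
  v = \sum_i a 0 i *: e i x -> fcoord e v = a.
Proof.
move=> cx va; have [_ H _ _] := T; have [b [_ Pb]] := H x cx v.
by rewrite -(Pb _ va) (Pb _ (fcoordE v cx)).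
Qed.

Lemma fcoord_linear x : cdom c x -> linear (@fcoord e x).
Proof.
move=> cx r u v; apply: fcoord_unique => //.
rewrite {1}(fcoordE u cx) {1}(fcoordE v cx) scaler_sumr -big_split /=.
by apply: eq_bigr => i _; rewrite !mxE scalerDl scalerA.
Qed.

Lemma fcoord0 x : cdom c x -> fcoord e (0 : bfib E x) = 0.
Proof.
move=> cx; apply: fcoord_unique => //.
by rewrite big1 // => i _; rewrite mxE scale0r.
Qed.

Lemma fcoord_basis x i : cdom c x -> fcoord e (e i x) = delta_mx 0 i.
Proof.
move=> cx; apply: fcoord_unique => //; rewrite (bigD1 i) //= big1 => [|j ji].
  by rewrite mxE !eqxx scale1r addr0.
by rewrite mxE eqxx /= (negbTE ji) scale0r.
Qed.

Lemma cmap_bpt x (v : bfib E x) : cdom c x -> cmap C (bpt v) = row_mx (cmap c x) (fcoord e v).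
Proof. by move=> cx; have [_ _ _ H] := T; rewrite {1}(fcoordE v cx) H. Qed.

Lemma cmap_tot (q : tot E) : cdom c (bproj q) ->
  cmap C q = row_mx (cmap c (bproj q)) (fcoord e (bvec q)).
Proof. by move=> cq; rewrite -{1}(bptK q) cmap_bpt. Qed.

Lemma cdom_tot (q : tot E) : cdom c (bproj q) -> cdom C q.
Proof. by have [_ _ [_ ->] _] := T. Qed.

Lemma cdom_tot_nbhs (q : tot E) : cdom c (bproj q) -> nbhs q [set p : tot E | cdom c (bproj p)].
Proof.
by move=> cq; apply: bproj_continuous; have [ac _ _ _] := T; exact: cdom_nbhs.
Qed.

Lemma smooth_at_fcoord (q : tot E) i : cdom c (bproj q) ->
  smooth_at (fun p : tot E => fcoord e (bvec p) 0 i) q.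
Proof.
move=> cq; have [_ _ [aC _] _] := T.
apply: smooth_at_ext (smooth_at_coord (rshift n i) aC (cdom_tot cq)).
by apply: filterS (cdom_tot_nbhs cq) => p cp; rewrite cmap_tot // row_mxEr.
Qed.

Lemma section_smooth_fcoord (s : section) x0 i : smooth s -> cdom c x0 ->
  smooth_at (fun x => fcoord e (s x) 0 i) x0.
Proof.
move=> ss cx; have [ac _ [aC CE] _] := T.
have Cs : cdom C (bpt (s x0)) by rewrite CE /= bproj_pt.
have [g sg gE] := smooth_at_extend (smooth_at_coord (rshift n i) aC Cs).
apply: smooth_at_ext (smooth_fun_at x0 (smooth_map_comp ss sg)).
have cs : {for x0, continuous (fun x => bpt (s x) : tot E)} by have [+ _] := ss; exact.
apply: filterS2 (cdom_nbhs ac cx) (cs _ gE) => x cx' /= ->.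
by rewrite cmap_bpt // row_mxEr.
Qed.

(** In the chart of the total space the section is the graph of its
    coordinates. *)
Lemma section_comp_smooth_at (s : section) x0 g : cdom c x0 ->
  (forall i, smooth_at (fun x => fcoord e (s x) 0 i) x0) -> smooth_fun g ->
  smooth_at (fun x => g (bpt (s x) : tot E)) x0.
Proof.
move=> cx sa sg; have [ac _ [aC CE] _] := T.
have Cs : cdom C (bpt (s x0)) by rewrite CE /= bproj_pt.
have [_ oC _ _ _] := atlas_chart aC.
have iCs : cimg C (cmap C (bpt (s x0))) by exists (bpt (s x0)).
have sgC : forall j, Ck (cimg C) j (g \o cinv C : _ -> R^o) by apply/smooth_onP; exact: sg.
have [G sG GE] := gsmooth_germ oC iCs sgC.
pose f i := cid2 (smooth_at_chart (sa i) ac cx).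
pose A i := s2val (f i).
have sA i : gsmooth (A i) by exact: (s2valP (f i)).
have AE : \forall y \near x0, forall i, fcoord e (s y) 0 i = A i (cmap c y).
  by apply: filter_forall => i; exact: (s2valP' (f i)).
pose Z (y : 'rV[R]_n) : 'rV[R]_(n + k) := row_mx y (\row_i A i y).
have sZ : gsmooth Z.
  move=> j; apply: (Ck_rowE openT) => l; case: (split_ordP l) => i ->.
    apply: Ck_ext (Ck_coordinate j i openT) => //; first exact: openT.
    by move=> y _; rewrite row_mxEl.
  apply: Ck_ext (sA i j) => //; first exact: openT.
  by move=> y _; rewrite row_mxEr mxE.
have ZE : \forall y \near x0, Z (cmap c y) = cmap C (bpt (s y)).
  apply: filterS2 (cdom_nbhs ac cx) AE => y cy Ay.
  rewrite cmap_bpt // /Z; congr row_mx; apply/rowP => i.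
  by rewrite mxE Ay.
exists c, (G \o Z); split=> //.
  by move=> j; exact: (@Ck_comp _ _ _ _ setT _ _ _ openT (fun _ _ => I) (sZ j) (sG j)).
have cZ : {for cmap c x0, continuous Z} by exact: gsmooth_continuous.
have GZ : \forall y \near x0, G (Z (cmap c y)) = g (cinv C (Z (cmap c y))).
  apply: (near_cmap (P := fun y => G (Z y) = g (cinv C (Z y))) ac cx).
  suff GZ0 : nbhs (Z (cmap c x0)) [set z | G z = g (cinv C z)] by exact: (cZ _ GZ0).
  by rewrite (nbhs_singleton ZE).
near=> y; rewrite /=.
have -> : G (Z (cmap c y)) = g (cinv C (Z (cmap c y))) by near: y.
have -> : Z (cmap c y) = cmap C (bpt (s y)) by near: y.
have cy : cdom c y by near: y; exact: (cdom_nbhs ac cx).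
by rewrite cmapK // CE /= bproj_pt.
Unshelve. all: by end_near. Qed.

End Triv.

Lemma section_smoothI (s : section) :
  (forall x0, exists c e C, [/\ trivializes c e C, cdom c x0 &
     forall i, smooth_at (fun x => fcoord e (s x) 0 i) x0]) -> smooth s.
Proof.
move=> H; apply: smooth_mapP => g sg; apply/smooth_funP => x0.
have [c [e [C [T cx sa]]]] := H x0.
exact: (section_comp_smooth_at T cx sa sg).
Qed.

Lemma bundle_module : smooth_module (bundle_family E).
Proof.
split=> [a b sa sb|f a sf sa]; apply: section_smoothI => x0;
  have [c [e [C [T cx]]]] := trivialization_at x0; have [ac _ _ _] := T;
  exists c, e, C; split=> // i.
- apply: smooth_at_ext (smooth_atD (section_smooth_fcoord T i sa cx)
    (section_smooth_fcoord T i sb cx)).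
  apply: filterS (cdom_nbhs ac cx) => x cx'.
  have := fcoord_linear T cx' 1 (a x) (b x); rewrite !scale1r => ->.
  by rewrite mxE.
- apply: smooth_at_ext (smooth_atM (smooth_fun_at x0 sf) (section_smooth_fcoord T i sa cx)).
  apply: filterS (cdom_nbhs ac cx) => x cx'.
  have := fcoord_linear T cx' (f x) (a x) 0; rewrite addr0 => ->.
  by rewrite (fcoord0 T cx') addr0 mxE.
Qed.

Lemma section_D (s t : section) : smooth s -> smooth t -> smooth (fun x => s x + t x).
Proof. by have [H _] := bundle_module; exact: H. Qed.

Lemma section_Z f (s : section) : smooth_fun f -> smooth s -> smooth (fun x => f x *: s x).
Proof. by have [_ H] := bundle_module; exact: H. Qed.

Lemma section_0 : smooth (fun=> 0 : bfib E _).
Proof.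
apply: section_smoothI => x0.
have [c [e [C [T cx]]]] := trivialization_at x0; have [ac _ _ _] := T.
exists c, e, C; split=> // i; apply: smooth_at_ext (smooth_at_cst 0 x0).
by apply: filterS (cdom_nbhs ac cx) => x cx'; rewrite (fcoord0 T cx') mxE.
Qed.

Lemma section_sum m (s : 'I_m -> section) : (forall i, smooth (s i)) ->
  smooth (fun x => \sum_i s i x).
Proof.
elim: m s => [|m IH] s ss.
  have -> : (fun x => \sum_i s i x) = fun=> 0; last exact: section_0.
  by apply: functional_extensionality_dep => x; rewrite big_ord0.
have -> : (fun x => \sum_i s i x) = fun x => s ord0 x + \sum_i s (lift ord0 i) x.
  by apply: functional_extensionality_dep => x; rewrite big_ord_recl.
by apply: section_D => //; exact: (IH (fun i => s (lift ord0 i))).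
Qed.

(** Sections of the dual bundle are represented by the fibrewise linear
    functions that they define on the total space. *)
Definition ell (xi : forall x, bfib E x -> R) (q : tot E) : R := xi (bproj q) (bvec q).

Definition dual_section (xi : forall x, bfib E x -> R) : Prop :=
  (forall x r (u v : bfib E x), xi x (r *: u + v) = r * xi x u + xi x v) /\
  smooth_fun (ell xi).

Section Dual.
Variable xi : forall x, bfib E x -> R.
Hypothesis dxi : dual_section xi.

Lemma ell_bpt x (v : bfib E x) : ell xi (bpt v) = xi v.
Proof. exact: at_bpt. Qed.

Lemma dual0 x : xi (0 : bfib E x) = 0.
Proof.
have := dxi.1 x 1 0 0; rewrite scale1r mul1r addr0 => E0.
by apply: (addrI (xi (0 : bfib E x))); rewrite addr0 {3}E0.
Qed.

Lemma dualD x (u v : bfib E x) : xi (u + v) = xi u + xi v.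
Proof. by have := dxi.1 x 1 u v; rewrite scale1r mul1r. Qed.

Lemma dualZ x r (u : bfib E x) : xi (r *: u) = r * xi u.
Proof. by have := dxi.1 x r u 0; rewrite dual0 !addr0. Qed.

Lemma dual_sum x m (u : 'I_m -> bfib E x) : xi (\sum_i u i) = \sum_i xi (u i).
Proof.
elim: m u => [|m IH] u; first by rewrite !big_ord0 dual0.
by rewrite !big_ord_recl dualD IH.
Qed.

Lemma dual_smooth (s : section) : smooth s -> smooth_fun (fun x => xi (s x)).
Proof.
move=> ss; rewrite (_ : (fun x => _) = ell xi \o (fun x => bpt (s x))).
  by apply: smooth_map_comp => //; exact: dxi.2.
by apply/funext => x; rewrite /= ell_bpt.
Qed.

End Dual.

(** Take the frame [e] and its dual frame, multiplied by a bump function. *)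
Lemma cutoff_frame c e C x0 : trivializes c e C -> cdom c x0 ->
  exists (s : 'I_k -> section) (xi : 'I_k -> forall x, bfib E x -> R),
  [/\ forall i, smooth (s i), forall i, dual_section (xi i),
      \forall x \near x0, forall v : bfib E x, v = \sum_i xi i x v *: s i x &
      \forall x \near x0, forall i (v : bfib E x), xi i x v = fcoord e v 0 i].
Proof.
move=> T cx; have [ac _ _ _] := T.
have [chi [K [schi c1 cK KW c0]]] := bump_manifold (cdom_nbhs ac cx).
have nK x : ~ K x -> nbhs x (~` K).
  by move=> nKx; apply: open_nbhs_nbhs; split=> //; exact: closed_openC.
pose xi i x (v : bfib E x) : R := chi x * fcoord e v 0 i.
exists (fun i x => chi x *: e i x), xi.
have chiE : \forall x \near x0, chi x = 1 by [].
split.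
- move=> i; apply: section_smoothI => x; have [Kx|nKx] := pselect (K x).
    have cx' := KW x Kx; exists c, e, C; split=> // j.
    apply: smooth_at_ext (smooth_atM (smooth_fun_at x schi) (smooth_at_cst ((j == i)%:R) x)).
    apply: filterS (cdom_nbhs ac cx') => y cy.
    have := fcoord_linear T cy (chi y) (e i y) 0; rewrite addr0 => ->.
    by rewrite (fcoord0 T cy) addr0 mxE (fcoord_basis T _ cy) mxE eqxx.
  have [c' [e' [C' [T' cx']]]] := trivialization_at x; have [ac' _ _ _] := T'.
  exists c', e', C'; split=> // j.
  apply: smooth_at_ext (smooth_at_cst 0 x).
  apply: filterS2 (cdom_nbhs ac' cx') (nK x nKx) => y cy /c0 ->.
  by rewrite scale0r (fcoord0 T' cy) mxE.
- move=> i; split=> [x r u v|].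
    have [Kx|/c0 E0] := pselect (K x); last by rewrite /xi E0 !mul0r mulr0 addr0.
    by rewrite /xi (fcoord_linear T (KW x Kx)) !mxE; ring.
  apply/smooth_funP => q; have [Kq|nKq] := pselect (K (bproj q)).
    apply: smooth_atM; first exact: smooth_fun_at (smooth_pullback schi).
    exact: (smooth_at_fcoord T i (KW _ Kq)).
  apply: smooth_at_ext (smooth_at_cst 0 q).
  have : nbhs q [set p : tot E | ~ K (bproj p)] by exact: (bproj_continuous (nK _ nKq)).
  apply: filterS => p /c0 E0.
  by rewrite /ell /xi E0 mul0r.
- apply: filterS2 (cdom_nbhs ac cx) chiE => x cx' E1 v.
  rewrite {1}(fcoordE T v cx'); apply: eq_bigr => i _.
  by rewrite /xi E1 mul1r scale1r.
- by apply: filterS chiE => x E1 i v; rewrite /xi E1 mul1r.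
Qed.

Lemma bundle_frame (x0 : M) : exists (s : 'I_k -> section) (xi : 'I_k -> forall x, bfib E x -> R),
  [/\ forall i, smooth (s i), forall i, dual_section (xi i) &
      \forall x \near x0, forall v : bfib E x, v = \sum_i xi i x v *: s i x].
Proof.
have [c [e [C [T cx]]]] := trivialization_at x0.
by have [s [xi [ss dxi H _]]] := cutoff_frame T cx; exists s, xi.
Qed.

Lemma bundle_generated (q : M) : locally_generated (bundle_family E) q.
Proof.
have [Y [xi [sY dxi YE]]] := bundle_frame q.
have [chi [K [schi c1 cK KW c0]]] := bump_manifold YE.
exists k, Y; split=> // a sa; exists chi, (fun i y => chi y * xi i y (a y)).
split=> //.
- by move=> i; apply: smooth_funM => //; exact: dual_smooth.
- exact: (nbhs_singleton c1).
- by move=> a0 i; rewrite a0 dual0 // mulr0.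
move=> y; have [Ky|/c0 ->] := pselect (K y).
  rewrite {1}(KW y Ky (a y)) scaler_sumr.
  by apply: eq_bigr => i _; rewrite scalerA.
by rewrite scale0r big1 // => i _; rewrite mul0r scale0r.
Qed.

Lemma section_extend (q : M) (v : bfib E q) : exists2 s : section, smooth s & s q = v.
Proof.
have [s [xi [ss dxi sE]]] := bundle_frame q.
exists (fun x => \sum_i xi i q v *: s i x); last by rewrite -(nbhs_singleton sE).
apply: section_sum => i; apply: (section_Z (f := fun=> xi i q v)) => //.
exact: smooth_fun_cst.
Qed.

(** Near [q0] the chart of the total space given by a trivialization has for
    coordinates functions pulled back from the base and fibrewise linear
    functions. Tangent vectors and vector fields on the total space can thus be
    tested on such functions, which is how all identities about lifts are
    proved. *)
Lemma tot_frame (q0 : tot E) : exists (f : 'I_n -> M -> R)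
    (xi : 'I_k -> forall x, bfib E x -> R) (Y : 'I_(n + k) -> forall q : tot E, tangent q),
  [/\ forall i, smooth_fun (f i), forall i, dual_section (xi i),
      forall j, smooth_sec (v := tangent_bundle (tot E)) (Y j) &
      \forall q \near q0, forall D : tangent q,
        D = \sum_i D (fun p => f i (bproj p)) *: Y (lshift k i) q
            + \sum_i D (ell (xi i)) *: Y (rshift n i) q].
Proof.
have [c [e [C [T cx]]]] := trivialization_at (bproj q0).
have [ac _ [aC CE] _] := T.
have [s [xi [ss dxi _ xiE]]] := cutoff_frame T cx.
pose g i := cid2 (smooth_at_extend (smooth_at_coord i ac cx)).
pose f i := s2val (g i).
have sf i : smooth_fun (f i) by exact: (s2valP (g i)).
have fE i : \forall y \near bproj q0, f i y = cmap c y 0 i by exact: (s2valP' (g i)).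
pose z (l : 'I_(n + k)) : tot E -> R := match fintype.split l with
  | inl i => fun p => f i (bproj p) | inr i => ell (xi i) end.
have zl i : z (lshift k i) = fun p => f i (bproj p).
  by rewrite /z -[lshift k i]/(unsplit (inl i)) unsplitK.
have zr i : z (rshift n i) = ell (xi i).
  by rewrite /z -[rshift n i]/(unsplit (inr i)) unsplitK.
have sz l : smooth_fun (z l).
  rewrite /z; case: (fintype.split l) => i; first exact: smooth_pullback.
  exact: (dxi i).2.
have zE l : \forall q \near q0, z l q = cmap C q 0 l.
  have H := cdom_tot_nbhs T cx; case: (split_ordP l) => i ->.
    rewrite zl; apply: filterS2 H (bproj_continuous (fE i)) => q cq Eq.
    by rewrite (cmap_tot T cq) row_mxEl.
  rewrite zr; apply: filterS2 H (bproj_continuous xiE) => q cq Eq.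
  by rewrite (cmap_tot T cq) row_mxEr /ell Eq.
have [Y sY YE] := coordinate_frame aC (cdom_tot T cx) sz zE.
exists f, xi, Y; split=> //; apply: filterS YE => q H D.
rewrite {1}(H D) big_split_ord /=; congr (_ + _); apply: eq_bigr => i _.
  by rewrite zl.
by rewrite zr.
Qed.

Lemma tot_tangent_eq (q : tot E) (D1 D2 : tangent q) :
  (forall f, smooth_fun f -> D1 (fun p => f (bproj p)) = D2 (fun p => f (bproj p))) ->
  (forall xi, dual_section xi -> D1 (ell xi) = D2 (ell xi)) -> D1 = D2.
Proof.
move=> H1 H2; have [f [xi [Y [sf dxi _ /nbhs_singleton YE]]]] := tot_frame q.
rewrite (YE D1) (YE D2); congr (_ + _); apply: eq_bigr => i _.
  by rewrite H1.
by rewrite H2.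
Qed.

Lemma tot_smooth_vf (X : forall q : tot E, tangent q) :
  (forall f, smooth_fun f -> smooth_fun (fun q => X q (fun p => f (bproj p)))) ->
  (forall xi, dual_section xi -> smooth_fun (fun q => X q (ell xi))) ->
  smooth_sec (v := tangent_bundle (tot E)) X.
Proof.
move=> H1 H2 g sg; apply/smooth_funP => q0.
have [f [xi [Y [sf dxi sY YE]]]] := tot_frame q0.
have : smooth_at (fun q => \sum_i X q (fun p => f i (bproj p)) * Y (lshift k i) q g
            + \sum_i X q (ell (xi i)) * Y (rshift n i) q g) q0.
  apply: smooth_atD; apply: smooth_at_sum => i; apply: smooth_atM; apply: smooth_fun_at.
  - exact: H1.
  - exact: sY.
  - exact: H2.
  - exact: sY.
apply: smooth_at_ext; apply: filterS YE => q H.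
by rewrite [in RHS](H (X q)) tanvD !tanv_sum.
Qed.

End Bundle.

(** * Horizontal and vertical lifts *)

Section Vertical.
Context {R : realType} {n : nat} {M : manifold R n} {k : nat} {E : vector_bundle M k}.

(** In the chart of the total space the curve is a straight line. *)
Lemma vert_derivable (q : tot E) (w : bfib E (bproj q)) f : smooth_fun f ->
  derivable (fun t : R^o => f (bpt (bvec q + t *: w)) : R^o) 0 1.
Proof.
move=> sf; have [c [e [C [T cx]]]] := trivialization_at E (bproj q).
have [ac _ [aC CE] _] := T.
have sfC := sf C aC.
have CL t : f (bpt (bvec q + t *: w)) =
    (f \o cinv C) (cmap C q + t *: row_mx 0 (fcoord e w)).
  have Cb : cdom C (bpt (bvec q + t *: w)) by rewrite CE /= bproj_pt.
  rewrite /= (cmap_tot T cx) scale_row_mx scaler0 add_row_mx addr0.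
  have := fcoord_linear T cx t w (bvec q); rewrite addrC => H.
  by rewrite addrC -H -(cmap_bpt T) // cmapK // addrC.
rewrite (_ : (fun t => _) = (fun t : R^o =>
    (f \o cinv C : _ -> R^o) (cmap C q + t *: row_mx 0 (fcoord e w)))); last first.
  by apply/funext => t; exact: CL.
have Cq : cimg C (cmap C q) by exists q => //; exact: (cdom_tot T cx).
have df : differentiable (f \o cinv C : _ -> R^o)
    (cmap C q + (0 : R) *: row_mx 0 (fcoord e w)).
  by rewrite scale0r addr0; exact: (sfC [::] (cmap C q) Cq).
by have [] := is_derive_line df.
Qed.

Lemma vertE (q : tot E) (w : bfib E (bproj q)) f : smooth_fun f ->
  vert w f = 'D_1 (fun t : R^o => f (bpt (bvec q + t *: w)) : R^o) 0.
Proof.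
rewrite -derive1E; pose L g : R^o -> R^o := fun t => g (bpt (bvec q + t *: w)).
have dL g : smooth_fun g -> derivable (L g) 0 1 by move=> sg; exact: vert_derivable.
have L0 g : L g 0 = g q by rewrite /L scale0r addr0 bptK.
apply: (@tangent_ofE R _ _ q (fun f => derive1 (L f) 0)) => [r g h sg sh|g h sg sh].
  rewrite !derive1E; have dg := dL g sg; have dh := dL h sh.
  transitivity ('D_1 (r *: L g + L h) 0) => //.
  by rewrite (deriveD (derivableZ (k := r) dg) dh) (deriveZ r dg).
rewrite !derive1E; have dg := dL g sg; have dh := dL h sh.
transitivity ('D_1 (L g * L h) 0) => //.
by rewrite (deriveM dg dh) !L0 /GRing.scale /= addrC [h q * _]mulrC.
Qed.

Lemma vert_pullback (q : tot E) (w : bfib E (bproj q)) f : smooth_fun f ->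
  vert w (fun p => f (bproj p)) = 0.
Proof.
move=> sf; rewrite vertE; last exact: smooth_pullback.
rewrite (_ : (fun t => _) = cst (f (bproj q))); first exact: derive_cst.
by apply/funext => t; rewrite bproj_pt.
Qed.

Lemma vert_ell (q : tot E) (w : bfib E (bproj q)) xi : dual_section xi ->
  vert w (ell xi) = xi _ w.
Proof.
move=> dxi; rewrite vertE; last exact: dxi.2.
have -> : (fun t : R^o => ell xi (bpt (bvec q + t *: w)) : R^o) =
    cst (xi _ (bvec q) : R^o) + (fun t : R^o => t *: (xi _ w : R^o)).
  by apply/funext => t; rewrite ell_bpt (dualD dxi) (dualZ dxi).
have d1 : is_diff (0 : R^o) (fun t : R^o => t *: (xi _ w : R^o)) (fun t => t *: (xi _ w : R^o)).
  exact: is_diff_scalel.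
have [e1 e2] := d1.
rewrite deriveD ?derive_cst ?add0r; [|exact: derivable_cst|exact: diff_derivable].
by rewrite deriveE // e2 scale1r.
Qed.

Lemma vert_linear (q : tot E) : linear (@vert R n M k E q).
Proof.
move=> r u v; apply: tot_tangent_eq => [f sf|xi dxi]; rewrite tanvD tanvZ.
  by rewrite (vert_pullback _ sf) (vert_pullback u sf) (vert_pullback v sf) mulr0 addr0.
by rewrite (vert_ell _ dxi) (vert_ell u dxi) (vert_ell v dxi) dxi.1.
Qed.

Lemma vert0 (q : tot E) : vert (0 : bfib E (bproj q)) = 0.
Proof.
apply: tot_tangent_eq => [f sf|xi dxi]; first by rewrite vert_pullback.
by rewrite vert_ell // dual0.
Qed.

Lemma smooth_vert s : smooth_sec (v := bundle_family E) s ->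
  smooth_sec (v := tangent_bundle (tot E)) (fun q : tot E => vert (s (bproj q))).
Proof.
move=> ss; apply: tot_smooth_vf => [f sf|xi dxi].
  rewrite (_ : (fun q => _) = fun=> 0); first exact: smooth_fun_cst.
  by apply/funext => q; rewrite vert_pullback.
rewrite (_ : (fun q => _) = fun q : tot E => xi _ (s (bproj q))).
  exact: (smooth_pullback (dual_smooth dxi ss)).
by apply/funext => q; rewrite vert_ell.
Qed.

End Vertical.

Section Horizontal.
Context {R : realType} {n : nat} {M : manifold R n} {k : nat} {E : vector_bundle M k}.
Local Notation section := (forall x, bfib E x).
Local Notation smooth := (smooth_sec (v := bundle_family E)).
Local Notation smooth_vf := (smooth_sec (v := tangent_bundle M)).
Variable nabla : covariant E.
Hypothesis conn : is_connection nabla.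

Lemma nablaL x (u v : tangent x) r (s : section) : smooth s ->
  nabla (r *: u + v) s = r *: nabla u s + nabla v s.
Proof. by have [H _ _ _] := conn; move=> ss; exact: H. Qed.

Lemma nablaD x (u : tangent x) (s t : section) : smooth s -> smooth t ->
  nabla u (fun y => s y + t y) = nabla u s + nabla u t.
Proof.
move=> ss st; have [_ H _ _] := conn; have := H x u 1 s t ss st.
rewrite scale1r => <-; congr (nabla u _).
by apply: functional_extensionality_dep => y; rewrite scale1r.
Qed.

Lemma nablaM x (u : tangent x) f (s : section) : smooth_fun f -> smooth s ->
  nabla u (fun y => f y *: s y) = u f *: s x + f x *: nabla u s.
Proof. by have [_ _ H _] := conn; exact: H. Qed.

Lemma nabla_smooth X s : smooth_vf X -> smooth s -> smooth (fun x => nabla (X x) s).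
Proof. by have [_ _ _ H] := conn; exact: H. Qed.

Lemma nabla0 x (s : section) : smooth s -> nabla (0 : tangent x) s = 0.
Proof.
move=> ss; have := nablaL (0 : tangent x) 0 1 ss; rewrite scaler0 addr0 scale1r => E0.
by apply: (addrI (nabla (0 : tangent x) s)); rewrite addr0 {3}E0.
Qed.

Lemma nabla_section0 x (u : tangent x) : nabla u (fun=> 0) = 0.
Proof.
have := nablaM u (smooth_fun_cst 0) (section_0 E).
rewrite scaler0 scale0r addr0 => <-; congr (nabla u _).
by apply: functional_extensionality_dep => y; rewrite scale0r.
Qed.

(** ** The dual connection *)

(** The covariant derivative of [xi] for the dual connection, evaluated on [s]; it
    depends on [s] only through its value at [x]. *)
Definition dual_nabla_along (xi : forall x, bfib E x -> R) x (u : tangent x) (s : section) : R^o :=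
  u (fun y => xi y (s y)) - xi x (nabla u s).

Lemma dual_nabla_along_eq xi x (u : tangent x) (s t : section) : dual_section xi ->
  smooth s -> smooth t -> s x = t x -> dual_nabla_along xi u s = dual_nabla_along xi u t.
Proof.
move=> dxi ss st st_x.
apply: (@tensor_pointwise R n M (bundle_family E) R^o (dual_nabla_along xi u) x) => //.
- exact: bundle_module.
- exact: bundle_generated.
- move=> a b sa sb; rewrite /dual_nabla_along nablaD // (dualD dxi).
  rewrite (_ : (fun y => xi y (a y + b y)) = fun y => xi y (a y) + xi y (b y)).
    rewrite derD; [|exact: dual_smooth|exact: dual_smooth].
    by rewrite opprD addrACA.
  by apply/funext => y; rewrite (dualD dxi).
- move=> f a sf sa; rewrite /dual_nabla_along nablaM // (dualD dxi) !(dualZ dxi).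
  rewrite (_ : (fun y => xi y (f y *: a y)) = fun y => f y * xi y (a y)).
    rewrite derM //; last exact: dual_smooth.
    by rewrite /GRing.scale /=; ring.
  by apply/funext => y; rewrite (dualZ dxi).
Qed.

Definition dual_nabla (xi : forall x, bfib E x -> R) x (u : tangent x) (v : bfib E x) : R :=
  dual_nabla_along xi u (s2val (cid2 (section_extend v))).

Lemma dual_nablaE xi x (u : tangent x) (s : section) : dual_section xi -> smooth s ->
  dual_nabla xi u (s x) = u (fun y => xi y (s y)) - xi x (nabla u s).
Proof.
move=> dxi ss; rewrite /dual_nabla; case: (cid2 _) => t st tx /=.
exact: dual_nabla_along_eq.
Qed.

Lemma dual_nablaL xi x (u w : tangent x) r v : dual_section xi ->
  dual_nabla xi (r *: u + w) v = r * dual_nabla xi u v + dual_nabla xi w v.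
Proof.
move=> dxi; have [s ss <-] := section_extend v.
by rewrite !dual_nablaE // nablaL // (dualD dxi) (dualZ dxi) tanvD tanvZ; ring.
Qed.

Lemma dual_nabla_section xi X : dual_section xi -> smooth_vf X ->
  dual_section (fun x v => dual_nabla xi (X x) v).
Proof.
move=> dxi sX; split=> [x r u v|].
  have [s ss <-] := section_extend u; have [t st <-] := section_extend v.
  have srs := section_Z (smooth_fun_cst r) ss.
  have := dual_nablaE (X x) dxi (section_D srs st) => /= ->.
  rewrite !dual_nablaE // nablaD // nablaM //; last exact: smooth_fun_cst.
  rewrite der_cst scale0r add0r (dualD dxi) (dualZ dxi).
  rewrite (_ : (fun y => xi y (r *: s y + t y)) = fun y => r * xi y (s y) + xi y (t y)).
    rewrite derZD; [|exact: dual_smooth|exact: dual_smooth].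
    by ring.
  by apply/funext => y; rewrite (dualD dxi) (dualZ dxi).
apply/smooth_funP => q0.
have [s [eta [ss deta etaE]]] := bundle_frame E (bproj q0).
pose h i x : R := X x (fun y => xi y (s i y)) - xi x (nabla (X x) (s i)).
have sh i : smooth_fun (h i).
  apply: smooth_funB; first by apply: sX; exact: dual_smooth.
  by apply: (dual_smooth dxi); exact: nabla_smooth.
(* by linearity the coordinates of the derivative of [xi] in a frame are the [h i] *)
have : smooth_at (fun q : tot E => \sum_i ell (eta i) q * h i (bproj q)) q0.
  apply: smooth_at_sum => i; apply: smooth_fun_at; apply: smooth_funM.
    exact: (deta i).2.
  exact: smooth_pullback.
apply: smooth_at_ext.
have : \forall q \near q0, forall v : bfib E (bproj q), v = \sum_i eta i _ v *: s i (bproj q).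
  by have := bproj_continuous etaE.
apply: filterS => q H.
have se : smooth (fun x => \sum_i eta i _ (bvec q) *: s i x).
  by apply: section_sum => i; exact: (section_Z (smooth_fun_cst _) (ss i)).
rewrite /ell [in RHS](H (bvec q)).
have := dual_nablaE (X (bproj q)) dxi se => /= ->.
have -> : nabla (X (bproj q)) (fun x => \sum_i eta i _ (bvec q) *: s i x) =
    \sum_i eta i _ (bvec q) *: nabla (X (bproj q)) (s i).
  have [_ HL _ _] := conn.
  pose a i := eta i _ (bvec q); rewrite -/(a _).
  suff HS m (b : 'I_m -> R) (t : 'I_m -> section) : (forall i, smooth (t i)) ->
    nabla (X (bproj q)) (fun x => \sum_i b i *: t i x) =
    \sum_i b i *: nabla (X (bproj q)) (t i) by exact: HS.
  elim: m b t => [|m IH] b t st.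
    rewrite big_ord0 -[RHS](nabla_section0 (X (bproj q))); congr (nabla _ _).
    by apply: functional_extensionality_dep => y; rewrite big_ord0.
  rewrite big_ord_recl -IH // -HL //; last first.
    by apply: section_sum => i; exact: (section_Z (smooth_fun_cst _) (st _)).
  congr (nabla _ _).
  by apply: functional_extensionality_dep => y; rewrite big_ord_recl.
rewrite (_ : (fun y => xi y _) = fun y => \sum_i eta i _ (bvec q) * xi y (s i y)).
  rewrite der_sum; last first.
    by move=> i; apply: smooth_funM; [exact: smooth_fun_cst|exact: dual_smooth].
  rewrite (dual_sum dxi) -sumrB; apply: eq_bigr => i _.
  rewrite derZ; last exact: dual_smooth.
  by rewrite (dualZ dxi) /h mulrBr.
apply/funext => y; rewrite (dual_sum dxi); apply: eq_bigr => i _.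
by rewrite (dualZ dxi).
Qed.

(** ** Horizontal lifts *)

(** A section through [q] that is parallel in the direction [u]: correct an
    arbitrary section through [q] by a function vanishing at the base point
    with derivative one along [u]. *)
Lemma parallel_section (q : tot E) (u : tangent (bproj q)) : exists s : section,
  [/\ smooth s, s (bproj q) = bvec q & nabla u s = 0].
Proof.
have [s ss sq] := section_extend (bvec q).
have [u0|/eqP u0] := eqVneq u 0.
  by exists s; split=> //; rewrite u0 nabla0.
have [f sf uf] : exists2 f, smooth_fun f & u f != 0.
  apply: contrapT => H; apply: u0; apply: tangent_eq => f sf.
  by apply/eqP; apply: contrapT => /negP uf; apply: H; exists f.
pose g (y : M) : R := (u f)^-1 * (f y - f (bproj q)).
have sc := @smooth_fun_cst R n M.
have sg : smooth_fun g by apply: smooth_funM => //; exact: smooth_funB.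
have ug : u g = 1.
  rewrite /g derZ; last exact: smooth_funB.
  by rewrite derB // der_cst subr0 mulVf.
have gq : g (bproj q) = 0 by rewrite /g subrr mulr0.
have [z sz zq] := section_extend (nabla u s).
have sng : smooth_fun (fun y => -1 * g y) by exact: smooth_funM.
exists (fun y => s y + (-1 * g y) *: z y); split.
- by apply: section_D => //; exact: section_Z.
- by rewrite gq mulr0 scale0r addr0.
- rewrite nablaD //; last exact: section_Z.
  rewrite nablaM // derZ // ug gq mulr0 scale0r addr0 mulr1 zq scaleN1r.
  by rewrite subrr.
Qed.

(** The derivation [f |-> u (f o s)], for the parallel section [s], is a possible
    value of the choice made in [hor]. *)
Lemma hor_section (q : tot E) (u : tangent (bproj q)) : exists s : section,
  [/\ smooth s, s (bproj q) = bvec q, nabla u s = 0 &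
      forall f, smooth_fun f -> hor nabla u f = u (fun x => f (bpt (s x)))].
Proof.
have [s [ss sq ns]] := parallel_section u.
have sc f : smooth_fun f -> smooth_fun (fun x => f (bpt (s x) : tot E)).
  by move=> sf; exact: (smooth_map_comp ss sf).
pose w : tangent q := tangent_of q (fun f => u (fun x => f (bpt (s x)))).
pose P := [set w : tangent q | exists s : forall x, bfib E x,
    [/\ smooth s, s (bproj q) = bvec q, nabla u s = 0 &
        forall f, smooth_fun f -> w f = u (fun x => f (bpt (s x)))]].
have Pw : P w.
  exists s; split=> //; apply: tangent_ofE => [r g h sg sh|g h sg sh].
    by rewrite derZD //; exact: sc.
  by rewrite derM ?sq ?bptK //; exact: sc.
exact: (xgetI 0 Pw).
Qed.

Lemma hor_pullback (q : tot E) (u : tangent (bproj q)) f : smooth_fun f ->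
  hor nabla u (fun p => f (bproj p)) = u f.
Proof.
move=> sf; have [s [ss sq ns ->]] := hor_section u; last exact: smooth_pullback.
by congr (Defs.tval u _); apply/funext => x; rewrite bproj_pt.
Qed.

Lemma hor_ell (q : tot E) (u : tangent (bproj q)) xi : dual_section xi ->
  hor nabla u (ell xi) = dual_nabla xi u (bvec q).
Proof.
move=> dxi; have [s [ss sq ns ->]] := hor_section u; last exact: dxi.2.
rewrite -sq dual_nablaE // ns (dual0 dxi) subr0.
by congr (Defs.tval u _); apply/funext => x; rewrite ell_bpt.
Qed.

Lemma hor_linear (q : tot E) : linear (@hor R n M k E nabla q).
Proof.
move=> r u v; apply: tot_tangent_eq => [f sf|xi dxi]; rewrite tanvD tanvZ.
  by rewrite !hor_pullback // tanvD tanvZ.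
by rewrite !hor_ell // dual_nablaL.
Qed.

Lemma horD (q : tot E) (u v : tangent (bproj q)) : hor nabla (u + v) = hor nabla u + hor nabla v.
Proof. by have := hor_linear 1 u v; rewrite !scale1r. Qed.

Lemma hor0 (q : tot E) : hor nabla (0 : tangent (bproj q)) = 0.
Proof.
have := horD (0 : tangent (bproj q)) 0; rewrite addr0 => E0.
by apply: (addrI (hor nabla (0 : tangent (bproj q)))); rewrite addr0 {3}E0.
Qed.

Lemma horZ (q : tot E) r (u : tangent (bproj q)) : hor nabla (r *: u) = r *: hor nabla u.
Proof. by have := hor_linear r u 0; rewrite hor0 !addr0. Qed.

Lemma horB (q : tot E) (u v : tangent (bproj q)) : hor nabla (u - v) = hor nabla u - hor nabla v.
Proof. by rewrite horD -scaleN1r horZ scaleN1r. Qed.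

(** The projection of [hor nabla u] to the base is [u]. *)
Lemma hor_inj0 (q : tot E) (u : tangent (bproj q)) : hor nabla u = 0 -> u = 0.
Proof.
move=> h0; apply: tangent_eq => f sf.
by rewrite -hor_pullback // h0.
Qed.

Lemma smooth_hor X : smooth_vf X ->
  smooth_sec (v := tangent_bundle (tot E)) (fun q : tot E => hor nabla (X (bproj q))).
Proof.
move=> sX; apply: tot_smooth_vf => [f sf|xi dxi].
  rewrite (_ : (fun q => _) = fun q : tot E => X (bproj q) f).
    by apply: (smooth_pullback (f := fun x => X x f)); exact: sX.
  by apply/funext => q; rewrite hor_pullback.
rewrite (_ : (fun q => _) = ell (fun x v => dual_nabla xi (X x) v)).
  by have [] := dual_nabla_section dxi sX.
by apply/funext => q; rewrite hor_ell.
Qed.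

(** On functions pulled back from the base the vertical term vanishes and both
    sides are [lie X Y]. On [ell xi] the bracket acts through the commutator of
    dual covariant derivatives, and the curvature of the dual connection is
    minus the transpose of [Rn]: whence the sign. *)
Lemma lie_hor Rn X Y (q : tot E) : is_connection_curvature nabla Rn ->
  smooth_vf X -> smooth_vf Y ->
  lie (fun q : tot E => hor nabla (X (bproj q))) (fun q : tot E => hor nabla (Y (bproj q))) q =
  hor nabla (lie X Y (bproj q)) - vert (Rn (bproj q) (X (bproj q)) (Y (bproj q)) (bvec q)).
Proof.
move=> curv sX sY; have shX := smooth_hor sX; have shY := smooth_hor sY.
apply: tot_tangent_eq => [f sf|xi dxi]; rewrite tanvB.
  have sp := smooth_pullback (E := E) sf.
  rewrite vert_pullback // subr0 hor_pullback // lieE // lieE //.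
  have H Z : smooth_vf Z -> (fun p : tot E => hor nabla (Z (bproj p)) (fun p => f (bproj p)))
     = fun p => Z (bproj p) f.
    by move=> sZ; apply/funext => p; rewrite hor_pullback.
  rewrite !H // (hor_pullback _ (f := fun x => Y x f)); last exact: sY.
  by rewrite (hor_pullback _ (f := fun x => X x f)) //; exact: sX.
have [s ss sq] := section_extend (bvec q).
rewrite vert_ell // hor_ell // lieE //; last exact: dxi.2.
have H Z : smooth_vf Z -> (fun p : tot E => hor nabla (Z (bproj p)) (ell xi)) =
    ell (fun x v => dual_nabla xi (Z x) v).
  by move=> sZ; apply/funext => p; rewrite hor_ell.
have dX := dual_nabla_section dxi sX; have dY := dual_nabla_section dxi sY.
rewrite !H // !hor_ell // -sq.
have snX := nabla_smooth sX ss; have snY := nabla_smooth sY ss.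
rewrite !dual_nablaE // -/(nabla _ _).
have HZ Z : smooth_vf Z -> (fun y => dual_nabla xi (Z y) (s y)) =
    fun y => Z y (fun z => xi z (s z)) - xi y (nabla (Z y) s).
  by move=> sZ; apply/funext => y; rewrite dual_nablaE.
have cXn := dual_nablaE (X (bproj q)) dxi snY.
have cYn := dual_nablaE (Y (bproj q)) dxi snX.
rewrite !HZ // cXn cYn.
have sxs : smooth_fun (fun z => xi z (s z)) by exact: dual_smooth.
rewrite !derB; try by [exact: sX|exact: sY|exact: dual_smooth].
rewrite (curv X Y s) // lieE //.
have dB v w : xi (bproj q) (v - w) = xi _ v - xi _ w.
  by rewrite (dualD dxi) -scaleN1r (dualZ dxi) mulN1r.
rewrite !dB; ring.
Qed.

End Horizontal.

(** ** The lift of sections of [TM (+) E] *)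

Section Phi.
Context {R : realType} {n : nat} {M : manifold R n} {k : nat} {E : vector_bundle M k}.
Variable nabla : covariant E.
Hypothesis conn : is_connection nabla.
Local Notation smooth := (smooth_sec (v := TM_plus_E E)).

Lemma smooth_phi a : smooth a -> smooth_sec (v := tangent_bundle (tot E)) (phi nabla a).
Proof.
move=> [s1 s2]; apply: smooth_vfD; first exact: (smooth_hor conn s1).
exact: (smooth_vert s2).
Qed.

Lemma sum_section_extend x (z : TM_plus_E E x) : exists2 a, smooth a & a x = z.
Proof.
case: z => u v; have [X sX Xx] := vector_extend u; have [s ss sx] := section_extend v.
by exists (fun y => (X y, s y)); [split|rewrite /= Xx sx].
Qed.

(** Subtracting the horizontal lift of the projection of a tangent vector
    leaves a vector that kills pulled back functions, and its values on
    fibrewise linear functions are those of a vertical lift. *)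
Lemma hor_vert_decomposition (q : tot E) (D : tangent q) :
  exists (u : tangent (bproj q)) (v : bfib E (bproj q)), D = hor nabla u + vert v.
Proof.
pose u : tangent (bproj q) := tangent_of (bproj q) (fun f => D (fun p => f (bproj p))).
have uE f : smooth_fun f -> u f = D (fun p => f (bproj p)).
  apply: tangent_ofE => [r g h sg sh|g h sg sh].
    by rewrite (derZD D r (smooth_pullback (E := E) sg) (smooth_pullback (E := E) sh)).
  by rewrite (derM D (smooth_pullback (E := E) sg) (smooth_pullback (E := E) sh)).
pose D' := D - hor nabla u.
have D'0 f : smooth_fun f -> D' (fun p => f (bproj p)) = 0.
  by move=> sf; rewrite tanvB hor_pullback // uE // subrr.
have [s [xi [ss dxi sE]]] := bundle_frame E (bproj q).
pose v := \sum_i D' (ell (xi i)) *: s i (bproj q).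
exists u, v; rewrite -[LHS](subrK (hor nabla u)) addrC; congr (_ + _).
rewrite -/D'; apply: tot_tangent_eq => [f sf|eta deta].
  by rewrite D'0 // vert_pullback.
rewrite vert_ell // /v (dual_sum deta).
have sw i : smooth_fun (fun x => eta x (s i x)) by exact: dual_smooth.
have -> : D' (ell eta) = D' (fun p => \sum_i ell (xi i) p * eta _ (s i (bproj p))).
  apply: der_local; first exact: deta.2.
    apply: smooth_fun_sum => i; apply: smooth_funM; first exact: (dxi i).2.
    exact: (smooth_pullback (E := E) (sw i)).
  have : \forall p \near q, forall w : bfib E (bproj p), w = \sum_i xi i _ w *: s i (bproj p).
    by have := bproj_continuous sE.
  apply: filterS => p H; rewrite /ell {1}(H (bvec p)) (dual_sum deta).
  by apply: eq_bigr => i _; rewrite (dualZ deta).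
rewrite der_sum; last first.
  move=> i; apply: smooth_funM; first exact: (dxi i).2.
  exact: (smooth_pullback (E := E) (sw i)).
apply: eq_bigr => i _; rewrite (dualZ deta) derM; last 2 first.
- exact: (dxi i).2.
- exact: (smooth_pullback (E := E) (sw i)).
by rewrite (D'0 _ (sw i)) mulr0 addr0.
Qed.

Lemma phi_onto (q : tot E) (D : tangent q) : exists2 a, smooth a & phi nabla a q = D.
Proof.
have [u [v ->]] := hor_vert_decomposition D.
have [a sa aq] := sum_section_extend ((u, v) : TM_plus_E E (bproj q)).
exists a; first exact: sa.
by rewrite /phi aq.
Qed.

End Phi.

(** * Metric algebroids *)

(** If the functional, as a row of values on a spanning family, were not in the
    row space of the Gram matrix, then some column killed by the Gram matrix
    would not be killed by it, against non-degeneracy. *)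
Lemma riesz_finite (R : fieldType) (V : lmodType R) m (b : 'I_m -> V)
    (B : V -> V -> R) (alpha : V -> R) :
  (forall v, exists r : 'I_m -> R, v = \sum_i r i *: b i) ->
  (forall u, scalar (B u)) -> (forall u v, B u v = B v u) ->
  (forall u, (forall v, B u v = 0) -> u = 0) -> scalar alpha ->
  exists u, forall v, B u v = alpha v.
Proof.
move=> span Bl Bs Bn al.
have lin_sum (f : V -> R) (r : 'I_m -> R) : scalar f ->
    f (\sum_i r i *: b i) = \sum_i r i * f (b i).
  move=> fl; pose fM := GRing.isLinear.Build _ _ _ _ _ fl.
  pose F : {scalar V} := HB.pack f fM.
  rewrite -[f]/(F : V -> R) linear_sum; apply: eq_bigr => i _.
  by rewrite linearZ.
pose G := \matrix_(i < m, j < m) B (b i) (b j).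
pose al_row := \row_(j < m) alpha (b j).
have /submxP[r rE] : (al_row <= G)%MS.
  rewrite submxE; apply/eqP/rowP => j; rewrite [RHS]mxE.
  pose z i := cokermx G i j; pose v := \sum_i z i *: b i.
  have v0 : v = 0.
    apply: Bn => w; have [s ->] := span w; rewrite (lin_sum (B v)) //.
    rewrite big1 // => i _; rewrite Bs /v (lin_sum (B (b i))) //.
    have E : (G *m cokermx G) i j = 0 by rewrite mulmx_coker mxE.
    suff -> : \sum_l z l * B (b i) (b l) = 0 by rewrite mulr0.
    rewrite -[RHS]E [RHS]mxE; apply: eq_bigr => l _.
    by rewrite [G i l]mxE mulrC.
  have a0 : alpha 0 = 0.
    have := al 1 0 0; rewrite scaler0 addr0 mul1r => E.
    by apply: (addrI (alpha 0)); rewrite addr0 {3}E.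
  rewrite mxE -[RHS]a0 -v0 /v lin_sum //.
  by apply: eq_bigr => l _; rewrite [al_row _ _]mxE mulrC.
exists (\sum_i r 0 i *: b i) => v; have [s ->] := span v.
rewrite (lin_sum (B _)) // (lin_sum alpha) //; apply: eq_bigr => j _; congr (_ * _).
have := congr1 (fun N : 'rV[R]_m => N 0 j) rE; rewrite !mxE => ->.
rewrite Bs (lin_sum (B (b j))) //.
by apply: eq_bigr => i _; rewrite mxE Bs.
Qed.

Section Lie.
Context {R : realType} {n : nat} {M : manifold R n}.
Local Notation smooth_vf := (smooth_sec (v := tangent_bundle M)).
Implicit Types X Y Z : forall x : M, tangent x.

Lemma lieN X Y x : smooth_vf X -> smooth_vf Y -> lie X Y x = - lie Y X x.
Proof.
move=> sX sY; apply: tangent_eq => f sf.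
by rewrite tanvN !lieE // opprB.
Qed.

Lemma lieDr X Y Z x : smooth_vf X -> smooth_vf Y -> smooth_vf Z ->
  lie X (fun y => Y y + Z y) x = lie X Y x + lie X Z x.
Proof.
move=> sX sY sZ; apply: tangent_eq => f sf.
rewrite tanvD !lieE //; last exact: smooth_vfD.
rewrite tanvD (_ : (fun y => (Y y + Z y) f) = fun y => Y y f + Z y f) //.
by rewrite derD; [ring|exact: sY|exact: sZ].
Qed.

Lemma lieZr X Y g x : smooth_vf X -> smooth_vf Y -> smooth_fun g ->
  lie X (fun y => g y *: Y y) x = X x g *: Y x + g x *: lie X Y x.
Proof.
move=> sX sY sg; apply: tangent_eq => f sf.
rewrite tanvD !tanvZ !lieE //; last exact: smooth_vfZ.
rewrite tanvZ (_ : (fun y => (g y *: Y y) f) = fun y => g y * Y y f) //.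
by rewrite derM //; [ring|exact: sY].
Qed.

Lemma lieDl X Y Z x : smooth_vf X -> smooth_vf Y -> smooth_vf Z ->
  lie (fun y => X y + Y y) Z x = lie X Z x + lie Y Z x.
Proof.
move=> sX sY sZ; rewrite (lieN x (smooth_vfD sX sY) sZ) (lieDr x sZ sX sY).
by rewrite (lieN x sX sZ) (lieN x sY sZ) opprD.
Qed.

Lemma lieZl X Y g x : smooth_vf X -> smooth_vf Y -> smooth_fun g ->
  lie (fun y => g y *: X y) Y x = - (Y x g *: X x) + g x *: lie X Y x.
Proof.
move=> sX sY sg; rewrite (lieN x (smooth_vfZ sg sX) sY) (lieZr x sY sX sg).
by rewrite (lieN x sX sY) opprD scalerN.
Qed.

Lemma lie0l Y x : smooth_vf Y -> lie (fun=> 0) Y x = 0.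
Proof.
move=> sY; apply: tangent_eq => f sf; rewrite lieE //; last exact: smooth_vf0.
rewrite tanv0 sub0r (_ : (fun y => (0 : tangent y) f) = fun=> 0) //.
by rewrite der_cst oppr0.
Qed.

End Lie.

Section Algebroid.
Context {R : realType} {n : nat} {M : manifold R n}.
Variables (V : vfamily M) (A : algebroid_tuple V).
Local Notation section := (forall x, fib V x).
Local Notation smooth := (@smooth_sec R n M V).
Local Notation rho a := (fun x => anchor A (a x)).
Local Notation "<< a , b >>" := (fun x => pairing A (a x) (b x)).

(** A [vfamily] carries no bundle axioms; these are the ones that the algebroid
    calculus uses, and tangent bundles and [TM_plus_E] satisfy them. *)
Definition bundle_like : Prop :=
  [/\ smooth_module V,
      forall x (z : V x), exists2 a : section, smooth a & a x = z &
      forall x, exists m (b : 'I_m -> V x), forall v, exists r : 'I_m -> R,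
        v = \sum_i r i *: b i].

Hypotheses (VB : bundle_like) (tA : is_tuple A).

Lemma smoothD (a b : section) : smooth a -> smooth b -> smooth (fun x => a x + b x).
Proof. by have [[H _] _ _] := VB; exact: H. Qed.

Lemma smoothZ f (a : section) : smooth_fun f -> smooth a -> smooth (fun x => f x *: a x).
Proof. by have [[_ H] _ _] := VB; exact: H. Qed.

Lemma section_through x (z : V x) : exists2 a : section, smooth a & a x = z.
Proof. by have [_ H _] := VB. Qed.

Lemma pairingC x (u v : V x) : pairing A u v = pairing A v u.
Proof. by have [[_ H _ _] _ _] := tA. Qed.

Lemma pairingDr x (u v w : V x) : pairing A u (v + w) = pairing A u v + pairing A u w.
Proof. by have [[H _ _ _] _ _] := tA; have := H x u 1 v w; rewrite scale1r mul1r. Qed.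

Lemma pairing0r x (u : V x) : pairing A u 0 = 0.
Proof.
have := pairingDr u 0 0; rewrite addr0 => E0.
by apply: (addrI (pairing A u 0)); rewrite addr0 {3}E0.
Qed.

Lemma pairingZr x (u v : V x) r : pairing A u (r *: v) = r * pairing A u v.
Proof.
by have [[H _ _ _] _ _] := tA; have := H x u r v 0; rewrite pairing0r !addr0.
Qed.

Lemma pairingDl x (u v w : V x) : pairing A (v + w) u = pairing A v u + pairing A w u.
Proof. by rewrite pairingC pairingDr !(pairingC u). Qed.

Lemma pairingZl x (u v : V x) r : pairing A (r *: v) u = r * pairing A v u.
Proof. by rewrite pairingC pairingZr (pairingC u). Qed.

Lemma pairingNl x (u v : V x) : pairing A (- v) u = - pairing A v u.
Proof. by rewrite -scaleN1r pairingZl mulN1r. Qed.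

Lemma pairing_inj x (u v : V x) : (forall w, pairing A u w = pairing A v w) -> u = v.
Proof.
move=> H; apply/eqP; rewrite -subr_eq0; apply/eqP.
have [[_ _ Bn _] _ _] := tA; apply: Bn => w.
by rewrite pairingDl pairingNl H subrr.
Qed.

Lemma pairing_smooth a b : smooth a -> smooth b -> smooth_fun << a, b >>.
Proof. by have [[_ _ _ H] _ _] := tA; exact: H. Qed.

Lemma anchorL x r (u v : V x) : anchor A (r *: u + v) = r *: anchor A u + anchor A v.
Proof. by have [_ [H _] _] := tA; exact: H. Qed.

Lemma anchorD x (u v : V x) : anchor A (u + v) = anchor A u + anchor A v.
Proof. by have := anchorL 1 u v; rewrite !scale1r. Qed.

Lemma anchor0 x : anchor A (0 : V x) = 0.
Proof.
have := anchorD (0 : V x) 0; rewrite addr0 => E0.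
by apply: (addrI (anchor A (0 : V x))); rewrite addr0 {3}E0.
Qed.

Lemma anchorZ x r (u : V x) : anchor A (r *: u) = r *: anchor A u.
Proof. by have := anchorL r u 0; rewrite anchor0 !addr0. Qed.

Lemma anchorN x (u : V x) : anchor A (- u) = - anchor A u.
Proof. by rewrite -scaleN1r anchorZ scaleN1r. Qed.

Lemma anchor_smooth a : smooth a -> smooth_sec (v := tangent_bundle M) (rho a).
Proof. by have [_ [_ H] _] := tA; exact: H. Qed.

Lemma bracket_smooth a b : smooth a -> smooth b -> smooth (bracket A a b).
Proof. by have [_ _ [H _ _]] := tA; exact: H. Qed.

Lemma bracketDl a b c x : smooth a -> smooth b -> smooth c ->
  bracket A (fun y => a y + b y) c x = bracket A a c x + bracket A b c x.
Proof.
move=> sa sb sc; have [_ _ [_ H _]] := tA.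
have := H 1 a b c sa sb sc x; rewrite scale1r => <-.
rewrite (_ : (fun y => 1 *: a y + b y) = fun y => a y + b y) //.
by apply: functional_extensionality_dep => y; rewrite scale1r.
Qed.

Lemma bracketDr a b c x : smooth a -> smooth b -> smooth c ->
  bracket A a (fun y => b y + c y) x = bracket A a b x + bracket A a c x.
Proof.
move=> sa sb sc; have [_ _ [_ _ H]] := tA.
have := H 1 a b c sa sb sc x; rewrite scale1r => <-.
rewrite (_ : (fun y => 1 *: b y + c y) = fun y => b y + c y) //.
by apply: functional_extensionality_dep => y; rewrite scale1r.
Qed.

Lemma pairing_anchor_dual x (alpha : tangent x -> R) : scalar alpha ->
  forall v, pairing A (anchor_dual A alpha) v = alpha (anchor A v).
Proof.
move=> al; have [_ _ fin] := VB; have [m [b span]] := fin x.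
have [[Bl Bs Bn _] _ _] := tA.
have ral : scalar (fun v : V x => alpha (anchor A v)).
  by move=> r u v; rewrite anchorL al.
have [u Pu] := riesz_finite span (Bl x) (Bs x) (Bn x) ral.
exact: (@xgetI _ 0 [set u : V x | forall v, pairing A u v = alpha (anchor A v)] u Pu).
Qed.

Lemma pairing_star f x v : pairing A (rho_star_d A f x) v = anchor A v f.
Proof. exact: (@pairing_anchor_dual x (fun u => u f)). Qed.

Lemma starD f g x : smooth_fun f -> smooth_fun g ->
  rho_star_d A (fun y => f y + g y) x = rho_star_d A f x + rho_star_d A g x.
Proof.
by move=> sf sg; apply: pairing_inj => w; rewrite pairingDl !pairing_star derD.
Qed.

Lemma starM f g x : smooth_fun f -> smooth_fun g ->
  rho_star_d A (fun y => f y * g y) x = f x *: rho_star_d A g x + g x *: rho_star_d A f x.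
Proof.
move=> sf sg; apply: pairing_inj => w.
by rewrite pairingDl !pairingZl !pairing_star derM //; ring.
Qed.

(** Expand (Ca2) for the sections [f b] and [c] and use non-degeneracy. *)
Lemma metric_Ca4 : Ca2 A -> Ca4 A.
Proof.
move=> C2 a b f sa sb sf x; apply: pairing_inj => w.
have [c sc <-] := section_through w.
have sfb := smoothZ sf sb.
have E1 := C2 a _ c sa sfb sc x; have E2 := C2 a b c sa sb sc x.
rewrite pairingDl !pairingZl.
have sbc := pairing_smooth sb sc.
move: E1; rewrite (_ : (fun y => pairing A (f y *: b y) (c y)) =
  fun y => f y * pairing A (b y) (c y)); last first.
  by apply/funext => y; rewrite pairingZl.
rewrite derM // E2 pairingZl => E1; apply: (addIr (f x * pairing A (b x) (bracket A a c x))).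
by rewrite -E1; ring.
Qed.

(** (Ca1) exchanges the two arguments in (Ca4). *)
Lemma metric_Ca5 : Ca1 A -> Ca4 A -> Ca5 A.
Proof.
move=> C1 C4 a b f sa sb sf x.
have sfa := smoothZ sf sa; have sab := pairing_smooth sa sb.
have := C1 _ b sfa sb x; rewrite C4 //.
rewrite (_ : (fun y => pairing A (f y *: a y) (b y)) =
  fun y => f y * pairing A (a y) (b y)); last first.
  by apply/funext => y; rewrite pairingZl.
rewrite starM // -(C1 a b sa sb x) => E; apply: pairing_inj => w.
have := congr1 (fun z => pairing A z w) E.
rewrite !(pairingDl, pairingZl, pairingNl) => Ew.
by apply: (addIr (anchor A (b x) f * pairing A (a x) w + f x * pairing A (bracket A b a x) w));
   rewrite Ew; ring.
Qed.

(** ** Tensoriality of the defects of the axioms *)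

Section Defects.
Hypothesis (LG : forall x, locally_generated V x).
Hypotheses (C4 : Ca4 A) (C5 : Ca5 A).

Definition symmetry_defect (a b : section) x : V x :=
  bracket A a b x + bracket A b a x - rho_star_d A << a, b >> x.

Definition invariance_defect (a b c : section) x : R^o :=
  rho a x << b, c >> - pairing A (bracket A a b x) (c x)
  - pairing A (b x) (bracket A a c x).

Definition curvature_defect (a b : section) x : tangent x :=
  rho (bracket A a b) x - lie (rho a) (rho b) x.

Lemma symmetry_defectC a b x : symmetry_defect a b x = symmetry_defect b a x.
Proof.
rewrite /symmetry_defect [bracket A a b x + _]addrC; congr (_ - rho_star_d A _ x).
by apply/funext => y; rewrite pairingC.
Qed.

Lemma symmetry_defect_pointwise a b b' x : smooth a -> smooth b -> smooth b' ->
  b x = b' x -> symmetry_defect a b x = symmetry_defect a b' x.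
Proof.
move=> sa sb sb' E; have [sm _ _] := VB.
apply: (@tensor_pointwise R n M V (V x) (fun b => symmetry_defect a b x) x) => //.
  move=> c d sc sd; rewrite /symmetry_defect bracketDr // bracketDl //.
  rewrite (_ : (fun y => pairing A (a y) (c y + d y)) = fun y =>
    pairing A (a y) (c y) + pairing A (a y) (d y)).
    rewrite starD; [|exact: pairing_smooth|exact: pairing_smooth].
    by apply: pairing_inj => w; rewrite !(pairingDl, pairingNl); ring.
  by apply/funext => y; rewrite pairingDr.
move=> f c sf sc; rewrite /symmetry_defect C4 // C5 //.
have sac := pairing_smooth sa sc.
rewrite (_ : (fun y => pairing A (a y) (f y *: c y)) = fun y =>
    f y * pairing A (a y) (c y)); last first.
  by apply/funext => y; rewrite pairingZr.
rewrite starM // (pairingC (c x)); apply: pairing_inj => w.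
by rewrite !(pairingDl, pairingZl, pairingNl); ring.
Qed.

(** The derivatives of [f] in (Ca5) for [[fa,b]] cancel against the term in
    [rho^* df] for [[fa,c]], and conversely. *)
Lemma invariance_defect_pointwise1 a a' b c x : smooth a -> smooth a' ->
  smooth b -> smooth c -> a x = a' x ->
  invariance_defect a b c x = invariance_defect a' b c x.
Proof.
move=> sa sa' sb sc E; have [sm _ _] := VB.
apply: (@tensor_pointwise R n M V R^o (fun a => invariance_defect a b c x) x) => //.
  move=> d e sd se; rewrite /invariance_defect !bracketDl // anchorD tanvD.
  by rewrite pairingDl pairingDr; ring.
move=> f d sf sd; rewrite /invariance_defect !C5 // anchorZ tanvZ.
rewrite !(pairingDl, pairingZl, pairingNl) pairing_star.
rewrite !(pairingC (b x)) !(pairingDl, pairingZl, pairingNl) pairing_star.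
by rewrite (pairingC (d x) (b x)) /GRing.scale /=; ring.
Qed.

Lemma invariance_defect_pointwise2 a b b' c x : smooth a -> smooth b ->
  smooth b' -> smooth c -> b x = b' x ->
  invariance_defect a b c x = invariance_defect a b' c x.
Proof.
move=> sa sb sb' sc E; have [sm _ _] := VB.
apply: (@tensor_pointwise R n M V R^o (fun b => invariance_defect a b c x) x) => //.
  move=> d e sd se; rewrite /invariance_defect bracketDr // !pairingDl.
  rewrite (_ : (fun y => pairing A (d y + e y) (c y)) = fun y =>
    pairing A (d y) (c y) + pairing A (e y) (c y)); last first.
    by apply/funext => y; rewrite pairingDl.
  by rewrite derD; [ring|exact: pairing_smooth|exact: pairing_smooth].
move=> f d sf sd; rewrite /invariance_defect C4 //.
rewrite (_ : (fun y => pairing A (f y *: d y) (c y)) = fun y =>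
    f y * pairing A (d y) (c y)); last first.
  by apply/funext => y; rewrite pairingZl.
rewrite derM //; last exact: pairing_smooth.
by rewrite !(pairingDl, pairingZl) /GRing.scale /=; ring.
Qed.

Lemma invariance_defectC a b c x :
  invariance_defect a b c x = invariance_defect a c b x.
Proof.
rewrite /invariance_defect addrAC; congr (_ - _ - _); try exact: pairingC.
by congr (Defs.tval _ _); apply/funext => y; rewrite pairingC.
Qed.

Lemma curvature_defect_pointwise2 a b b' x : smooth a -> smooth b -> smooth b' ->
  b x = b' x -> curvature_defect a b x = curvature_defect a b' x.
Proof.
move=> sa sb sb' E; have [sm _ _] := VB.
have sra := anchor_smooth sa.
apply: (@tensor_pointwise R n M V (tangent x) (fun b => curvature_defect a b x) x) => //.
  move=> c d sc sd; rewrite /curvature_defect bracketDr // anchorD.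
  rewrite (_ : (fun y => anchor A (c y + d y)) = fun y => anchor A (c y) + anchor A (d y)).
    by rewrite lieDr //; [rewrite opprD addrACA|exact: anchor_smooth|exact: anchor_smooth].
  by apply: functional_extensionality_dep => y; rewrite anchorD.
move=> f c sf sc; rewrite /curvature_defect C4 // anchorD !anchorZ.
rewrite (_ : (fun y => anchor A (f y *: c y)) = fun y => f y *: anchor A (c y)).
  rewrite lieZr //; last exact: anchor_smooth.
  by rewrite opprD addrACA subrr add0r -scalerBr.
by apply: functional_extensionality_dep => y; rewrite anchorZ.
Qed.

Hypothesis rho_star0 : forall f x, smooth_fun f -> anchor A (rho_star_d A f x) = 0.

(** In the first argument (Ca5) contributes the extra term
    [<a,b> rho(rho^* df)], removed by [rho_star0]. *)
Lemma curvature_defect_pointwise1 a a' b x : smooth a -> smooth a' -> smooth b ->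
  a x = a' x -> curvature_defect a b x = curvature_defect a' b x.
Proof.
move=> sa sa' sb E; have [sm _ _] := VB.
have srb := anchor_smooth sb.
apply: (@tensor_pointwise R n M V (tangent x) (fun a => curvature_defect a b x) x) => //.
  move=> c d sc sd; rewrite /curvature_defect bracketDl // anchorD.
  rewrite (_ : (fun y => anchor A (c y + d y)) = fun y => anchor A (c y) + anchor A (d y)).
    by rewrite lieDl //; [rewrite opprD addrACA|exact: anchor_smooth|exact: anchor_smooth].
  by apply: functional_extensionality_dep => y; rewrite anchorD.
move=> f c sf sc; rewrite /curvature_defect C5 // !anchorD anchorN !anchorZ.
rewrite rho_star0 // scaler0 addr0.
rewrite (_ : (fun y => anchor A (f y *: c y)) = fun y => f y *: anchor A (c y)).
  rewrite lieZl //; last exact: anchor_smooth.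
  by rewrite opprD addrACA subrr add0r -scalerBr.
by apply: functional_extensionality_dep => y; rewrite anchorZ.
Qed.

Definition extension x (z : V x) : section := s2val (cid2 (section_through z)).

Definition curvature_form x (u v : V x) : tangent x :=
  curvature_defect (extension u) (extension v) x.

Lemma extension_smooth x (z : V x) : smooth (extension z).
Proof. exact: (s2valP (cid2 (section_through z))). Qed.

Lemma extension_at x (z : V x) : extension z x = z.
Proof. exact: (s2valP' (cid2 (section_through z))). Qed.

Lemma curvature_formE a b x : smooth a -> smooth b ->
  curvature_form (a x) (b x) = curvature_defect a b x.
Proof.
move=> sa sb; rewrite /curvature_form.
rewrite (@curvature_defect_pointwise1 _ a) //; [|exact: extension_smooth|exact: extension_smooth|exact: extension_at].
by apply: curvature_defect_pointwise2 => //; [exact: extension_smooth|exact: extension_at].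
Qed.

(** Antisymmetry comes from applying [rho] to (Ca1), whose right-hand side is
    killed by [rho o rho^* = 0]. *)
Lemma curved_courant_of_metric : Ca1 A -> Ca2 A ->
  (forall x (u v : V x), anchor A u = 0 -> curvature_form u v = 0) ->
  curved_courant A curvature_form.
Proof.
move=> C1 C2 ker0; split=> //; last first.
  by move=> a b sa sb x; rewrite curvature_formE.
split.
- move=> x u r v w.
  have [[a sa <-] [b sb <-] [c sc <-]] :=
    And3 (section_through u) (section_through v) (section_through w).
  have sr := @smooth_fun_cst R n M r.
  have srb := smoothZ sr sb.
  rewrite (curvature_formE (b := fun y => r *: b y + c y)) //; last exact: smoothD.
  rewrite !curvature_formE // /curvature_defect bracketDr // anchorD.
  rewrite (C4 (f := fun=> r)) // der_cst scale0r add0r anchorZ.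
  rewrite (_ : (fun y => anchor A (r *: b y + c y)) =
     fun y => r *: anchor A (b y) + anchor A (c y)); last first.
    by apply: functional_extensionality_dep => y; rewrite anchorL.
  have [ra rb rc] := And3 (anchor_smooth sa) (anchor_smooth sb) (anchor_smooth sc).
  have rrb := smooth_vfZ sr rb.
  rewrite (lieDr _ ra rrb rc) (lieZr _ ra rb sr) der_cst scale0r add0r.
  by rewrite scalerBr opprD addrACA.
- move=> x u v.
  have [[a sa <-] [b sb <-]] := conj (section_through u) (section_through v).
  rewrite !curvature_formE // /curvature_defect.
  have := congr1 (@anchor _ _ _ _ A x) (C1 a b sa sb x).
  rewrite rho_star0 ?anchorD => [E|]; last exact: pairing_smooth.
  rewrite (lieN x (anchor_smooth sb) (anchor_smooth sa)) opprK opprD.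
  by congr (_ - _); apply/eqP; rewrite -addr_eq0 E.
- move=> a b sa sb.
  rewrite (_ : (fun x => _) = curvature_defect a b).
    apply: smooth_vfB; first by apply: anchor_smooth; exact: bracket_smooth.
    by apply: smooth_lie; exact: anchor_smooth.
  by apply: functional_extensionality_dep => x; rewrite curvature_formE.
Qed.

End Defects.

(** Since the curvature is a tensor, comparing [F(fa,b)] with [f F(a,b)] leaves
    [<a,b> rho(rho^* df) = 0]; if [rho^* df] is non-zero at [x], non-degeneracy
    provides [a] and [b] with [<a,b>] non-zero at [x]. *)
Lemma curved_rho_star0 F f x : curved_courant A F -> smooth_fun f ->
  anchor A (rho_star_d A f x) = 0.
Proof.
move=> [[_ C1 C2] [Fl Fa _] FE _] sf.
have C4 := metric_Ca4 C2; have C5 := metric_Ca5 C1 C4.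
set z := rho_star_d A f x.
have [z0|] := pselect (exists w, pairing A z w != 0); last first.
  move=> nw; have -> : z = 0; last exact: anchor0.
  have [[_ _ Bn _] _ _] := tA; apply: Bn => w.
  by apply/eqP; apply: contrapT => /negP zw; apply: nw; exists w.
have [w zw] := z0.
have [[a sa az] [b sb bw]] := conj (section_through z) (section_through w).
have sfa := smoothZ sf sa.
have Flin : F x (f x *: a x) (b x) = f x *: F x (a x) (b x).
  rewrite Fa; have F0 : F x (b x) 0 = 0.
    have := Fl x (b x) 1 0 0; rewrite scaler0 addr0 scale1r => E0.
    by apply: (addrI (F x (b x) 0)); rewrite addr0 {3}E0.
  have := Fl x (b x) (f x) (a x) 0; rewrite F0 !addr0 => ->.
  by rewrite -scalerN -Fa.
move: Flin; rewrite (FE _ b sfa sb) (FE a b sa sb) C5 // !anchorD anchorN !anchorZ.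
rewrite (_ : (fun y => anchor A (f y *: a y)) = fun y => f y *: anchor A (a y)); last first.
  by apply: functional_extensionality_dep => y; rewrite anchorZ.
rewrite lieZl //; [|exact: anchor_smooth|exact: anchor_smooth].
rewrite -/z az bw => E.
have : pairing A z w *: anchor A z = 0.
  apply: tangent_eq => g sg; have := congr1 (fun D : tangent x => D g) E.
  rewrite !(tanvD, tanvN, tanvB, tanvZ, tanv0) => Eg.
  by rewrite -[RHS](subrr (f x * (anchor A (bracket A a b x) g - lie (rho a) (rho b) x g))) -{1}Eg; ring.
by move=> /eqP; rewrite scaler_eq0 (negbTE zw) => /eqP.
Qed.

End Algebroid.

(** * The Courant algebroid lift *)

Section BundleLike.
Context {R : realType} {n : nat} {M : manifold R n}.

Lemma tangent_bundle_like : bundle_like (tangent_bundle M).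
Proof.
split; [exact: tangent_bundle_module|exact: vector_extend|move=> x].
have [xi [Y [_ YE]]] := tangent_span x.
by exists n, Y => v; exists (fun i => v (xi i)); exact: YE.
Qed.

(** A frame of the tangent space followed by a frame of the fibre spans. *)
Lemma TM_plus_E_like k (E : vector_bundle M k) : bundle_like (TM_plus_E E).
Proof.
split.
- have [D1 Z1] := tangent_bundle_module (M := M); have [D2 Z2] := bundle_module E.
  split=> [a b [sa1 sa2] [sb1 sb2]|f a sf [sa1 sa2]]; split.
  + exact: D1.
  + exact: D2.
  + exact: Z1.
  + exact: Z2.
- by move=> x z; exact: sum_section_extend.
- move=> x; have [xi [Y [_ YE]]] := tangent_span x.
  have [s [eta [_ deta /nbhs_singleton sE]]] := bundle_frame E x.
  exists (n + k)%N, (fun l => match fintype.split l with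
    | inl i => ((Y i, 0) : TM_plus_E E x) | inr i => ((0, s i x) : TM_plus_E E x) end).
  move=> [u v]; exists (fun l => match fintype.split l with
    | inl i => u (xi i) | inr i => eta i x v end).
  rewrite big_split_ord /=.
  under eq_bigr => i _ do rewrite -[lshift k i]/(unsplit (inl i)) unsplitK.
  under [X in _ = _ + X]eq_bigr => i _ do rewrite -[rshift n i]/(unsplit (inr i)) unsplitK.
  have S1 m (r : 'I_m -> R) (z : 'I_m -> tangent x) :
      \sum_i r i *: ((z i, 0) : TM_plus_E E x) = (\sum_i r i *: z i, 0) :> TM_plus_E E x.
    elim: m r z => [|m IH] r z; first by rewrite !big_ord0.
    by rewrite !big_ord_recl IH; congr pair; rewrite /= scaler0 addr0.
  have S2 m (r : 'I_m -> R) (z : 'I_m -> bfib E x) :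
      \sum_i r i *: ((0, z i) : TM_plus_E E x) = (0, \sum_i r i *: z i) :> TM_plus_E E x.
    elim: m r z => [|m IH] r z; first by rewrite !big_ord0.
    by rewrite !big_ord_recl IH; congr pair; rewrite /= scaler0 addr0.
  rewrite S1 S2; congr pair; rewrite /= ?addr0 ?add0r; first exact: YE.
  exact: sE.
Qed.

End BundleLike.

Section Lift.
Context {R : realType} {n k : nat} {M : manifold R n} {E : vector_bundle M k}.
Variables (A : algebroid_tuple (TM_plus_E E)) (nabla : covariant E)
  (L : algebroid_tuple (tangent_bundle (tot E))).
Hypotheses (tA : is_tuple A) (conn : is_connection nabla) (lift : is_lift A nabla L).
Local Notation smooth := (smooth_sec (v := TM_plus_E E)).
Local Notation VBA := (TM_plus_E_like E).
Local Notation VBL := (@tangent_bundle_like R _ (tot E)).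

Lemma lift_tuple : is_tuple L. Proof. by case: lift. Qed.

Lemma lift_pairing a b q : smooth a -> smooth b ->
  pairing L (phi nabla a q) (phi nabla b q) = pairing A (a (bproj q)) (b (bproj q)).
Proof. by case: lift => _ H _ _ _ sa sb; exact: H. Qed.

Lemma lift_anchor a q : smooth a ->
  anchor L (phi nabla a q) = hor nabla (anchor A (a (bproj q))).
Proof. by case: lift => _ _ H _ _ sa; exact: H. Qed.

Lemma lift_bracket a b : smooth a -> smooth b ->
  bracket L (phi nabla a) (phi nabla b) = phi nabla (bracket A a b).
Proof.
case: lift => _ _ _ H _ sa sb.
by apply: functional_extensionality_dep => q; exact: H.
Qed.

(** Both sides pair in the same way with every [phi b]: the anchor of [L] takes
    horizontal values, along which [g] is differentiated like [f]. *)
Lemma lift_star (g : tot E -> R) (f : M -> R) (q : tot E) a :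
  (forall u : tangent (bproj q), hor nabla u g = u f) -> smooth a ->
  a (bproj q) = rho_star_d A f (bproj q) ->
  rho_star_d L g q = phi nabla a q.
Proof.
move=> gf sa az; apply: (pairing_inj lift_tuple) => w.
have [b sb <-] := phi_onto conn w.
rewrite (pairing_star VBL lift_tuple) lift_pairing // az.
by rewrite (pairing_star VBA tA) lift_anchor // gf.
Qed.

(** As the anchor of [L] is horizontal, [rho^* dg] only depends on the
    restriction of [dg] to horizontal vectors at [q], and this restriction is
    the differential of a function on the base. *)
Lemma lift_rho_star0 (g : tot E -> R) q :
  (forall f x, smooth_fun f -> anchor A (rho_star_d A f x) = 0) ->
  anchor L (rho_star_d L g q) = 0.
Proof.
move=> A0; have [xi [Y [sxi YE]]] := tangent_span (bproj q).
(* a function on the base whose differential at the base point is the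
   restriction of that of [g] to horizontal vectors *)
pose f x : R := \sum_i hor nabla (Y i) g * xi i x.
have sc := @smooth_fun_cst R n M.
have sf : smooth_fun f by apply: smooth_fun_sum => i; exact: smooth_funM.
have gf (u : tangent (bproj q)) : hor nabla u g = u f.
  rewrite /f der_sum => [|i]; last exact: smooth_funM.
  rewrite {1}(YE u).
  have -> : hor nabla (\sum_i u (xi i) *: Y i) = \sum_i u (xi i) *: hor nabla (Y i).
    have S m (r : 'I_m -> R) (z : 'I_m -> tangent (bproj q)) :
        hor nabla (\sum_i r i *: z i) = \sum_i r i *: hor nabla (z i).
      elim: m r z => [|m IH] r z; first by rewrite !big_ord0 hor0.
      by rewrite !big_ord_recl (hor_linear conn) IH.
    exact: S.
  rewrite tanv_sum; apply: eq_bigr => i _.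
  by rewrite tanvZ derZ // mulrC.
have [a sa az] := sum_section_extend (rho_star_d A f (bproj q)).
by rewrite (lift_star gf sa az) lift_anchor // az A0 // hor0.
Qed.

Lemma lift_pairing_fun a b : smooth a -> smooth b ->
  (fun q => pairing L (phi nabla a q) (phi nabla b q)) =
  fun q : tot E => pairing A (a (bproj q)) (b (bproj q)).
Proof. by move=> sa sb; apply/funext => q; rewrite lift_pairing. Qed.

Lemma phiD a b q : phi nabla (fun x => a x + b x) q = phi nabla a q + phi nabla b q.
Proof.
rewrite /phi /= (horD conn) -addrACA; congr (_ + _).
by have := vert_linear 1 (a (bproj q)).2 (b (bproj q)).2; rewrite !scale1r.
Qed.

(** The defect is tensorial and every tangent vector is the value of a field
    [phi a], so that only fields of this form matter; there the axiom is the
    image under [phi] of the axiom of [A]. *)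
Lemma lift_Ca1 : Ca1 A -> Ca1 L.
Proof.
move=> C1; have [_ _ _ _ [C4 C5]] := lift.
have LG := tangent_bundle_generated (M := tot E).
move=> U W sU sW q.
suff : symmetry_defect L U W q = 0 by move=> /eqP; rewrite subr_eq0 => /eqP.
have [a sa aU] := phi_onto conn (U q); have [b sb bW] := phi_onto conn (W q).
have spa := smooth_phi conn sa; have spb := smooth_phi conn sb.
rewrite (symmetry_defect_pointwise VBL lift_tuple LG C4 C5 sU sW spb (esym bW)).
rewrite (symmetry_defectC lift_tuple).
rewrite (symmetry_defect_pointwise VBL lift_tuple LG C4 C5 spb sU spa (esym aU)).
rewrite (symmetry_defectC lift_tuple) /symmetry_defect !lift_bracket // -phiD.
have sab := bracket_smooth tA sa sb; have sba := bracket_smooth tA sb sa.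
rewrite (lift_pairing_fun sa sb).
rewrite (@lift_star _ (fun x => pairing A (a x) (b x)) q
  (fun x => bracket A a b x + bracket A b a x)) ?subrr //.
- by move=> u; apply: (hor_pullback conn); exact: (pairing_smooth tA).
- exact: (smoothD VBA).
- by rewrite C1.
Qed.

Lemma lift_Ca2 : Ca2 A -> Ca2 L.
Proof.
move=> C2; have [_ _ _ _ [C4 C5]] := lift.
have LG := tangent_bundle_generated (M := tot E).
move=> U W Z sU sW sZ q.
suff : invariance_defect L U W Z q = 0.
  by move=> /eqP; rewrite /invariance_defect -addrA -opprD subr_eq0 => /eqP.
have [a sa aU] := phi_onto conn (U q); have [b sb bW] := phi_onto conn (W q).
have [c sc cZ] := phi_onto conn (Z q).
have spa := smooth_phi conn sa; have spb := smooth_phi conn sb.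
have spc := smooth_phi conn sc.
rewrite (invariance_defect_pointwise1 VBL lift_tuple LG C5 sU spa sW sZ (esym aU)).
rewrite (invariance_defect_pointwise2 VBL lift_tuple LG C4 spa sW spb sZ (esym bW)).
rewrite (invariance_defectC lift_tuple).
rewrite (invariance_defect_pointwise2 VBL lift_tuple LG C4 spa sZ spc spb (esym cZ)).
rewrite (invariance_defectC lift_tuple) /invariance_defect !lift_bracket //.
have sab := bracket_smooth tA sa sb; have sac := bracket_smooth tA sa sc.
rewrite lift_pairing_fun // !lift_pairing // lift_anchor //.
rewrite (hor_pullback conn (anchor A (a (bproj q))) (pairing_smooth tA sb sc)).
by rewrite (C2 a b c sa sb sc (bproj q)); ring.
Qed.

Lemma lift_curvature Rn F a b q : is_connection_curvature nabla Rn ->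
  (forall a b, smooth a -> smooth b -> forall x,
     F x (a x) (b x) = curvature_defect A a b x) ->
  smooth a -> smooth b ->
  curvature_defect L (phi nabla a) (phi nabla b) q =
  hor nabla (F (bproj q) (a (bproj q)) (b (bproj q)))
  + vert (Rn (bproj q) (anchor A (a (bproj q))) (anchor A (b (bproj q))) (bvec q)).
Proof.
move=> curv FE sa sb; have sab := bracket_smooth tA sa sb.
have H c : smooth c -> (fun q => anchor L (phi nabla c q)) =
    fun q : tot E => hor nabla (anchor A (c (bproj q))).
  by move=> sc; apply: functional_extensionality_dep => p; rewrite lift_anchor.
rewrite /curvature_defect lift_bracket // lift_anchor // !H //.
rewrite (lie_hor conn q curv (anchor_smooth tA sa) (anchor_smooth tA sb)).
by rewrite FE // /curvature_defect (horB conn) opprB addrA addrAC.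
Qed.

End Lift.

Theorem proposition4p7 (R : realType) (n k : nat) (M : manifold R n)
    (E : vector_bundle M k)
    (A : algebroid_tuple (TM_plus_E E))
    (F : forall x : M, TM_plus_E E x -> TM_plus_E E x -> tangent x)
    (nabla : covariant E)
    (Rn : forall x : M, tangent x -> tangent x -> bfib E x -> bfib E x)
    (L : algebroid_tuple (tangent_bundle (tot E))) :
  curved_courant A F ->
  is_connection nabla ->
  is_connection_curvature nabla Rn ->
  is_lift A nabla L ->
  exists Fn : forall q : tot E, tangent q -> tangent q -> tangent q,
    curved_courant L Fn /\
    forall a b : (forall x, TM_plus_E E x),
      smooth_sec a -> smooth_sec b -> forall q : tot E,
      Fn q (phi nabla a q) (phi nabla b q) =
        hor nabla (F (bproj q) (a (bproj q)) (b (bproj q)))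
        + vert (Rn (bproj q) (anchor A (a (bproj q)))
                   (anchor A (b (bproj q))) (bvec q)).
Proof.
move=> cA conn curv lift.
have [[tA A1 A2] _ FE ker0] := cA.
have tL := lift_tuple lift; have [_ _ _ _ [C4 C5]] := lift.
have VBL := @tangent_bundle_like R _ (tot E).
have LG := tangent_bundle_generated (M := tot E).
have A0 f x : smooth_fun f -> anchor A (rho_star_d A f x) = 0.
  exact: (curved_rho_star0 (TM_plus_E_like E) tA x cA).
have L0 (g : tot E -> R) q : smooth_fun g -> anchor L (rho_star_d L g q) = 0.
  by move=> _; exact: (lift_rho_star0 tA conn lift).
have formula a b : smooth_sec a -> smooth_sec b -> forall q : tot E,
    curvature_form L VBL (phi nabla a q) (phi nabla b q) =
    hor nabla (F (bproj q) (a (bproj q)) (b (bproj q)))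
    + vert (Rn (bproj q) (anchor A (a (bproj q))) (anchor A (b (bproj q))) (bvec q)).
  move=> sa sb q.
  have spa := smooth_phi conn sa; have spb := smooth_phi conn sb.
  rewrite (curvature_formE VBL tL LG C4 C5 L0 q spa spb).
  exact: (lift_curvature tA conn lift).
exists (curvature_form L VBL); split=> //.
apply: curved_courant_of_metric => //.
- exact: (lift_Ca1 tA conn lift).
- exact: (lift_Ca2 tA conn lift).
move=> q u v; have [a sa <-] := phi_onto conn u; have [b sb <-] := phi_onto conn v.
rewrite (lift_anchor lift) // => /(hor_inj0 conn) a0.
rewrite formula // (ker0 _ _ _ a0) (hor0 conn) add0r a0.
have [s ss <-] := section_extend (bvec q).
have srb := anchor_smooth tA sb.
rewrite (curv (fun=> 0) _ s (smooth_vf0 (M := M)) srb ss).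
(* the curvature of [nabla] vanishes when one argument does *)
have -> : (fun y => nabla y 0 s) = fun=> 0.
  by apply: functional_extensionality_dep => y; rewrite (nabla0 conn).
have snb := nabla_smooth conn srb ss.
rewrite (nabla_section0 conn) (nabla0 conn _ snb) lie0l // (nabla0 conn _ ss).
by rewrite !subr0 vert0.
Qed.
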